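(* Any smooth projective curve is isomorphic to a curve in $\mathbb{P}^3$ that is Legendrian with respect to a contact structure on $\mathbb{P}^3$. In particular, any smooth projective curve can be embedded in $\mathbb{P}^3$ as an osculating self-dual curve.
   Context: The base field is $\mathbb{C}$; curves are irreducible. Points of $\mathbb{P}(E)$ are lines in the vector space $E$. Contact structure on $\mathbb{P}^3$: let $\mathbb{P}^3=\mathbb{P}(E)$, $\dim E=4$, and let $B$ be a non-degenerate skew-symmetric bilinear form on $E$. The contact structure on $\mathbb{P}(E)$ corresponding to $B$ assigns to each point $x=(v)$, $v\in E\setminus\{0\}$, the contact hyperplane $\mathcal{S}_x=\mathcal{T}_x\mathbb{P}(v^\perp)\subset\mathcal{T}_x\mathbb{P}(E)$, where $v^\perp$ is the skew-orthogonal complement of $v$ with respect to $B$. ''A contact structure on $\mathbb{P}^3$'' means the one corresponding to some such $B$. A curve $C\subset\mathbb{P}^3$ is Legendrian with respect to the contact structure if $\mathcal{T}_yC\subset\mathcal{S}_y$ for each smooth point $y\in C$. For a projective curve $C\subset\mathbb{P}^3$ not contained in a plane and a general point $x\in C$, there is a unique plane $\operatorname{Osc}^2_xC$ osculating to $C$ at $x$ to order $2$, i.e. containing $x$ and such that the restriction of its local equation to $C$ lies in $\mathfrak{m}_x^3$, where $\mathfrak{m}_x\subset\mathcal{O}_{x,C}$ is the maximal ideal. The osculating dual $C^\vee\subset(\mathbb{P}^3)^*$ is the closure of the set of points corresponding to the planes $\operatorname{Osc}^2_xC$ for general $x\in C$. The curve $C$ is called osculating self-dual if there is a projective (linear) isomorphism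 $\mathbb{P}^3\to(\mathbb{P}^3)^*$ mapping $C$ onto $C^\vee$; in particular an osculating self-dual curve is by definition not contained in a plane. *)

(* Defs.v *)
From HB Require Import structures.
From mathcomp Require Import all_boot all_order all_algebra.
From mathcomp Require Import boolp classical_sets reals.
From mathcomp Require Import complex.
From mathcomp Require Import mpoly.

Set Implicit Arguments.
Unset Strict Implicit.
Unset Printing Implicit Defensive.

Import GRing.Theory.
Local Open Scope classical_set_scope.
Local Open Scope ring_scope.

Section ProjectiveVarieties.
Variable K : fieldType.

(* P^n = P(K^(n+1)): points are the lines through the origin. *)
Definition proj (n : nat) : Type :=
  {L : {vspace 'rV[K]_n.+1} | \dim L == 1%N}.

(* A vector of homogeneous coordinates; everything below that is stated with
   [rep x] is independent of the choice, by homogeneity. *)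
Definition rep n (x : proj n) : 'rV[K]_n.+1 := vpick (val x).

Definition hom n (f : {mpoly K[n]}) : Prop := exists d, f \is d.-homog.

Definition ev n (f : {mpoly K[n]}) (v : 'rV[K]_n) : K := f.@[fun i => v 0 i].

Definition zclosed n (Z : set (proj n)) : Prop :=
  exists F : set {mpoly K[n.+1]}, (forall f, F f -> hom f) /\
    Z = [set x | forall f, F f -> ev f (rep x) = 0].

Definition zopen n (U : set (proj n)) : Prop := zclosed (~` U).

Definition zclosure n (S : set (proj n)) : set (proj n) :=
  [set x | forall Z, zclosed Z -> S `<=` Z -> Z x].

Definition irreducible n (X : set (proj n)) : Prop :=
  X !=set0 /\ forall A B, zclosed A -> zclosed B ->
    X `<=` A `|` B -> X `<=` A \/ X `<=` B.

(* Krull dimension of the closed set X. *)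
Definition has_chain n (X : set (proj n)) (d : nat) : Prop :=
  exists Z : nat -> set (proj n),
    (forall i, (i <= d)%N -> [/\ zclosed (Z i), irreducible (Z i) & Z i `<=` X])
    /\ (forall i, (i < d)%N -> Z i `<` Z i.+1).

Definition dimension n (X : set (proj n)) (d : nat) : Prop :=
  has_chain X d /\ ~ has_chain X d.+1.

Definition curve n (C : set (proj n)) : Prop :=
  [/\ zclosed C, irreducible C & dimension C 1].

(* T_x P(E) = Hom(x, E/x) is identified with E/x by evaluation at [rep x]; the
   subspace T_x X of E/x is represented by its preimage in E, which contains x
   and has dimension dim T_x X + 1. *)
Definition tangent n (X : set (proj n)) (x : proj n) : set 'rV[K]_n.+1 :=
  [set w | forall f, hom f -> (forall y, X y -> ev f (rep y) = 0) ->
     \sum_i ev (mderiv i f) (rep x) * w 0 i = 0].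

Definition smooth_at n (X : set (proj n)) (x : proj n) : Prop :=
  exists (d : nat) (V : {vspace 'rV[K]_n.+1}),
    [/\ dimension X d, forall w, w \in V <-> tangent X x w & \dim V = d.+1].

Definition smooth n (X : set (proj n)) : Prop :=
  forall x, X x -> smooth_at X x.

(* A map is given on all of P^n, but only its values on X are used.  Since
   [val (phi y)] has dimension 1, the F i have no common zero on X `&` U. *)
Definition regular_map n m (X : set (proj n)) (phi : proj n -> proj m) : Prop :=
  forall x, X x -> exists U, [/\ zopen U, U x &
    exists (d : nat) (F : 'I_m.+1 -> {mpoly K[n.+1]}),
      (forall i, F i \is d.-homog) /\
      forall y, X y -> U y -> val (phi y) = <[\row_i ev (F i) (rep y)]>%VS].

Definition isomorphic n m (X : set (proj n)) (Y : set (proj m)) : Prop :=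
  exists (phi : proj n -> proj m) (psi : proj m -> proj n),
    [/\ regular_map X phi, regular_map Y psi,
        forall x, X x -> Y (phi x) /\ psi (phi x) = x &
        forall y, Y y -> X (psi y) /\ phi (psi y) = y].

(* s represents a germ in the local ring O_{x,X}. *)
Definition regular_at n (X : set (proj n)) (x : proj n) (s : proj n -> K)
    : Prop :=
  exists U, [/\ zopen U, U x &
    exists (d : nat) (f g : {mpoly K[n.+1]}),
      [/\ f \is d.-homog, g \is d.-homog &
      forall y, X y -> U y ->
        ev g (rep y) != 0 /\ s y = ev f (rep y) / ev g (rep y)]].

Definition in_max_ideal n (X : set (proj n)) (x : proj n) (s : proj n -> K)
    : Prop :=
  regular_at X x s /\ s x = 0.

Definition in_max_ideal_pow n (X : set (proj n)) (x : proj n) (k : nat)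
    (s : proj n -> K) : Prop :=
  exists (N : nat) (c : 'I_N -> proj n -> K) (t : 'I_N -> 'I_k -> proj n -> K),
    [/\ forall i, regular_at X x (c i),
        forall i j, in_max_ideal X x (t i j) &
        exists U, [/\ zopen U, U x &
          forall y, X y -> U y -> s y = \sum_i c i y * \prod_j t i j y]].

(* P(E)^* in the dual coordinates: the class of a vector a stands for the
   hyperplane with equation \sum_i a_i x_i = 0. *)
Definition dual_proj (n : nat) : Type := proj n.

Definition pairing n (a v : 'rV[K]_n) : K := \sum_i a 0 i * v 0 i.

Definition hyperplane n (a : dual_proj n) : set (proj n) :=
  [set y | pairing (rep a) (rep y) = 0].

(* The local equation of the hyperplane near x is the quotient of its linear
   form by a linear form b not vanishing at x; another b changes it by a unit. *)
Definition osculates n (C : set (proj n)) (k : nat) (x : proj n)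
    (a : dual_proj n) : Prop :=
  hyperplane a x /\
  exists2 b : 'rV[K]_n.+1, pairing b (rep x) != 0 &
    in_max_ideal_pow C x k.+1
      (fun y => pairing (rep a) (rep y) / pairing b (rep y)).

(* D is the osculating dual of C: for x in some nonempty open subset U0 of C the
   osculating plane is unique, and D is the closure of the set of these planes,
   whichever nonempty open subset U of U0 the points are taken from. *)
Definition osculating_dual (C : set (proj 3)) (D : set (dual_proj 3)) : Prop :=
  exists U0, [/\ zopen U0, C `&` U0 !=set0,
    forall x, C x -> U0 x -> exists! a, osculates C 2 x a &
    forall U, zopen U -> U `<=` U0 -> C `&` U !=set0 ->
      D = zclosure [set a | exists2 x, (C `&` U) x & osculates C 2 x a]].

Definition linear_image n (M : 'M[K]_n.+1) (X : set (proj n))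
    : set (proj n) :=
  [set y | exists2 x, X x & val y = <[rep x *m M]>%VS].

Definition osculating_self_dual (C : set (proj 3)) : Prop :=
  [/\ curve C, ~ (exists a : dual_proj 3, C `<=` hyperplane a) &
    exists (D : set (dual_proj 3)) (M : 'M[K]_4),
      [/\ osculating_dual C D, M \in unitmx & linear_image M C = D]].

(* The bilinear form on K^4 with Gram matrix B. *)
Definition bform (B : 'M[K]_4) (v w : 'rV[K]_4) : K := (v *m B *m w^T) 0 0.

Definition contact_form (B : 'M[K]_4) : Prop :=
  (forall v w, bform B v w = - bform B w v) /\
  (forall v, (forall w, bform B v w = 0) -> v = 0).

(* P(v^\perp) for x = (v). *)
Definition perp (B : 'M[K]_4) (x : proj 3) : set (proj 3) :=
  [set y | bform B (rep x) (rep y) = 0].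

Definition contact_hyperplane (B : 'M[K]_4) (x : proj 3) : set 'rV[K]_4 :=
  tangent (perp B x) x.

Definition legendrian (B : 'M[K]_4) (C : set (proj 3)) : Prop :=
  forall y, C y -> smooth_at C y -> tangent C y `<=` contact_hyperplane B y.

End ProjectiveVarieties.

(* Main.v *)
(* Bryant's construction.  Let g and f be rational functions on C and let ' be the
   derivation of the function field with g' = 1.  The four functions
   Phi = (1, f - g f'/2, g, f'/2) satisfy Phi_0 Phi_1' - Phi_1 Phi_0' + Phi_2 Phi_3' - Phi_3 Phi_2' = 0,
   so the curve traced by Phi is Legendrian for the standard symplectic form B.

   To make Phi an embedding, let g = a/b be the quotient of two general linear forms, h a
   linear form with a zero on C, and N the polynomial whose roots are the branch values of
   g, and take f = N(g) ((l1 + l2 g) L0/b + L1/b) (b/h)^r with r = deg N + 1 and L0, L1, l1,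
   l2 general.  The factor N(g) keeps f' regular where g ramifies, and f'/2 is then a local
   parameter up to a constant there.  Where b = 0, dividing by g gives the limit
   (0 : e/2 : 1 : 0); where h = 0, the pole of f gives the limit (0 : - g : 0 : 1).  On a
   fibre of g, f and f' separate points: on the finite-over-P^1 set of pairs of points in
   a fibre all functions are algebraic over k(g), so the level sets of a function are
   finite for all but finitely many levels, which suffices to choose the parameters one
   after the other.

   An injective immersion is an isomorphism onto its image because every place of the
   function field has a centre on C.  Finally B(Phi(x), Phi) vanishes to order 3 at a
   general x, because B(Phi, Phi') = B(Phi, Phi'') = 0, so the osculating plane at x is
   the skew-orthogonal of Phi(x) and B maps the curve onto its osculating dual; the
   osculating plane is unique where f''' <> 0, and f''' <> 0 as f has a pole where h = 0. *)
Require Import Defs.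
From HB Require Import structures.
From mathcomp Require Import all_boot all_order all_algebra.
From mathcomp Require Import boolp classical_sets functions cardinality reals.
From mathcomp Require Import complex.
From mathcomp Require Import mpoly.
From mathcomp Require Import generic_quotient ring_quotient fraction.
From mathcomp Require Import zify ring.

Import Defs.

Set Implicit Arguments.
Unset Strict Implicit.
Unset Printing Implicit Defensive.

Import Order.TTheory GRing.Theory Num.Theory.
Local Open Scope ring_scope.

(** * Hilbert's basis theorem *)

(** In the chart (1 : z : x : y) the contact form is dz + x dy - y dx. Substituting z = f - x y
    turns it into df - 2 y dx, whence x = g, y = f'/2: the lift lists the contact elements of the
    plane curve (g, f). A coincidence of the lift on a fibre of g imposes two conditions, f(x) =
    f(y) and f'(x) = f'(y), on a one-dimensional family of pairs, so two parameters suffice to avoid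
    it. The factor l1 + l2 g is made for this: the first condition fixes its value at the pair, the
    second then fixes its derivative l2. The exponent r = deg N + 1 is forced where b = 0: since b/h
    is a/h divided by g, the power of b/h cancels every power of g in f but one, so that f/g stays
    finite. Smoothness is given by tangent spaces and curves by Krull dimension; both have to be
    turned into statements about the function field K, where points are partial k-morphisms from K
    to k, encoded by their graphs. Characteristic zero enters through the orders of vanishing that
    appear as factors under differentiation. *)

Definition noetherian (R : comNzRingType) : Prop :=
  forall a : nat -> R, exists (N : nat) (c : nat -> R),
    a N = \sum_(i < N) c i * a i.

Lemma noetherian_field (F : fieldType) : noetherian F.
Proof.
move=> a; have [a0|a0] := eqVneq (a 0%N) 0.
  by exists 0%N, (fun=> 0); rewrite big_ord0.
by exists 1%N, (fun=> a 1%N / a 0%N); rewrite big_ord1 divfK.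
Qed.

Lemma noetherian_surj (R S : comNzRingType) (f : {rmorphism R -> S}) :
  (forall y, exists x, f x = y) -> noetherian R -> noetherian S.
Proof.
move=> fsurj nR a; have [b bE] := choice fsurj.
have [N [c cE]] := nR (b \o a); exists N, (f \o c).
rewrite -[LHS]bE -[b _]/((b \o a) N) cE rmorph_sum.
by apply: eq_bigr => i _; rewrite rmorphM /= bE.
Qed.

Section HilbertBasis.
Variable R : comNzRingType.

Let gen (s : seq {poly R}) (f : {poly R}) :=
  exists c : nat -> {poly R}, f = \sum_(i < size s) c i * s`_i.

Let genD s f g : gen s f -> gen s g -> gen s (f + g).
Proof.
move=> [c ->] [d ->]; exists (fun i => c i + d i).
by rewrite -big_split; apply: eq_bigr => i _; rewrite mulrDl.
Qed.

Let genM s f g : gen s g -> gen s (f * g).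
Proof.
move=> [c ->]; exists (fun i => f * c i).
by rewrite mulr_sumr; apply: eq_bigr => i _; rewrite mulrA.
Qed.

Let gen0 s : gen s 0.
Proof. by exists (fun=> 0); rewrite big1 // => i _; rewrite mul0r. Qed.

Let gen_nth s i : (i < size s)%N -> gen s s`_i.
Proof.
move=> lti; exists (fun j => (j == i)%:R).
rewrite (bigD1 (Ordinal lti)) //= eqxx mul1r big1 ?addr0 // => j.
by rewrite -val_eqE /= => /negPf ->; rewrite mul0r.
Qed.

(* Pick each generator of least degree outside the ideal of the previous ones;
   a relation between leading coefficients then lowers that degree. *)
Lemma noetherian_poly : noetherian R -> noetherian {poly R}.
Proof.
move=> nR P; apply: contrapT => noP.
pose J f := exists N, gen (mkseq P N) f.
have wid N M h : gen (mkseq P N) h -> gen (mkseq P (N + M)) h.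
  move=> [c ->]; rewrite size_mkseq.
  elim/big_ind: _ => [|u v|i _]; first exact: gen0.
    exact: genD.
  rewrite nth_mkseq // -(@nth_mkseq _ 0 P (N + M)) ?ltn_addr //.
  by apply/genM/gen_nth; rewrite size_mkseq ltn_addr.
have JD f g : J f -> J g -> J (f + g).
  by move=> [N fN] [M gM]; exists (N + M)%N; apply: genD; [exact: wid|rewrite addnC; exact: wid].
have JM f g : J g -> J (f * g) by move=> [N gN]; exists N; apply: genM.
have JP N : J (P N).
  by exists N.+1; rewrite -(@nth_mkseq _ 0 P N.+1) //; apply: gen_nth; rewrite size_mkseq.
have notfg s : (forall f, f \in s -> J f) -> exists f, J f /\ ~ gen s f.
  move=> sJ; apply: contrapT => /forallNP sall.
  have {}sall f : J f -> gen s f by move=> Jf; have /not_andP[|/contrapT] := sall f.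
  have [N sN] : exists N, forall f, f \in s -> gen (mkseq P N) f.
    elim: s sJ {sall} => [|f s IHs] sJ; first by exists 0%N.
    have [N Ns] : exists N, forall f, f \in s -> gen (mkseq P N) f.
      by apply: IHs => g gs; apply: sJ; rewrite inE gs orbT.
    have [M Mf] := sJ f (mem_head _ _).
    exists (N + M)%N => g; rewrite inE => /orP[/eqP->|/Ns/wid//].
    by rewrite addnC; exact: wid.
  case: noP; exists N; have [c ->] := sall _ (JP N).
  suff [d ->] : gen (mkseq P N) (\sum_(i < size s) c i * s`_i).
    by exists d; rewrite size_mkseq; apply: eq_bigr => i _; rewrite nth_mkseq.
  elim/big_ind: _ => [|u v|i _]; first exact: gen0.
    exact: genD.
  by apply/genM/sN/mem_nth.
have pickP s : exists f, (forall g, g \in s -> J g) -> J f /\ ~ gen s f /\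
    forall g, J g -> ~ gen s g -> (size f <= size g)%N.
  have [sJ|?] := pselect (forall g, g \in s -> J g); last by exists 0.
  pose Q n := `[< exists f, [/\ J f, ~ gen s f & size f = n] >].
  have exQ : exists n, Q n.
    by have [f [Jf sf]] := notfg s sJ; exists (size f); apply/asboolP; exists f.
  have [_ /asboolP[f [Jf nf <-]] minf] := ex_minnP exQ.
  exists f => _; do 2!split=> //; move=> g Jg ng; apply: minf.
  by apply/asboolP; exists g.
have [pick pickE] := choice pickP.
pose fix sq k := if k is k'.+1 then rcons (sq k') (pick (sq k')) else [::].
pose f k := pick (sq k).
have sqE k : sq k = mkseq f k by elim: k => //= k IHk; rewrite mkseqS -IHk.
have fJ k : forall g, g \in sq k -> J g.
  elim: k => //= k IHk g; rewrite mem_rcons inE => /orP[/eqP->|/IHk//].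
  exact: (pickE _ IHk).1.
have fP k := pickE _ (fJ k).
have [N [c cE]] := nR (fun k => lead_coef (f k)).
have [JfN [nfN minN]] := fP N.
have fle i : (i < N)%N -> (size (f i) <= size (f N))%N.
  move=> ltiN; apply: (fP i).2.2 => // -[d dE]; apply: nfN.
  rewrite -/(f N) dE; elim/big_ind: _ => [|u v|j _]; first exact: gen0.
    exact: genD.
  have ltj : (j < i)%N by have := ltn_ord j; rewrite [X in (j < size X)%N]sqE size_mkseq.
  apply: genM; move: (nat_of_ord j) ltj => m ltj.
  have -> : (sq i)`_m = (sq N)`_m by rewrite !sqE !nth_mkseq // (ltn_trans ltj).
  by apply: gen_nth; rewrite sqE size_mkseq (ltn_trans ltj).
have fN0 : f N != 0.
  by apply/eqP=> f0; apply: nfN; rewrite -/(f N) f0; exact: gen0.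
pose h := \sum_(i < N) (c i)%:P * 'X^(size (f N) - size (f i)) * f i.
have genh : gen (sq N) h.
  rewrite /h; elim/big_ind: _ => [|u v|i _]; first exact: gen0.
    exact: genD.
  apply: genM; rewrite -(@nth_mkseq _ 0 f N) // -sqE.
  by apply: gen_nth; rewrite sqE size_mkseq.
have Jh : J h.
  case: genh => d ->; elim/big_ind: _ => [|u v|i _]; [|exact: JD|]; last first.
    by apply/JM/(fJ N)/mem_nth.
  by exists 0%N, (fun=> 0); rewrite big_ord0.
have ltsz : (size (f N - h)%R < size (f N))%N.
  have szf : (0 < size (f N))%N by rewrite lt0n size_poly_eq0.
  rewrite -(prednK szf) ltnS; apply/leq_sizeP => j lej.
  rewrite coefB coef_sum; have [->|nej] := eqVneq j (size (f N)).-1.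
    apply/eqP; rewrite subr_eq0; apply/eqP; rewrite -/(lead_coef _) [LHS]cE.
    apply: eq_bigr => i _; rewrite -mulrA coefCM coefXnM ltnNge.
    have lei := fle _ (ltn_ord i).
    have [fi0|fi0] := eqVneq (f i) 0.
      by rewrite fi0 lead_coef0 size_poly0 subn0 leqNgt prednK ?leqnn //= mulr0.
    rewrite -size_poly_gt0 in fi0.
    have [-> ->] : (size (f N) - size (f i) <= (size (f N)).-1)%N = true /\
        ((size (f N)).-1 - (size (f N) - size (f i)) = (size (f i)).-1)%N.
      by split; lia.
    by [].
  have ltj : (size (f N) <= j)%N by rewrite -(prednK szf) ltn_neqAle eq_sym nej.
  rewrite nth_default // big1 ?subr0 // => i _; rewrite -mulrA coefCM coefXnM.
  have lei := fle _ (ltn_ord i).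
  case: ifP => _; rewrite ?mulr0 // nth_default ?mulr0 //.
  by move: (size (f i)) (size (f N)) lei ltj => A B; lia.
have /minN : J (f N - h).
  by apply: JD => //; rewrite -mulN1r; apply: JM.
rewrite leqNgt ltsz => /(_ _)/negP; case; last by [].
by move=> gfN; apply: nfN; rewrite -[pick _](subrK h); exact: genD.
Qed.

End HilbertBasis.

(** Evaluating the outer variable at the last coordinate maps [{poly {mpoly F[n]}}] onto [{mpoly
    F[n.+1]}]. The sequence form of [noetherian] suits its uses: it is applied to the equations that
    successively cut down a chain of closed sets, and to the numerators of the quotients of a
    function by powers of a uniformizer. *)
Lemma noetherian_mpoly (F : fieldType) n : noetherian {mpoly F[n]}.
Proof.
elim: n => [|n IHn].
  apply: (@noetherian_surj F _ (@mpolyC 0 F)) (@noetherian_field F) => p.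
  by exists p@_0; apply/mpolyP => m; rewrite mcoeffC; have -> : m = 0%MM; [apply/mnmP; case|rewrite eqxx mulr1].
have cX : commr_rmorph (@mwiden n F) 'X_ord_max by move=> u; exact: mulrC.
pose f : {rmorphism {poly {mpoly F[n]}} -> {mpoly F[n.+1]}} := horner_morph cX.
have fC u : f u%:P = mwiden u := horner_morphC cX u.
apply: (@noetherian_surj _ _ f) (noetherian_poly IHn) => p.
elim/mpolyind: p => [|c m p _ _ [q qE]]; first by exists 0; rewrite rmorph0.
suff [r rE] : exists r, f r = 'X_[m].
  by exists ((c%:MP)%:P * r + q); rewrite rmorphD rmorphM fC rE qE mwidenC mul_mpolyC.
rewrite mpolyXE_id; elim/big_ind: _ => [|_ _ [u <-] [v <-]|i _].
- by exists 1; rewrite rmorph1.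
- by exists (u * v); rewrite rmorphM.
suff [r rE] : exists r, f r = 'X_i by exists (r ^+ m i); rewrite rmorphXn /= rE.
case: (unliftP ord_max i) => [j ->|->]; last first.
  by exists 'X; rewrite /f /= (horner_morphX cX).
exists ('X_j)%:P; rewrite fC mwidenX; congr 'X_[_].
by rewrite mnmwiden1; congr U_(_)%MM; apply/val_inj; rewrite /= /bump leqNgt ltn_ord.
Qed.

(** * Places and integrality *)

Section Places.
Variables (k : closedFieldType) (K : fieldType) (emb : {rmorphism k -> K}).
Implicit Types (H : K -> k -> Prop) (x y z : K) (c d : k).

(* The graph of a k-algebra morphism from a subring of K to k. *)
Record place_graph H : Prop := PlaceGraph {
  pgC : forall c, H (emb c) c;
  pgD : forall x c y d, H x c -> H y d -> H (x + y) (c + d);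
  pgM : forall x c y d, H x c -> H y d -> H (x * y) (c * d);
  pg0 : forall c, H 0 c -> c = 0
}.

Definition dom H x := exists c, H x c.

(** For a place graph, the domain is then a local ring whose maximal ideal consists of the elements
    of value 0. *)
Definition local_graph H := forall x c, H x c -> c != 0 -> H x^-1 c^-1.

Lemma pg00 H : place_graph H -> H 0 0.
Proof. by move=> gH; rewrite -[X in H X _](rmorph0 emb); exact: pgC. Qed.

Lemma pg11 H : place_graph H -> H 1 1.
Proof. by move=> gH; rewrite -[X in H X _](rmorph1 emb); exact: pgC. Qed.

Lemma pgN H x c : place_graph H -> H x c -> H (- x) (- c).
Proof.
move=> gH Hx; rewrite -mulN1r -[- c]mulN1r; apply: pgM => //.
by rewrite -[X in H X _](rmorphN1 emb); exact: pgC.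
Qed.

Lemma pgB H x c y d : place_graph H -> H x c -> H y d -> H (x - y) (c - d).
Proof. by move=> gH Hx Hy; apply: pgD => //; exact: pgN. Qed.

Lemma pgX H x c n : place_graph H -> H x c -> H (x ^+ n) (c ^+ n).
Proof.
by move=> gH Hx; elim: n => [|n IH]; [exact: pg11|rewrite !exprS; exact: pgM].
Qed.

Lemma pg_sum H (I : Type) (r : seq I) (P : pred I) (F : I -> K) (G : I -> k) :
  place_graph H -> (forall i, P i -> H (F i) (G i)) ->
  H (\sum_(i <- r | P i) F i) (\sum_(i <- r | P i) G i).
Proof.
by move=> gH FG; elim/big_ind2: _ => //; [exact: pg00|move=> *; exact: pgD].
Qed.

Lemma pg_prod H (I : Type) (r : seq I) (P : pred I) (F : I -> K) (G : I -> k) :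
  place_graph H -> (forall i, P i -> H (F i) (G i)) ->
  H (\prod_(i <- r | P i) F i) (\prod_(i <- r | P i) G i).
Proof.
by move=> gH FG; elim/big_ind2: _ => //; [exact: pg11|move=> *; exact: pgM].
Qed.

Lemma pg_fun H x c d : place_graph H -> H x c -> H x d -> c = d.
Proof.
move=> gH Hc Hd; apply/eqP; rewrite -subr_eq0; apply/eqP.
by apply: (pg0 gH); rewrite -(subrr x); exact: pgB.
Qed.

Lemma pg_neq0 H x c : place_graph H -> H x c -> c != 0 -> x != 0.
Proof.
by move=> gH Hx; apply: contra => /eqP x0; rewrite x0 in Hx; rewrite (pg0 gH Hx).
Qed.

Lemma pg_horner H (P : {poly k}) x c : place_graph H -> H x c ->
  H (map_poly emb P).[x] P.[c].
Proof.
move=> gH Hx; rewrite horner_coef size_map_poly horner_coef.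
apply: pg_sum => // i _; rewrite coef_map; apply: pgM => //; first exact: pgC.
exact: pgX.
Qed.

(** The ring generated by [dom H] and [z], with the value [t] prescribed at [z]; elements and values
    are carried by two parallel polynomials. The relation is single-valued only under the condition
    of [pext_graph]. *)
Definition pext H z t : K -> k -> Prop := fun x c =>
  exists (P : {poly K}) (Q : {poly k}),
    [/\ forall i, H P`_i Q`_i, x = P.[z] & c = Q.[t]].

Lemma pext_sub H z t x c : place_graph H -> H x c -> pext H z t x c.
Proof.
move=> gH Hx; exists x%:P, c%:P; split; rewrite ?hornerC // => i.
by rewrite !coefC; case: ifP => // _; exact: pg00.
Qed.

Lemma pext_gen H z t : place_graph H -> pext H z t z t.
Proof.
move=> gH; exists 'X, 'X; split; rewrite ?hornerX // => i.
by rewrite !coefX; case: (_ == _) => /=; [exact: pg11|exact: pg00].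
Qed.

Lemma pext_graph H z t : place_graph H ->
  (forall (P : {poly K}) (Q : {poly k}), (forall i, H P`_i Q`_i) ->
     P.[z] = 0 -> Q.[t] = 0) ->
  place_graph (pext H z t).
Proof.
move=> gH fH; split.
- by move=> c; apply: pext_sub => //; exact: pgC.
- move=> _ _ _ _ [P [Q [PQ -> ->]]] [P' [Q' [PQ' -> ->]]].
  exists (P + P'), (Q + Q'); split; rewrite ?hornerD // => i.
  by rewrite !coefD; exact: pgD.
- move=> _ _ _ _ [P [Q [PQ -> ->]]] [P' [Q' [PQ' -> ->]]].
  exists (P * P'), (Q * Q'); split; rewrite ?hornerM // => i.
  by rewrite !coefM; apply: pg_sum => // j _; exact: pgM.
- by move=> c [P [Q [PQ P0 ->]]]; exact: (fH P).
Qed.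

(** The kernel of [H] generates the unit ideal once [z] is adjoined, so no extension of [H] can be
    defined at [z]. *)
Definition pbad H z := exists P : {poly K},
  (forall i, H P`_i (1 : {poly k})`_i) /\ P.[z] = 0.

(** The residues of the polynomial relations satisfied by [z] form an ideal of k[X] without nonzero
    constants. A nonzero element of least degree generates it and has a root, k being algebraically
    closed; that root is an admissible value of [z]. *)
Lemma pbadPn H z : place_graph H -> ~ pbad H z ->
  exists t, place_graph (pext H z t).
Proof.
move=> gH nbad.
pose J (Q : {poly k}) := exists P : {poly K}, (forall i, H P`_i Q`_i) /\ P.[z] = 0.
have JC c : J c%:P -> c = 0.
  move=> [P [PQ P0]]; apply: contrapT => /eqP c0; apply: nbad.
  exists ((emb c^-1)%:P * P); split; last by rewrite hornerM P0 mulr0.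
  move=> i; rewrite coefCM; have -> : (1 : {poly k})`_i = c^-1 * c%:P`_i by rewrite -coefCM -polyCM mulVf.
  by apply: pgM => //; exact: pgC.
have JB Q Q' R : J Q -> J Q' -> J (Q - R * Q').
  move=> [P [PQ P0]] [P' [PQ' P0']]; exists (P - map_poly emb R * P'); split.
    move=> i; rewrite !coefB !coefM; apply: pgB => //; apply: pg_sum => // j _.
    by rewrite coef_map; apply: pgM => //; exact: pgC.
  by rewrite hornerD hornerN hornerM P0 P0' mulr0 subr0.
have [[Q [JQ Q0]]|none] := pselect (exists Q, J Q /\ Q != 0); last first.
  (* Every relation has residue zero here, so any value would do. *)
  exists 0; apply: pext_graph => // P Q PQ P0.
  have [->|Q0] := eqVneq Q 0; first by rewrite horner0.
  by case: none; exists Q; split=> //; exists P.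
pose S m := `[< exists Q, [/\ J Q, Q != 0 & size Q = m] >].
have exS : exists m, S m by exists (size Q); apply/asboolP; exists Q.
have [_ /asboolP[{JQ}q [Jq q0 <-]] minq] := ex_minnP exS.
have sq : size q != 1%N.
  apply/eqP => /eqP/size_poly1P[c c0 qc].
  by move: c0; rewrite (JC c) ?eqxx // -qc.
have /closed_rootP[t /rootP qt] := sq.
exists t; apply: pext_graph => // P Q' PQ P0.
have JQ' : J Q' by exists P.
have : J (Q' %% q).
  have -> : Q' %% q = Q' - (Q' %/ q) * q by rewrite {2}(divp_eq Q' q) addrC addKr.
  exact: JB.
have [r0 _|r0 Jr] := eqVneq (Q' %% q) 0.
  by rewrite (divp_eq Q' q) r0 addr0 hornerM qt mulr0.
have : (size q <= size (Q' %% q)%R)%N by apply: minq; apply/asboolP; exists (Q' %% q).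
by rewrite leqNgt ltn_modp q0.
Qed.

(* Chevalley's argument: of two relations for z and 1/z with constant term 1
   modulo the kernel, the shorter one lowers the degree of the longer one. *)
Lemma pbadV H z : place_graph H -> z != 0 -> ~ (pbad H z /\ pbad H z^-1).
Proof.
move=> gH z0 [[P [PQ P0]] [P' [PQ' P0']]].
have [N] := ubnP (size P + size P')%N.
elim: N z z0 P P' PQ PQ' P0 P0' => // N IHN z z0 P P' PQ PQ' P0 P0' ltN.
wlog lePP : z z0 P P' PQ PQ' P0 P0' ltN / (size P' <= size P)%N.
  move=> W; have [le|/ltnW le] := leqP (size P') (size P); first exact: (W z z0 P P').
  by apply: (W z^-1 _ P' P) => //; rewrite ?invrK ?invr_eq0 // addnC.
have sP : (1 < size P)%N.
  rewrite ltnNge; apply/negP => /size1_polyC PC; move: P0 (PQ 0%N).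
  rewrite PC hornerC coefC /= => -> /(pg0 gH)/eqP.
  by rewrite coef1 oner_eq0.
set n := (size P).-1.
have szP : size P = n.+1 by rewrite prednK // ltnW.
have n0 : n != 0%N by rewrite -lt0n; move: sP; rewrite szP.
pose R := \poly_(i < n.+1) P'`_(n - i).
have R0 : R.[z] = 0.
  rewrite horner_poly; transitivity (z ^+ n * P'.[z^-1]); last by rewrite P0' mulr0.
  rewrite (@horner_coef_wide _ n.+1) -?szP // szP mulr_sumr (reindex_inj rev_ord_inj) /=.
  apply: eq_bigr => i _; rewrite subSS subKn -1?ltnS // mulrCA; congr (_ * _).
  by rewrite exprVn expfB_cond // (negPf z0) add0n -ltnS.
have Pn0 : H P`_n 0 by have := PQ n; rewrite coef1 (negPf n0).
have P'01 : H P'`_0 1 by have := PQ' 0%N; rewrite coef1.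
(* [R] is z^n P'(1/z). The combination loses its term of degree n, and its residue is still 1
   because the constant coefficient of P' has value 1 and the leading coefficient of P has value
   0. *)
apply: (IHN z z0 (P'`_0 *: P - P`_n *: R) P') => //.
- move=> i; rewrite coefB !coefZ coef_poly -[X in H _ X]subr0.
  apply: pgB => //; first by rewrite -[X in H _ X]mul1r; exact: pgM.
  rewrite -[X in H _ X](mul0r (if (i < n.+1)%N then (1 : {poly k})`_(n - i) else 0)).
  by apply: pgM => //; case: ifP => // _; exact: pg00.
- by rewrite hornerD hornerN !hornerZ P0 R0 !mulr0 subr0.
- rewrite -ltnS; apply: leq_trans ltN; rewrite ltnS ltn_add2r szP ltnS; apply/leq_sizeP => j lej.
  rewrite coefB !coefZ coef_poly ltnS; case: ltngtP lej => // [ltnj|<-] _.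
    by have -> : P`_j = 0 by [rewrite nth_default ?szP]; rewrite !mulr0 subr0.
  by rewrite subnn mulrC subrr.
Qed.

Lemma place_extend H z : place_graph H -> z != 0 ->
  exists H', [/\ place_graph H', forall x c, H x c -> H' x c &
    dom H' z \/ dom H' z^-1].
Proof.
move=> gH z0; have [bz|/(pbadPn gH)[t gt]] := pselect (pbad H z); last first.
  exists (pext H z t); split=> // [x c|]; first exact: pext_sub.
  by left; exists t; exact: pext_gen.
have [bz'|/(pbadPn gH)[t gt]] := pselect (pbad H z^-1).
  by case: (pbadV gH z0).
exists (pext H z^-1 t); split=> // [x c|]; first exact: pext_sub.
by right; exists t; exact: pext_gen.
Qed.

(** [j] is an entry of least order at the extended place. A new entry [y] replaces it when the place
    extends to j/y rather than to y/j; a quotient by [y] is then a quotient by [j] times j/y. *)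
Lemma place_center_seq H (s : seq K) x0 : place_graph H -> x0 != 0 ->
  exists H', exists j, [/\ place_graph H', forall x c, H x c -> H' x c,
    j \in x0 :: s, j != 0 & forall x, x \in x0 :: s -> dom H' (x / j)].
Proof.
move=> gH x00; elim/last_ind: s => [|s y [H' [j [gH' HH' js j0 sH']]]].
  exists H, x0; split=> // [|x]; first exact: mem_head.
  by rewrite inE => /eqP->; rewrite divff //; exists 1; exact: pg11.
have [y0|y0] := eqVneq y 0.
  exists H', j; split=> //; first by rewrite -rcons_cons mem_rcons inE js orbT.
  move=> x; rewrite -rcons_cons mem_rcons inE => /orP[/eqP->|/sH'//].
  by rewrite y0 mul0r; exists 0; exact: pg00.
have yj0 : y / j != 0 by rewrite mulf_neq0 ?invr_eq0.
have [H2 [gH2 HH2 [[c yjc]|[c yjc]]]] := place_extend gH' yj0.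
  exists H2, j; split=> //; first by move=> x d /HH'/HH2.
    by rewrite -rcons_cons mem_rcons inE js orbT.
  move=> x; rewrite -rcons_cons mem_rcons inE => /orP[/eqP->|/sH'[d /HH2]].
    by exists c.
  by exists d.
exists H2, y; split=> //; first by move=> x d /HH'/HH2.
  by rewrite -rcons_cons mem_rcons inE eqxx.
move=> x; rewrite -rcons_cons mem_rcons inE => /orP[/eqP->|/sH'[d /HH2 xd]].
  by rewrite divff //; exists 1; exact: pg11.
have -> : x / y = x / j * (y / j)^-1 by rewrite invf_div mulrA divfK.
by exists (d * c); exact: pgM.
Qed.

Definition integral H x := exists P : {poly K},
  [/\ P \is monic, forall i, dom H P`_i & P.[x] = 0].

(** A relation for 1/x whose constant coefficient has nonzero value can be divided by that
    coefficient and multiplied by x^n, which gives a monic equation for x. Without such an equation,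
    1/x may be sent to 0. *)
Lemma pext_inv0 H x : place_graph H -> local_graph H -> x != 0 ->
  ~ integral H x -> place_graph (pext H x^-1 0).
Proof.
move=> gH lH x0 nint; apply: pext_graph => // P Q PQ P0.
rewrite horner_coef0; apply: contrapT => /eqP Q0; apply: nint.
have P00 := pg_neq0 gH (PQ 0%N) Q0.
have sP : (0 < size P)%N.
  by rewrite lt0n size_poly_eq0; apply: contra P00 => /eqP->; rewrite coef0.
set n := (size P).-1; have szP : size P = n.+1 by rewrite prednK.
exists ((P`_0)^-1 *: \poly_(i < n.+1) P`_(n - i)); split.
- apply/monicP; rewrite lead_coefZ lead_coef_poly ?subnn ?mulVf //.
- move=> i; rewrite coefZ coef_poly.
  exists ((Q`_0)^-1 * (if (i < n.+1)%N then Q`_(n - i) else 0)).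
  by apply: pgM => //; [exact: lH|case: ifP => // _; exact: pg00].
- rewrite hornerZ horner_poly; apply/eqP; rewrite mulf_eq0; apply/orP; right.
  apply/eqP; transitivity (x ^+ n * P.[x^-1]); last by rewrite P0 mulr0.
  rewrite horner_coef szP mulr_sumr (reindex_inj rev_ord_inj) /=.
  apply: eq_bigr => i _; rewrite subSS subKn -1?ltnS // mulrCA; congr (_ * _).
  by rewrite exprVn expfB_cond // (negPf x0) add0n -ltnS.
Qed.

(** * Finite modules generated by integral elements *)

Section Span.
Variable A : K -> Prop.

Definition span_of (e : seq K) x := exists r : nat -> K,
  (forall i, A (r i)) /\ x = \sum_(i < size e) r i * e`_i.

Hypotheses (A0 : A 0) (A1 : A 1) (AN : forall x, A x -> A (- x))
  (AD : forall x y, A x -> A y -> A (x + y))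
  (AM : forall x y, A x -> A y -> A (x * y)).

Lemma span_of0 e : span_of e 0.
Proof. by exists (fun=> 0); split=> //; rewrite big1 // => i _; rewrite mul0r. Qed.

Lemma span_ofD e x y : span_of e x -> span_of e y -> span_of e (x + y).
Proof.
move=> [r [Ar ->]] [s [As ->]]; exists (fun i => r i + s i); split; first by auto.
by rewrite -big_split; apply: eq_bigr => i _; rewrite mulrDl.
Qed.

Lemma span_ofM e a x : A a -> span_of e x -> span_of e (a * x).
Proof.
move=> Aa [r [Ar ->]]; exists (fun i => a * r i); split; first by auto.
by rewrite mulr_sumr; apply: eq_bigr => i _; rewrite mulrA.
Qed.

Lemma span_of_sum e n (F : nat -> K) :
  (forall i, (i < n)%N -> span_of e (F i)) -> span_of e (\sum_(i < n) F i).
Proof.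
move=> eF; elim/big_ind: _; [exact: span_of0|exact: span_ofD|move=> i _; exact: eF].
Qed.

Lemma span_of_mem e x : x \in e -> span_of e x.
Proof.
move=> /(nthP 0)[i lti <-]; exists (fun j => (j == i)%:R); split.
  by move=> j; case: (_ == _).
rewrite (bigD1 (Ordinal lti)) //= eqxx mul1r big1 ?addr0 // => j.
by rewrite -val_eqE /= => /negPf ->; rewrite mul0r.
Qed.

(** The generators are monomials in the elements of [s], each exponent bounded by the degree of a
    monic equation. The last clause records this form, so that properties closed under products pass
    from [s] to the generators. *)
Lemma integral_span (s : seq K) :
  (forall x, x \in s -> exists P : {poly K},
     [/\ P \is monic, forall i, A P`_i & P.[x] = 0]) ->
  exists e, [/\ forall x, A x -> span_of e x, forall x, x \in s -> span_of e x,
    forall x y, span_of e x -> span_of e y -> span_of e (x * y) &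
    forall B : K -> Prop, B 1 -> (forall x y, B x -> B y -> B (x * y)) ->
      (forall x, x \in s -> B x) -> forall x, x \in e -> B x].
Proof.
elim: s => [|t s IHs] intS.
  exists [:: 1]; split=> // [x Ax|x y|B B1 _ _ x]; last by rewrite inE => /eqP ->.
    by exists (fun=> x); split=> //; rewrite big_ord1 mulr1.
  move=> [r [Ar ->]] [q [Aq ->]]; exists (fun=> r 0%N * q 0%N); split; first by auto.
  by rewrite !big_ord1 !mulr1.
have [e [Ae se eM eB]] : exists e, [/\ forall x, A x -> span_of e x,
    forall x, x \in s -> span_of e x,
    forall x y, span_of e x -> span_of e y -> span_of e (x * y) &
    forall B : K -> Prop, B 1 -> (forall x y, B x -> B y -> B (x * y)) ->
      (forall x, x \in s -> B x) -> forall x, x \in e -> B x].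
  by apply: IHs => x xs; apply: intS; rewrite inE xs orbT.
have [P [Pm AP P0]] := intS t (mem_head _ _).
set m := (size P).-1.
have szP : size P = m.+1.
  by rewrite prednK // lt0n size_poly_eq0 monic_neq0.
pose e' := [seq y * t ^+ i | i <- iota 0 m, y <- e].
have sub1 i x : (i < m)%N -> span_of e x -> span_of e' (x * t ^+ i).
  move=> ltim [r [Ar ->]]; rewrite mulr_suml.
  apply: (@span_of_sum _ _ (fun j => r j * e`_j * t ^+ i)) => j ltj.
  rewrite -mulrA; apply: span_ofM => //; apply: span_of_mem.
  apply/allpairsP; exists (i, e`_j); split=> //=; first by rewrite mem_iota.
  exact: mem_nth.
have tm : t ^+ m = \sum_(i < m) - P`_i * t ^+ i.
  move: P0; rewrite horner_coef szP big_ord_recr /=.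
  have -> : P`_m = 1 by have /monicP := Pm; rewrite lead_coefE szP.
  rewrite mul1r addrC => /eqP; rewrite addr_eq0 => /eqP ->.
  by rewrite -sumrN; apply: eq_bigr => i _; rewrite mulNr.
have mult x : span_of e' x -> span_of e' (t * x).
  move=> [r [Ar ->]]; rewrite mulr_sumr.
  apply: (@span_of_sum _ _ (fun j => t * (r j * e'`_j))) => j ltj.
  rewrite mulrCA; apply: span_ofM => //.
  have /allpairsP[[i y] /= [im ye ->]] := mem_nth 0 ltj.
  rewrite mem_iota /= add0n in im.
  rewrite mulrCA -exprS; have [ltim|] := ltnP i.+1 m.
    by apply: sub1 => //; exact: span_of_mem.
  rewrite leq_eqVlt ltnNge im orbF => /eqP <-; rewrite tm mulr_sumr.
  apply: (@span_of_sum _ _ (fun j => y * (- P`_j * t ^+ j))) => l ltl.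
  rewrite mulrCA; apply: span_ofM; first exact: AN.
  by apply: sub1 => //; exact: span_of_mem.
have [m0|m0] := posnP m.
  exfalso; move: tm; rewrite m0 expr0 big_ord0 => /eqP; by rewrite oner_eq0.
have eM' x y : span_of e x -> span_of e' y -> span_of e' (x * y).
  move=> ex [r [Ar ->]]; rewrite mulr_sumr.
  apply: (@span_of_sum _ _ (fun j => x * (r j * e'`_j))) => j ltj.
  rewrite mulrCA; apply: span_ofM => //.
  have /allpairsP[[i z] /= [im ze ->]] := mem_nth 0 ltj.
  rewrite mem_iota /= add0n in im; rewrite mulrA; apply: sub1 => //.
  by apply: eM => //; exact: span_of_mem.
have sub0 x : span_of e x -> span_of e' x.
  by move=> ex; rewrite -[x]mulr1 -(expr0 t); exact: sub1.
have te : span_of e' t by rewrite -[t]mulr1; apply/mult/sub0/Ae.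
exists e'; split.
- by move=> x /Ae/sub0.
- by move=> x; rewrite inE => /orP[/eqP->//|/se/sub0].
- move=> x y [r [Ar ->]] ey; rewrite mulr_suml.
apply: (@span_of_sum _ _ (fun j => r j * e'`_j * y)) => j ltj.
rewrite -mulrA; apply: span_ofM => //.
have /allpairsP[[i z] /= [im ze ->]] := mem_nth 0 ltj.
rewrite -mulrA; apply: eM'; first exact: span_of_mem.
  by elim: i {im} => [|i IHi]; rewrite ?expr0 ?mul1r // exprS -mulrA; exact: mult.
move=> B B1 BM sB x /allpairsP[[i y] /= [_ ye ->]]; apply: (BM).
  by apply: eB => // z zs; apply: sB; rewrite inE zs orbT.
have Bt : B t by apply: sB; exact: mem_head.
by elim: i => [|i IHi]; rewrite ?expr0 // exprS; exact: BM.
Qed.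

End Span.

(* Nakayama's lemma, eliminating one generator at a time. *)
Lemma nakayama H (N : K -> Prop) (s : nat) (e : nat -> K) :
  place_graph H -> local_graph H ->
  (forall x y, N x -> N y -> N (x + y)) ->
  (forall a x, dom H a -> N x -> N (a * x)) ->
  (forall i, (i < s)%N -> exists (y : K) (r : nat -> K),
    [/\ N y, forall j, H (r j) 0 & e i = y + \sum_(j < s) r j * e j]) ->
  forall i, (i < s)%N -> N (e i).
Proof.
move=> gH lH ND NM; elim: s => // s IHs es.
have [y [r [Ny r0 eE]]] := es s (ltnSn s).
have H1 : H (1 - r s) 1 by rewrite -[X in H _ X]subr0; apply: pgB => //; exact: pg11.
have u0 : 1 - r s != 0 by apply: pg_neq0 H1 _; rewrite ?oner_eq0.
have Hu : H (1 - r s)^-1 1 by rewrite -[X in H _ X]invr1; apply: lH => //; rewrite oner_eq0.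
have {}eE : e s = (1 - r s)^-1 * y + \sum_(j < s) ((1 - r s)^-1 * r j) * e j.
  apply: (mulfI u0); rewrite mulrDr mulVKf // mulr_sumr.
  rewrite [X in X = _]mulrBl mul1r {1}eE big_ord_recr /= addrA addrK; congr (_ + _).
  by apply: eq_bigr => j _; rewrite -mulrA mulVKf.
have Nu a : N a -> N ((1 - r s)^-1 * a) by apply: NM; exists 1.
have Hur j : H ((1 - r s)^-1 * r j) 0 by rewrite -[X in H _ X](mul1r 0); exact: pgM.
have IH : forall i, (i < s)%N -> N (e i).
  apply: IHs => i ltis; have [z [q [Nz q0 ->]]] := es i (ltnW ltis).
  exists (z + q s * ((1 - r s)^-1 * y)), (fun j => q j + q s * ((1 - r s)^-1 * r j)).
  split.
  - by apply: ND => //; apply: NM; [exists 0|exact: Nu].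
  - by move=> j; rewrite -[0]addr0; apply: pgD => //; rewrite -[0](mul0r 0); exact: pgM.
  - rewrite big_ord_recr /= eE mulrDr mulr_sumr -addrA; congr (_ + _).
    rewrite addrCA -big_split; congr (_ + _); apply: eq_bigr => j _ /=.
    by rewrite mulrDl mulrA.
move=> i; rewrite ltnS leq_eqVlt => /orP[/eqP->|]; last exact: IH.
have N0 : N 0 by rewrite -(mul0r y); apply: NM => //; exists 0; exact: pg00.
rewrite eE; apply: (ND _ _ (Nu _ Ny)).
by apply: (big_ind N) => [||j _]; [exact: N0|exact: ND|apply: (NM); [exists 0|exact: IH]].
Qed.

End Places.

Local Open Scope classical_set_scope.

(** * Projective varieties *)

Section Forms.

Lemma mmap1_scale n (S : comNzRingType) (h : 'I_n -> S) (a : S) (m : 'X_{1..n}) :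
  mmap1 (fun i => a * h i) m = a ^+ mdeg m * mmap1 h m.
Proof.
rewrite /mmap1 mdegE -prodrXr -big_split /=.
by apply: eq_bigr => i _; rewrite exprMn.
Qed.

Lemma mmap_scale n (R : nzRingType) (S : comNzRingType) (f : {rmorphism R -> S})
    (h : 'I_n -> S) (a : S) d (F : {mpoly R[n]}) :
  F \is d.-homog -> mmap f (fun i => a * h i) F = a ^+ d * mmap f h F.
Proof.
move=> /dhomogP hF; rewrite /mmap mulr_sumr big_seq [RHS]big_seq.
by apply: eq_bigr => m /hF <-; rewrite mmap1_scale mulrCA.
Qed.

Lemma mmap_ext n (R S : nzRingType) (f : R -> S) (h1 h2 : 'I_n -> S) (F : {mpoly R[n]}) :
  h1 =1 h2 -> mmap f h1 F = mmap f h2 F.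
Proof.
move=> h12; apply: eq_bigr => m _; congr (_ * _).
by apply: eq_bigr => i _; rewrite h12.
Qed.

End Forms.

Section Points.
Variables (k : fieldType) (n : nat).
Implicit Types (x y : proj k n) (F G : {mpoly k[n.+1]}) (A B Z U V : set (proj k n)).

Lemma ev_scale F d (v : 'rV[k]_n.+1) a : F \is d.-homog ->
  ev F (a *: v) = a ^+ d * ev F v.
Proof.
move=> hF; rewrite /ev /meval -(mmap_scale idfun (fun i => v 0 i) a hF).
by apply: mmap_ext => i; rewrite mxE.
Qed.

Lemma evD F G (v : 'rV[k]_n.+1) : ev (F + G) v = ev F v + ev G v.
Proof. exact: mevalD. Qed.

Lemma ev_sum (I : Type) (r : seq I) (P : pred I) (F : I -> {mpoly k[n.+1]}) (v : 'rV[k]_n.+1) :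
  ev (\sum_(i <- r | P i) F i) v = \sum_(i <- r | P i) ev (F i) v.
Proof. exact: raddf_sum. Qed.

Lemma evM F G (v : 'rV[k]_n.+1) : ev (F * G) v = ev F v * ev G v.
Proof. exact: mevalM. Qed.

Lemma evXU (v : 'rV[k]_n.+1) i : ev 'X_i v = v 0 i.
Proof. exact: mevalXU. Qed.

Lemma rep_neq0 x : rep x != 0.
Proof.
by rewrite /rep vpick0; apply/negP => /eqP x0; have := valP x; rewrite /= x0 dimv0.
Qed.

Lemma val_rep x : val x = <[rep x]>%VS.
Proof.
apply/esym/eqP; rewrite eqEdim -memvE memv_pick dim_vline rep_neq0 /=.
by rewrite (eqP (valP x)).
Qed.

Lemma proj_eqP x y : reflect (exists a, rep x = a *: rep y) (x == y :> {L | \dim L == 1%N}).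
Proof.
apply: (iffP eqP) => [->|[a xy]]; first by exists 1; rewrite scale1r.
apply/val_inj/eqP; rewrite eqEdim (eqP (valP x)) (eqP (valP y)) leqnn andbT.
by rewrite !val_rep -memvE xy memvZ ?memv_line.
Qed.

Lemma proj_eq x y a : rep x = a *: rep y -> x = y.
Proof. by move=> xy; apply/eqP/proj_eqP; exists a. Qed.

Lemma rep_val x v : val x = <[v]>%VS -> exists2 a, a != 0 & rep x = a *: v.
Proof.
move=> xv; have : rep x \in <[v]>%VS by rewrite -xv /rep memv_pick.
move=> /vlineP[a ra]; exists a => //; apply: contra (rep_neq0 x) => /eqP a0.
by rewrite ra a0 scale0r.
Qed.

Lemma exists_point v : v != 0 -> exists x : proj k n, val x = <[v]>%VS.
Proof.
move=> v0; have dv : \dim <[v]>%VS == 1%N by rewrite dim_vline v0.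
by exists (exist _ <[v]>%VS dv).
Qed.

Lemma line_neq0 x v : val x = <[v]>%VS -> v != 0.
Proof. by move=> xv; have := valP x; rewrite /= xv dim_vline; case: (v != 0). Qed.

Lemma ev_val_eq0 x v F : hom F -> val x = <[v]>%VS ->
  (ev F (rep x) == 0) = (ev F v == 0).
Proof.
move=> [d hF] /rep_val[a a0 ->]; rewrite (ev_scale _ _ hF) mulf_eq0.
by rewrite expf_eq0 (negPf a0) andbF.
Qed.

Lemma homM F G : hom F -> hom G -> hom (F * G).
Proof. by move=> [d hF] [e hG]; exists (d + e)%N; exact: dhomogM. Qed.

Lemma hom_coord (i : 'I_n.+1) : ('X_i : {mpoly k[n.+1]}) \is 1.-homog.
Proof. by rewrite dhomogX /= mdeg1. Qed.

Lemma zclosed_form F : hom F -> zclosed [set x | ev F (rep x) = 0].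
Proof.
move=> hF; exists [set F]; split=> [f ->//|].
by apply/seteqP; split=> [x /= F0 f ->//|x /= /(_ F erefl)].
Qed.

Lemma zclosed_sep Z x : zclosed Z -> ~ Z x ->
  exists F, [/\ hom F, forall y, Z y -> ev F (rep y) = 0 & ev F (rep x) != 0].
Proof.
move=> [S [hS ->]] /existsNP[F /not_implyP[SF /eqP Fx]].
by exists F; split=> //; [exact: hS|move=> y; apply].
Qed.

Lemma zclosed_intro Z : (forall x, ~ Z x ->
  exists F, [/\ hom F, forall y, Z y -> ev F (rep y) = 0 & ev F (rep x) != 0]) -> zclosed Z.
Proof.
move=> sepZ; exists [set F | hom F /\ forall y, Z y -> ev F (rep y) = 0]; split.
  by move=> F [].
apply/seteqP; split=> [x Zx F [_]|x /= xF]; first exact.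
apply: contrapT => /sepZ[F [hF FZ]]; rewrite xF ?eqxx //; by split.
Qed.

Lemma zclosedU A B : zclosed A -> zclosed B -> zclosed (A `|` B).
Proof.
move=> cA cB; apply: zclosed_intro => x /not_orP[nA nB].
have [F [hF FA Fx]] := zclosed_sep cA nA; have [G [hG GB Gx]] := zclosed_sep cB nB.
exists (F * G); split; first exact: homM.
  by move=> y [/FA Fy|/GB Gy]; rewrite evM ?Fy ?Gy ?mul0r ?mulr0.
by rewrite evM mulf_neq0.
Qed.

Lemma zclosedI A B : zclosed A -> zclosed B -> zclosed (A `&` B).
Proof.
move=> cA cB; apply: zclosed_intro => x /not_andP[nA|nB].
  by have [F [hF FA Fx]] := zclosed_sep cA nA; exists F; split=> // y [/FA].
by have [F [hF FA Fx]] := zclosed_sep cB nB; exists F; split=> // y [_ /FA].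
Qed.

Lemma zclosed0 : zclosed (set0 : set (proj k n)).
Proof.
apply: zclosed_intro => x _; exists 1; split=> //; first by exists 0%N; exact: dhomog1.
by rewrite /ev meval1 oner_eq0.
Qed.

Lemma two_point_form x y : x <> y ->
  exists F : {mpoly k[n.+1]}, [/\ F \is 1.-homog, ev F (rep x) = 0 & ev F (rep y) != 0].
Proof.
move=> xy.
have [i xi] : exists i, rep x 0 i != 0.
  apply: contrapT => /forallNP x0; move: (rep_neq0 x); apply/negP/negPn/eqP.
  by apply/rowP => i; rewrite mxE; apply/eqP/negPn/negP/x0.
have [j xj] : exists j, rep y 0 j * rep x 0 i != rep y 0 i * rep x 0 j.
  apply: contrapT => /forallNP xyE; apply: xy; apply/esym.
  apply: (@proj_eq _ _ (rep y 0 i / rep x 0 i)); apply/rowP => j.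
  have /negP/negPn/eqP := xyE j; rewrite !mxE => e.
  by apply: (mulIf xi); rewrite e mulrAC divfK.
exists (rep x 0 i *: 'X_j - rep x 0 j *: 'X_i); split.
- apply: rpredB; apply: rpredZ; exact: hom_coord.
- by rewrite /ev mevalB !mevalZ !mevalXU mulrC subrr.
- by rewrite /ev mevalB !mevalZ !mevalXU subr_eq0 mulrC [X in _ != X]mulrC.
Qed.

Lemma zclosed1 x : zclosed [set x].
Proof.
apply: zclosed_intro => y yx; have [|F [hF Fx Fy]] := @two_point_form x y; first by move=> e; apply: yx.
by exists F; split=> //; [exists 1%N|move=> z ->].
Qed.

Lemma finite_zclosed A : finite_set A -> zclosed A.
Proof.
move=> /(@finite_seqP {L : {vspace 'rV[k]_n.+1} | \dim L == 1%N})[s ->].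
elim: s => [|x s IHs].
  have -> : [set` [::]] = set0 :> set (proj k n).
    by apply/seteqP; split=> [y|y []]; rewrite /= in_nil.
  exact: zclosed0.
have -> : [set` x :: s] = [set x] `|` [set` s] :> set (proj k n).
  apply/seteqP; split=> y /=; first by rewrite inE => /orP[/eqP->|ys]; [left|right].
  by move=> [->|ys]; rewrite inE ?eqxx // ys orbT.
by apply: zclosedU => //; exact: zclosed1.
Qed.

Lemma zopen_form F : hom F -> zopen [set x | ev F (rep x) != 0].
Proof.
move=> hF; rewrite /zopen.
have -> : ~` [set x | ev F (rep x) != 0] = [set x | ev F (rep x) = 0].
  by apply/seteqP; split=> x /=; [move=> /negP/negPn/eqP|move=> ->; rewrite eqxx].
exact: zclosed_form.
Qed.

Lemma zopen_finite A : finite_set A -> zopen (~` A).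
Proof. by rewrite /zopen setCK; exact: finite_zclosed. Qed.

(* By Hilbert's basis theorem. *)
Lemma zclosed_minimal (P : set (proj k n) -> Prop) Z0 : zclosed Z0 -> P Z0 ->
  exists Z, [/\ zclosed Z, P Z, Z `<=` Z0 &
    forall Z', zclosed Z' -> P Z' -> Z' `<=` Z -> Z `<=` Z'].
Proof.
move=> cZ0 PZ0; apply: contrapT => /forallNP nomin.
pose good Z := [/\ zclosed Z, P Z & Z `<=` Z0].
have step Z : exists Z' F, good Z -> [/\ good Z', Z' `<=` Z, hom F,
    forall y, Z' y -> ev F (rep y) = 0 & exists2 y, Z y & ev F (rep y) != 0].
  have [[cZ PZ ZZ0]|?] := pselect (good Z); last by exists Z0, 0.
  have [Z' [cZ' PZ' ZZ' [x Zx nZx]]] : exists Z', [/\ zclosed Z', P Z', Z' `<=` Z &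
      exists2 x, Z x & ~ Z' x].
    apply: contrapT => none; apply: (nomin Z); split=> // Z' cZ' PZ' Z'Z x Zx.
    by apply: contrapT => nZ'x; apply: none; exists Z'; split=> //; exists x.
  have [F [hF FZ' Fx]] := zclosed_sep cZ' nZx.
  exists Z', F => _; split=> //; [split=> //|by exists x].
  exact: subset_trans ZZ0.
have {step}[nx /choice[fm stepP]] := choice step.
pose Z i := iter i nx Z0.
have gZ i : good (Z i).
  by elim: i => [|i /stepP[]]; first by split.
pose f i := fm (Z i).
have [N [c cE]] := noetherian_mpoly f.
have [_ _ _ _ [y Zy fNy]] := stepP _ (gZ N).
have Zle i : (i <= N)%N -> Z N `<=` Z i.
  move=> /subnK <-; elim: (N - i)%N => [|j IHj]; first exact.
  by apply: subset_trans IHj; have [_] := stepP _ (gZ (j + i)%N).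
move: fNy; rewrite -/(f N) cE ev_sum big1 ?eqxx // => i _.
rewrite evM; have [_ _ _ fi _] := stepP _ (gZ i).
by rewrite [X in _ * X]fi ?mulr0 //; apply: (Zle i.+1).
Qed.

Lemma dimension_uniq (X : set (proj k n)) d e : dimension X d -> dimension X e -> d = e.
Proof.
have mono a b : (a <= b)%N -> has_chain X b -> has_chain X a.
  move=> ab [Z [Z1 Z2]]; exists Z; split=> i lei; first by apply: Z1; apply: leq_trans ab.
  by apply: Z2; apply: leq_trans ab.
move=> [ce nce] [cd ncd]; case: (ltngtP d e) => // lt.
  by case: nce; exact: mono cd.
by case: ncd; exact: mono ce.
Qed.

Lemma irreducible1 x : irreducible [set x].
Proof.
split; first by exists x.
by move=> A B _ _ /(_ x erefl)[Ax|Bx]; [left=> y ->|right=> y ->].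
Qed.

Section Curve.
Variable C : set (proj k n).
Hypothesis hC : curve C.

(** A finite set with two points is the union of one of them and the closed set of the others, hence
    reducible; a single point carries no chain of length one. *)
Lemma curve_infinite : infinite_set C.
Proof.
move: hC => [cC [[p Cp] irrC] [[Z [Z1 Z2]] _]] finC.
have [q Cq pq] : exists2 q, C q & q <> p.
  apply: contrapT => nq; have Cp1 : C `<=` [set p].
    by move=> q Cq; apply: contrapT => qp; apply: nq; exists q.
  have [c0 [[z Z0z] _] Z0C] := Z1 0%N isT; have [c1 [_ _] Z1C] := Z1 1%N isT.
  have [_] := Z2 0%N isT; apply => u /Z1C/Cp1 ->.
  by have <- := Cp1 _ (Z0C _ Z0z).
have finCp : zclosed (C `\ p) by apply: finite_zclosed; exact: finite_setD.
have Cpp : C `<=` [set p] `|` (C `\ p).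
  by move=> x Cx; have [->|xp] := pselect (x = p); [left|right].
have [e|e] := irrC _ _ (zclosed1 p) finCp Cpp.
- by apply: pq; exact: e.
- by have [_] := e _ Cp; apply.
Qed.

(* A minimal infinite closed subset is irreducible. *)
Lemma curve_proper_finite Z : zclosed Z -> Z `<=` C -> ~ C `<=` Z -> finite_set Z.
Proof.
move=> cZ ZC nCZ; apply: contrapT => infZ.
have [Z1 [cZ1 infZ1 Z1Z minZ1]] := zclosed_minimal (P := fun S => infinite_set S) cZ infZ.
have [p Z1p] := infinite_setN0 infZ1.
have irrZ1 : irreducible Z1.
  split; first by exists p.
  move=> A B cA cB Z1AB.
  have [finA|infA] := pselect (finite_set (Z1 `&` A)); last first.
    left; apply: subset_trans (minZ1 _ (zclosedI cZ1 cA) infA (@subIsetl _ _ _)) _.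
    exact: subIsetr.
  right; have infB : infinite_set (Z1 `&` B).
    move=> finB; apply: infZ1; apply: (@sub_finite_set _ _ ((Z1 `&` A) `|` (Z1 `&` B))).
      by move=> x Zx; case: (Z1AB x Zx); [left|right].
    by rewrite finite_setU.
  apply: subset_trans (minZ1 _ (zclosedI cZ1 cB) infB (@subIsetl _ _ _)) _.
  exact: subIsetr.
have [cC irrC [_]] := hC; apply.
exists (fun i => if i is 0%N then [set p] else if i is 1%N then Z1 else C); split.
  case=> [|[|[|//]]] _; split=> //; [exact: zclosed1|exact: irreducible1| |].
    by move=> x ->; exact/ZC/Z1Z.
  exact: subset_trans ZC.
case=> [|[|//]] _; split.
- by move=> x ->.
- by move=> Z1p'; apply: infZ1; apply: sub_finite_set Z1p' _; exact: finite_set1.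
- exact: subset_trans ZC.
- by move=> CZ1; apply: nCZ; exact: subset_trans Z1Z.
Qed.

Lemma curve_zeros_finite F : hom F -> (exists2 x, C x & ev F (rep x) != 0) ->
  finite_set [set x | C x /\ ev F (rep x) = 0].
Proof.
move=> hF [x Cx Fx]; apply: curve_proper_finite.
- by have [cC _ _] := hC; exact: zclosedI cC (zclosed_form hF).
- by move=> y [].
- by move=> /(_ x Cx)[_ /eqP]; rewrite (negPf Fx).
Qed.

End Curve.
End Points.

Lemma fraction_surj (R : idomainType) (q : {fraction R}) :
  exists a b : R, b != 0 /\ q = FracField.tofrac a / FracField.tofrac b.
Proof.
exists (\n_(repr q)), (\d_(repr q)); have b0 := denom_ratioP (repr q); split=> //.
have bF0 : FracField.tofrac (\d_(repr q)) != 0 by rewrite tofrac_eq0.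
apply: (mulIf bF0); rewrite divfK // -{1}[q]reprK !piE.
apply/eqmodP; rewrite /= FracField.equivfE /FracField.mulf.
by rewrite !numden_Ratio ?mulf_neq0 ?oner_neq0 // !mulr1 mulrC.
Qed.

(** * The function field of a curve *)

Section QuotientField.
Local Open Scope quotient_scope.
Variables (A : comNzRingType) (I : A -> Prop).
Hypotheses (I0 : I 0) (I1 : ~ I 1) (ID : forall x y, I x -> I y -> I (x + y))
  (IM : forall x y, I y -> I (x * y)) (IP : forall x y, I (x * y) -> I x \/ I y).

Definition idealb : {pred A} := fun x => `[< I x >].

Let idealb_closed : idealr_closed idealb.
Proof.
split=> [|| a x y /asboolP Ix /asboolP Iy].
- exact/asboolP.
- exact/asboolP.
- by apply/asboolP; apply: ID => //; exact: IM.
Qed.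

Let idealb_prime : prime_idealr_closed idealb.
Proof.
move=> x y /asboolP/IP[Ix|Iy]; apply/orP; [left|right]; exact/asboolP.
Qed.

HB.instance Definition _ := isIdealr.Build A idealb idealb_closed.
HB.instance Definition _ := isPrimeIdealrClosed.Build A idealb idealb_prime.

Definition prime_quotient := {ideal_quot (idealb : prime_idealr A)}.
HB.instance Definition _ := GRing.ComNzRing.on prime_quotient.
HB.instance Definition _ := NzRingQuotient.on prime_quotient.

(** No formula gives the inverses, so they are chosen classically; the integral domain structure,
    needed for the fraction field, is built over a ring with a unit predicate. *)
Let unitq (x : prime_quotient) := `[< exists y, y * x = 1 >].
Let invq (x : prime_quotient) : prime_quotient :=
  if pselect (exists y, y * x = 1) is left h then projT1 (cid h) else x.

Let mulVq : {in unitq, left_inverse 1 invq *%R}.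
Proof.
move=> x /asboolP ux; rewrite /invq; case: pselect => // h.
exact: (projT2 (cid h)).
Qed.

Let unitqPl : forall x y : prime_quotient, y * x = 1 -> unitq x.
Proof. by move=> x y yx; apply/asboolP; exists y. Qed.

Let invq_out : {in [predC unitq], invq =1 id}.
Proof. by move=> x /asboolP nx; rewrite /invq; case: pselect. Qed.

HB.instance Definition _ :=
  GRing.ComNzRing_hasMulInverse.Build prime_quotient mulVq unitqPl invq_out.

Let prime_quotient_domain : GRing.integral_domain_axiom prime_quotient.
Proof. exact: Quotient.rquot_IdomainAxiom. Qed.

HB.instance Definition _ :=
  GRing.ComUnitRing_isIntegral.Build prime_quotient prime_quotient_domain.

Lemma prime_quotient_field : exists (K : fieldType) (f : {rmorphism A -> K}),
  (forall x, f x = 0 <-> I x) /\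
  forall q : K, exists x y, f y != 0 /\ q = f x / f y.
Proof.
pose J : prime_idealr A := idealb.
pose pi : {rmorphism A -> prime_quotient} := \pi_{ideal_quot J}.
pose f : {rmorphism A -> {fraction prime_quotient}} :=
  @FracField.tofrac prime_quotient \o pi.
exists {fraction prime_quotient}, f; split=> [x|q].
  have -> : (f x = 0) <-> (f x == 0) by split=> /eqP.
  rewrite /f /= tofrac_eq0 -(rmorph0 pi) /pi -Quotient.idealrBE subr0.
  by split=> /asboolP.
have [a [b [b0 ->]]] := fraction_surj q.
exists (repr a), (repr b); rewrite /f /pi /= !reprK; split=> //.
by rewrite tofrac_eq0.
Qed.

End QuotientField.

Section GenericPoint.
Variables (k : fieldType) (n : nat) (C : set (proj k n)).

(* w is a generic point of C with coordinates in the function field K. *)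
Record generic (K : fieldType) (emb : {rmorphism k -> K}) (w : 'I_n.+1 -> K) : Prop :=
  Generic {
    gen_eq0 : forall F, hom F ->
      (mmap emb w F = 0 <-> forall x, C x -> ev F (rep x) = 0);
    gen_frac : forall q : K, exists d F G, [/\ F \is d.-homog, G \is d.-homog,
      mmap emb w G != 0 & q = mmap emb w F / mmap emb w G] }.

Hypothesis irrC : irreducible C.

(** K is the fraction field of the coordinate ring of the chart where the coordinate [j] does not
    vanish, and [w] is the vector of affine coordinates, with w_j = 1. The index is taken so that
    the chart contains a point of C. *)
Lemma exists_generic : exists (K : fieldType) (emb : {rmorphism k -> K}) (w : 'I_n.+1 -> K),
  generic emb w.
Proof.
have [[p Cp] CU] := irrC.
have [j pj] : exists j, rep p 0 j != 0.
  apply: contrapT => /forallNP p0; move: (rep_neq0 p); apply/negP/negPn/eqP.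
  by apply/rowP => i; rewrite mxE; apply/eqP/negPn/negP/p0.
pose I (P : {mpoly k[n.+1]}) :=
  forall x, C x -> rep x 0 j != 0 -> ev P ((rep x 0 j)^-1 *: rep x) = 0.
(* Homogenisation with respect to X_j, in degree [msize P], one more than the degree of P. The spare
   factor X_j makes the form vanish on the hyperplane x_j = 0, so zeros on the chart become zeros on
   all of C. *)
pose hmg (P : {mpoly k[n.+1]}) :=
  \sum_(d < msize P) 'X_j ^+ (msize P - d) * pihomog [measure of mdeg] d P.
have hmgH P : hmg P \is (msize P).-homog.
  apply: rpred_sum => d _.
  suff : 'X_j ^+ (msize P - d) * pihomog [measure of mdeg] d P \is (msize P - d + d).-homog.
    by rewrite subnK // ltnW.
  apply: dhomogM; last exact: pihomogP.
  have := dhomogMn (msize P - d) (hom_coord k j).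
  by rewrite mul1n.
have hmgE P (S : comNzRingType) (f : {rmorphism k -> S}) (v : 'I_n.+1 -> S) : v j = 1 ->
    mmap f v (hmg P) = mmap f v P.
  move=> vj; have PE := @pihomog_partitionE _ _ [measure of mdeg] (msize P) P (leqnn _).
  transitivity (mmap f v (\sum_(d < msize P) pihomog [measure of mdeg] d P)); last by rewrite -PE.
  rewrite !rmorph_sum; apply: eq_bigr => d _.
  by rewrite rmorphM rmorphXn /= mmapX mmap1U vj expr1n mul1r.
have hmgev P (v : 'rV[k]_n.+1) : v 0 j = 1 -> ev (hmg P) v = ev P v.
  exact: (hmgE P _ idfun).
have hmg0 P x : rep x 0 j = 0 -> ev (hmg P) (rep x) = 0.
  move=> xj; rewrite ev_sum big1 // => d _; rewrite evM.
  by rewrite /ev rmorphXn /= mevalXU xj expr0n subn_eq0 leqNgt ltn_ord mul0r.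
have hmgx P x : rep x 0 j != 0 -> ev P ((rep x 0 j)^-1 *: rep x) = 0 -> ev (hmg P) (rep x) = 0.
  move=> xj P0; have := ev_scale (rep x) (rep x 0 j)^-1 (hmgH P).
  rewrite hmgev ?mxE ?mulVf // P0 // => /esym/eqP.
  by rewrite mulf_eq0 expf_eq0 invr_eq0 (negPf xj) andbF => /eqP.
have hmgI' P : (forall x, C x -> ev (hmg P) (rep x) = 0) -> I P.
  move=> hP x Cx xj; rewrite -hmgev ?mxE ?mulVf //.
  by rewrite (ev_scale _ _ (hmgH P)) hP // mulr0.
(* C is covered by the zeros of F and the hyperplane x_j = 0; irreducibility and the point [p] off
   the hyperplane leave only the zeros of F. *)
have IH F : hom F -> I F <-> forall x, C x -> ev F (rep x) = 0.
  move=> [d hF]; split=> [IF x Cx|F0 x Cx xj]; last by rewrite (ev_scale _ _ hF) F0 ?mulr0.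
  have hXj : hom ('X_j : {mpoly k[n.+1]}) by exists 1%N; exact: hom_coord.
  have [|CF|CX] := CU _ _ (zclosed_form (ex_intro _ d hF)) (zclosed_form hXj).
  - move=> y Cy; have [yj|yj] := eqVneq (rep y 0 j) 0; first by right; rewrite /= evXU.
    left; have := IF y Cy yj; rewrite (ev_scale _ _ hF) => /eqP.
    by rewrite mulf_eq0 expf_eq0 invr_eq0 (negPf yj) andbF => /eqP.
  - exact: CF.
  - by have := CX _ Cp; rewrite /= evXU => /eqP; rewrite (negPf pj).
have IP P Q : I (P * Q) -> I P \/ I Q.
  move=> IPQ; have cl R : zclosed [set x | ev (hmg R) (rep x) = 0].
    by apply: zclosed_form; exists (msize R).
  have [|CP|CQ] := CU _ _ (cl P) (cl Q).
  - move=> x Cx; have [/hmg0 e|xj] := eqVneq (rep x 0 j) 0; first by left; exact: e.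
    have := IPQ x Cx xj; rewrite evM => /eqP; rewrite mulf_eq0 => /orP[] /eqP e; [left|right].
      exact: hmgx.
    exact: hmgx.
  - by left; apply: hmgI'.
  - by right; apply: hmgI'.
have [||||K [f [fI fsurj]]] := @prime_quotient_field _ I _ _ _ _ IP.
- by move=> x _ _; rewrite /ev meval0.
- by move=> /(_ p Cp pj); rewrite /ev meval1 => /eqP; rewrite oner_eq0.
- by move=> P Q IP' IQ x Cx xj; rewrite evD IP' // IQ // addr0.
- by move=> P Q IQ x Cx xj; rewrite evM IQ // mulr0.
pose emb : {rmorphism k -> K} := f \o @mpolyC n.+1 k.
pose w i := f 'X_i.
have fE P : mmap emb w P = f P.
  rewrite {2}(mpolyE P) rmorph_sum; apply: eq_bigr => m _.
  rewrite -mul_mpolyC rmorphM /=; congr (_ * _).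
  rewrite mpolyXE_id rmorph_prod; apply: eq_bigr => i _.
  by rewrite rmorphXn.
have wj : w j = 1.
  rewrite /w -[1](rmorph1 f); apply/eqP; rewrite -subr_eq0 -rmorphB; apply/eqP/fI.
  by move=> x Cx xj; rewrite /ev mevalB meval1 mevalXU mxE mulVf ?subrr.
exists K, emb, w; split.
- by move=> F hF; rewrite fE fI; exact: IH.
- move=> q; have [P [Q [Q0 ->]]] := fsurj q.
  (* The powers of X_j bring numerator and denominator to the same degree and have value 1 at
     [w]. *)
  exists (msize P + msize Q)%N, (hmg P * 'X_j ^+ msize Q), ('X_j ^+ msize P * hmg Q).
  have hX m : ('X_j ^+ m : {mpoly k[n.+1]}) \is m.-homog.
    by have := dhomogMn m (hom_coord k j); rewrite mul1n.
  have EP : mmap emb w (hmg P * 'X_j ^+ msize Q) = f P.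
    by rewrite rmorphM rmorphXn /= mmapX mmap1U wj expr1n mulr1 hmgE // fE.
  have EQ : mmap emb w ('X_j ^+ msize P * hmg Q) = f Q.
    by rewrite rmorphM rmorphXn /= mmapX mmap1U wj expr1n mul1r hmgE // fE.
  by split; rewrite ?EP ?EQ //; exact: dhomogM.
Qed.

End GenericPoint.

(** * Derivations *)

Lemma mpoly_ring_ind (R : comNzRingType) n (P : {mpoly R[n]} -> Prop) :
  (forall c, P c%:MP) -> (forall i, P 'X_i) ->
  (forall F G, P F -> P G -> P (F + G)) ->
  (forall F G, P F -> P G -> P (F * G)) -> forall F, P F.
Proof.
move=> PC PX PD PM; elim/mpolyind => [|c m F _ _ PF].
  by rewrite -mpolyC0.
apply: PD PF; rewrite -mul_mpolyC; apply: (PM) => //.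
rewrite mpolyXE_id; apply: (big_ind P) => [||i _].
- by rewrite -mpolyC1.
- exact: PM.
by elim: (m i) => [|e IHe]; rewrite ?expr0 -?mpolyC1 // exprS; exact: PM.
Qed.

Lemma dhomog_mderiv (R : nzRingType) n (F : {mpoly R[n]}) d i :
  F \is d.-homog -> mderiv i F \is d.-1.-homog.
Proof.
move=> /dhomogP hF; apply/dhomogP => m; rewrite mcoeff_msupp mcoeff_mderiv => cm.
have /hF : (m + U_(i))%MM \in msupp F.
  by rewrite mcoeff_msupp; apply: contra cm => /eqP ->; rewrite mul0rn.
by rewrite /= mdegD mdeg1 => <-; rewrite addn1.
Qed.

Lemma euler_homog (R : comNzRingType) n (F : {mpoly R[n]}) d : F \is d.-homog ->
  \sum_i mderiv i F * 'X_i = F *+ d.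
Proof.
move=> /dhomogP hF; rewrite [in LHS](mpolyE F) [in RHS](mpolyE F).
under eq_bigr => i _ do rewrite raddf_sum mulr_suml.
rewrite exchange_big -sumrMnl /= big_seq [RHS]big_seq; apply: eq_bigr => m /hF /= <-.
under eq_bigr => i _ do rewrite mderivZ mderivX -scalerAl -scalerAl.
rewrite mdegE -sumrMnr; apply: eq_bigr => i _.
have [->|mi] := posnP (m i); first by rewrite scale0r scaler0 mulr0n.
rewrite -mpolyXD submK; last first.
  by apply/mnm_lepP => j; rewrite mnm1E; case: eqP => // <-.
by rewrite scaler_nat -scalerMnr.
Qed.

(** The chain rule, for a bare map [D], so that it serves both derivations of the function field and
    the formal derivative along a line. *)
Lemma leibniz_mmap (R S : comNzRingType) (phi : {rmorphism R -> S}) (D : S -> S) n (z : 'I_n -> S)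
    (F : {mpoly R[n]}) :
  (forall p q, D (p + q) = D p + D q) -> (forall p q, D (p * q) = D p * q + p * D q) ->
  (forall c, D (phi c) = 0) ->
  D (mmap phi z F) = \sum_i mmap phi z (mderiv i F) * D (z i).
Proof.
move=> DD DM DC; elim/mpoly_ring_ind: F => [c|j|F G IHF IHG|F G IHF IHG].
- by rewrite mmapC DC big1 // => i _; rewrite mderivC rmorph0 mul0r.
- rewrite mmapX mmap1U (bigD1 j) //= mderivX mnm1E eqxx scale1r big1 ?addr0.
    have -> : (U_(j) - U_(j))%MM = 0%MM :> 'X_{1..n}.
      by apply/mnmP => l; rewrite mnmBE mnm0E subnn.
    by rewrite mpolyX0 rmorph1 mul1r.
  by move=> i ij; rewrite mderivX mnm1E eq_sym (negPf ij) scale0r rmorph0 mul0r.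
- rewrite rmorphD DD IHF IHG -big_split; apply: eq_bigr => i _ /=.
  by rewrite mderivD rmorphD mulrDl.
- rewrite rmorphM DM IHF IHG mulr_suml mulr_sumr -big_split.
  by apply: eq_bigr => i _ /=; rewrite mderivM rmorphD !rmorphM /=; ring.
Qed.

Record derivation (k K : fieldType) (emb : {rmorphism k -> K}) (D : K -> K) : Prop :=
  Derivation {
    derD : forall a b, D (a + b) = D a + D b;
    derM : forall a b, D (a * b) = D a * b + a * D b;
    derC : forall c, D (emb c) = 0 }.

Section Derivation.
Variables (k K : fieldType) (emb : {rmorphism k -> K}) (D : K -> K).
Hypothesis hD : derivation emb D.

Lemma der0 : D 0 = 0. Proof. by have := derC hD 0; rewrite rmorph0. Qed.
Lemma der1 : D 1 = 0. Proof. by have := derC hD 1; rewrite rmorph1. Qed.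

Lemma derN a : D (- a) = - D a.
Proof. by apply/eqP; rewrite -addr_eq0 -(derD hD) addNr der0. Qed.

Lemma derB a b : D (a - b) = D a - D b.
Proof. by rewrite (derD hD) derN. Qed.

Lemma derCM c a : D (emb c * a) = emb c * D a.
Proof. by rewrite (derM hD) (derC hD) mul0r add0r. Qed.

Lemma der_sum (I : Type) (r : seq I) (P : pred I) (F : I -> K) :
  D (\sum_(i <- r | P i) F i) = \sum_(i <- r | P i) D (F i).
Proof. exact: (big_morph D (derD hD) der0). Qed.

Lemma derV a : a != 0 -> D a^-1 = - (D a / a ^+ 2).
Proof.
move=> a0; have := der1; rewrite -{1}(divff a0) (derM hD) => /eqP.
rewrite addrC addr_eq0 => /eqP e; apply: (mulfI a0); rewrite e.
by field.
Qed.

Lemma derX a n : D (a ^+ n) = (a ^+ n.-1 * D a) *+ n.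
Proof.
elim: n => [|n IHn]; first by rewrite expr0 mulr0n der1.
rewrite exprS (derM hD) IHn; case: n {IHn} => [|n].
  by rewrite expr0 mulr0n mulr0 addr0 mulr1 mulr1n mul1r.
by rewrite /= mulrnAr mulrA -exprS mulrC [RHS]mulrS.
Qed.

Lemma der_mmap n (z : 'I_n -> K) (F : {mpoly k[n]}) :
  D (mmap emb z F) = \sum_i mmap emb z (mderiv i F) * D (z i).
Proof. exact: (leibniz_mmap _ _ (derD hD) (derM hD) (derC hD)). Qed.

End Derivation.

(** * Linear functionals separating a vector from a subspace *)

Section Separation.
Variables (F : fieldType) (N : nat) (S : 'rV[F]_N -> Prop).
Hypotheses (S0 : S 0) (SD : forall a u v, S u -> S v -> S (a *: u + v)).

(** A matrix of maximal rank among those whose row space lies in [S] spans [S]: a vector outside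
    would raise the rank. *)
Lemma subspace_mx : exists A : 'M[F]_N, forall v : 'rV_N, S v <-> (v <= A)%MS.
Proof.
pose P r := `[< exists A : 'M[F]_N, (forall v : 'rV_N, (v <= A)%MS -> S v) /\ \rank A = r >].
have exP : exists r, P r.
  exists 0%N; apply/asboolP; exists 0; split; last by rewrite mxrank0.
  by move=> v; rewrite submx0 => /eqP ->.
have ubP r : P r -> (r <= N)%N by move=> /asboolP[A [_ <-]]; exact: rank_leq_row.
have [r /asboolP[A [AS rA]] maxr] := ex_maxnP exP ubP.
exists A => v; split; last exact: AS.
move=> Sv; apply: contrapT => /negP vA.
have : P (\rank (A + v)%MS).
  apply/asboolP; exists (A + v)%MS; split=> // u /sub_addsmxP[[a b] /= ->].
  rewrite addrC (mx11_scalar b) mul_scalar_mx; apply: SD => //.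
  by apply: AS; exact: submxMl.
move=> /maxr; rewrite -rA leqNgt => /negP; apply; apply: rank_ltmx.
by rewrite /ltmx addsmxSl addsmx_sub submx_refl; exact: vA.
Qed.

Lemma subspace_sep u : ~ S u ->
  exists w : 'rV[F]_N, (forall v, S v -> \sum_i v 0 i * w 0 i = 0) /\
    \sum_i u 0 i * w 0 i != 0.
Proof.
have [A AS] := subspace_mx; move=> nSu.
have /negP : ~ (u <= A)%MS by move=> /AS.
rewrite submxE => /rV0Pn[j uj]; exists (\row_i cokermx A i j); split.
  move=> v /AS; rewrite submxE => /eqP/rowP/(_ j); rewrite !mxE => e; rewrite -[RHS]e.
  by apply: eq_bigr => i _; rewrite !mxE.
have <- : (u *m cokermx A) 0 j = \sum_i u 0 i * (\row_i cokermx A i j) 0 i.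
  by rewrite mxE; apply: eq_bigr => i _; rewrite mxE.
exact: uj.
Qed.

End Separation.

Lemma pg_mmap (k : closedFieldType) (K : fieldType) (emb : {rmorphism k -> K}) H n
    (z : 'I_n -> K) (v : 'I_n -> k) (F : {mpoly k[n]}) :
  place_graph emb H -> (forall i, H (z i) (v i)) -> H (mmap emb z F) F.@[v].
Proof.
move=> gH Hz; rewrite mevalE /mmap.
apply: (@pg_sum _ _ _ H _ _ xpredT (fun m => emb F@_m * mmap1 z m)
  (fun m => F@_m * \prod_(i < n) v i ^+ m i) gH) => m _.
apply: (pgM gH); first exact: pgC.
apply: (@pg_prod _ _ _ H _ _ xpredT (fun i => z i ^+ m i) (fun i => v i ^+ m i) gH) => i _.
exact: (pgX _ gH).
Qed.

(** * Local rings of a curve *)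

Section LocalRing.
Variables (k : closedFieldType) (n : nat) (K : fieldType) (emb : {rmorphism k -> K}).
Variable w : 'I_n.+1 -> K.
Local Notation evK := (mmap emb w).

(* The function q is regular at x with value c. *)
Definition reg (x : proj k n) (q : K) (c : k) : Prop :=
  exists d F G, [/\ F \is d.-homog, G \is d.-homog, ev G (rep x) != 0,
    q = evK F / evK G & c = ev F (rep x) / ev G (rep x)].

(* The hypothesis says that x lies in the closure of the generic point. *)
Lemma reg_graph_at x : (forall F, hom F -> evK F = 0 -> ev F (rep x) = 0) ->
  place_graph emb (reg x).
Proof.
move=> vx.
have nzx F : hom F -> ev F (rep x) != 0 -> evK F != 0.
  by move=> hF; apply: contra => /eqP /(vx _ hF) ->.
split.
- move=> c; exists 0%N, c%:MP, 1; split.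
  + by rewrite -[c%:MP]mulr1 mul_mpolyC; apply: dhomogZ; exact: dhomog1.
  + exact: dhomog1.
  + by rewrite /ev meval1 oner_eq0.
  + by rewrite mmapC rmorph1 divr1.
  + by rewrite /ev mevalC meval1 divr1.
- move=> _ _ _ _ [d [F [G [hF hG G0 -> ->]]]] [e [F' [G' [hF' hG' G0' -> ->]]]].
  have GK := nzx _ (ex_intro _ d hG) G0.
  have GK' := nzx _ (ex_intro _ e hG') G0'.
  exists (d + e)%N, (F * G' + G * F'), (G * G'); split.
  + by apply: rpredD; exact: dhomogM.
  + exact: dhomogM.
  + by rewrite evM mulf_neq0.
  + by rewrite rmorphD !rmorphM /= addf_div // [evK F' * _]mulrC.
  + by rewrite evD !evM addf_div // [ev F' _ * _]mulrC.
- move=> _ _ _ _ [d [F [G [hF hG G0 -> ->]]]] [e [F' [G' [hF' hG' G0' -> ->]]]].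
  exists (d + e)%N, (F * F'), (G * G'); split; rewrite ?evM ?mulf_neq0 ?mulf_div //.
  + exact: dhomogM.
  + exact: dhomogM.
  + by rewrite !rmorphM.
- move=> _ [d [F [G [hF hG G0 /esym/eqP F0 ->]]]].
  have GK := nzx _ (ex_intro _ d hG) G0.
  move: F0; rewrite mulf_eq0 invr_eq0 (negPf GK) orbF => /eqP F0.
  by rewrite (vx _ (ex_intro _ d hF) F0) mul0r.
Qed.

Variable C : set (proj k n).
Hypothesis gw : generic C emb w.

Lemma gen_vanish F x : hom F -> evK F = 0 -> C x -> ev F (rep x) = 0.
Proof. by move=> hF /(gen_eq0 gw hF); apply. Qed.

Lemma gen_neq0 F x : hom F -> C x -> ev F (rep x) != 0 -> evK F != 0.
Proof.
by move=> hF Cx; apply: contra => /eqP /(gen_vanish hF) ->.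
Qed.

Lemma gen_nonvanish F : hom F -> evK F != 0 -> exists2 x, C x & ev F (rep x) != 0.
Proof.
move=> hF /eqP F0; apply: contrapT => none; apply: F0; apply/(gen_eq0 gw hF) => x Cx.
by apply: contrapT => /eqP Fx; apply: none; exists x.
Qed.

Lemma reg_graph x : C x -> place_graph emb (reg x).
Proof. by move=> Cx; apply: reg_graph_at => F hF F0; exact: gen_vanish F0 Cx. Qed.

Lemma reg_local x : local_graph (reg x).
Proof.
move=> _ _ [d [F [G [hF hG G0 -> ->]]]] c0; exists d, G, F; rewrite !invf_div; split=> //.
by apply: contra c0 => /eqP ->; rewrite mul0r.
Qed.

Lemma reg_frac x d F G : F \is d.-homog -> G \is d.-homog -> ev G (rep x) != 0 ->
  reg x (evK F / evK G) (ev F (rep x) / ev G (rep x)).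
Proof. by move=> hF hG G0; exists d, F, G. Qed.

Lemma coord_neq0 (x : proj k n) : exists i, rep x 0 i != 0.
Proof.
apply: contrapT => /forallNP x0; move: (rep_neq0 x); apply/negP/negPn/eqP.
by apply/rowP => i; rewrite mxE; apply/eqP/negPn/negP/x0.
Qed.

Lemma gen_coord_neq0 x i : C x -> rep x 0 i != 0 -> w i != 0.
Proof.
move=> Cx xi; have := @gen_neq0 'X_i x (ex_intro _ 1%N (hom_coord k i)) Cx.
by rewrite evXU mmapX mmap1U; apply.
Qed.

(** This scaling of the generic point makes the affine coordinates specialise to the chosen
    representative itself, so that forms evaluated at them have the value at [rep x] without
    correcting factors. *)
Lemma reg_coord x i j : rep x 0 j != 0 -> reg x (emb (rep x 0 j) / w j * w i) (rep x 0 i).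
Proof.
move=> xj; exists 1%N, (rep x 0 j *: 'X_i), 'X_j; rewrite /ev !mevalZ !mevalXU mmapZ !mmapX !mmap1U.
split=> //; [|exact: hom_coord|by rewrite mulrAC|by rewrite mulrAC divff ?mul1r].
by apply/dhomogZ/hom_coord.
Qed.

Lemma reg_affine x j : rep x 0 j != 0 ->
  forall d F G, F \is d.-homog -> G \is d.-homog -> w j != 0 ->
  evK F / evK G = mmap emb (fun i => emb (rep x 0 j) / w j * w i) F /
                  mmap emb (fun i => emb (rep x 0 j) / w j * w i) G.
Proof.
move=> xj d F G hF hG wj; rewrite !(mmap_scale emb w _ hF) !(mmap_scale emb w _ hG).
by rewrite -mulf_div divff ?mul1r // expf_neq0 // mulf_neq0 ?invr_eq0 // fmorph_eq0.
Qed.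

Hypothesis hC : curve C.

Lemma reg_nz_finite q : q != 0 ->
  finite_set [set x | C x /\ ~ exists2 c, c != 0 & reg x q c].
Proof.
have [d [F [G [hF hG G0 ->]]]] := gen_frac gw q; move=> q0.
have F0 : evK F != 0 by apply: contra q0 => /eqP ->; rewrite mul0r.
have finF := curve_zeros_finite hC (ex_intro _ d hF) (gen_nonvanish (ex_intro _ d hF) F0).
have finG := curve_zeros_finite hC (ex_intro _ d hG) (gen_nonvanish (ex_intro _ d hG) G0).
apply: (@sub_finite_set _ _ ([set x | C x /\ ev F (rep x) = 0] `|` [set x | C x /\ ev G (rep x) = 0])); last by rewrite finite_setU.
move=> x [Cx nr]; apply: contrapT => /not_orP[nF nG]; apply: nr.
have Fx : ev F (rep x) != 0 by apply/eqP => e; apply: nF.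
have Gx : ev G (rep x) != 0 by apply/eqP => e; apply: nG.
exists (ev F (rep x) / ev G (rep x)); first by rewrite mulf_neq0 ?invr_eq0.
exact: reg_frac hF hG Gx.
Qed.

Lemma reg_finite q : finite_set [set x | C x /\ ~ dom (reg x) q].
Proof.
have [->|q0] := eqVneq q 0.
  apply: (@sub_finite_set _ _ set0); last exact: finite_set0.
  by move=> x [Cx]; apply; exists 0; exact: pg00 (reg_graph Cx).
apply: sub_finite_set (reg_nz_finite q0) => x [Cx nr]; split=> // -[c _ qc].
by apply: nr; exists c.
Qed.

(** The identity principle: it turns equalities of values at infinitely many points into equalities
    in K. *)
Lemma reg_all0 q : infinite_set [set x | C x /\ reg x q 0] -> q = 0.
Proof.
move=> inf; apply: contrapT => /eqP q0; apply: inf; apply: sub_finite_set (reg_nz_finite q0).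
move=> x [Cx q00]; split=> // -[c c0 qc]; move/eqP: c0; apply.
exact: (pg_fun (reg_graph Cx) qc q00).
Qed.

Lemma infinite_avoid (B : set (proj k n)) : finite_set B -> exists2 x, C x & ~ B x.
Proof.
move=> fB; have [x [Cx Bx]] := infinite_setN0 (infinite_setD (curve_infinite hC) fB).
by exists x.
Qed.

(** * Taylor expansions and tangent vectors at a smooth point *)

Section Smooth.
Variable x : proj k n.
Hypotheses (Cx : C x) (sx : smooth_at C x).
Variable j : 'I_n.+1.
Hypothesis xj : rep x 0 j != 0.

Local Notation xi := (fun i => emb (rep x 0 j) / w j * w i).
Local Notation y := (fun i => xi i - emb (rep x 0 i)).
Let wj : w j != 0 := gen_coord_neq0 Cx xj.
Let gx := reg_graph Cx.

Lemma reg_y i : reg x (y i) 0.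
Proof.
rewrite -(subrr (rep x 0 i)); apply: (pgB gx); first exact: (reg_coord i xj).
exact: (pgC gx).
Qed.

Lemma reg_xi F : reg x (mmap emb xi F) (ev F (rep x)).
Proof. by apply: (pg_mmap _ gx) => i; exact: (reg_coord i xj). Qed.

Lemma xi_vanish F : hom F -> (forall z, C z -> ev F (rep z) = 0) -> mmap emb xi F = 0.
Proof.
move=> hF F0; case: (hF) => d hd; rewrite (mmap_scale emb w _ hd).
by rewrite (proj2 (gen_eq0 gw hF) F0) mulr0.
Qed.

(** With it the differences [y i] generate the maximal ideal at x. *)
Lemma taylor1 F : exists a, (forall i, dom (reg x) (a i)) /\
  mmap emb xi F - emb (ev F (rep x)) = \sum_i a i * y i.
Proof.
elim/mpoly_ring_ind: F => [c|i|F G [a [da Fa]] [b [db Gb]]|F G [a [da Fa]] [b [db Gb]]].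
- exists (fun=> 0); split=> [i|]; first by exists 0; exact: pg00 gx.
  by rewrite mmapC /ev mevalC subrr big1 // => i _; rewrite mul0r.
- exists (fun l => (l == i)%:R); split=> [l|].
    by case: (_ == _); [exists 1; exact: pg11 gx|exists 0; exact: pg00 gx].
  rewrite mmapX mmap1U evXU (bigD1 i) //= eqxx mul1r big1 ?addr0 // => l /negPf ->.
  by rewrite mul0r.
- exists (fun i => a i + b i); split=> [i|].
    by have [[c ?] [d ?]] := (da i, db i); exists (c + d); exact: (pgD gx).
  rewrite rmorphD evD rmorphD opprD addrACA Fa Gb -big_split.
  by apply: eq_bigr => i _; rewrite mulrDl.
- exists (fun i => a i * mmap emb xi G + emb (ev F (rep x)) * b i); split=> [i|].
    have [[c ac] [d bd]] := (da i, db i); exists (c * ev G (rep x) + ev F (rep x) * d).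
    by apply: (pgD gx); apply: (pgM gx) => //; [exact: reg_xi|exact: (pgC gx)].
  transitivity ((mmap emb xi F - emb (ev F (rep x))) * mmap emb xi G +
     emb (ev F (rep x)) * (mmap emb xi G - emb (ev G (rep x)))).
    by rewrite !rmorphM evM rmorphM; ring.
  rewrite Fa Gb mulr_suml mulr_sumr -big_split; apply: eq_bigr => i _ /=; ring.
Qed.

(** The remainder lies in the square of the maximal ideal. A form vanishing on C therefore yields a
    linear relation between the [y i] modulo that square, with its gradient as coefficients. *)
Lemma taylor2 F : exists a, (forall i, reg x (a i) 0) /\
  mmap emb xi F - emb (ev F (rep x)) - \sum_i emb (ev (mderiv i F) (rep x)) * y i =
  \sum_i a i * y i.
Proof.
elim/mpoly_ring_ind: F => [c|i|F G [a [da Fa]] [b [db Gb]]|F G [a [da Fa]] [b [db Gb]]].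
- exists (fun=> 0); split=> [i|]; first exact: pg00 gx.
  rewrite mmapC /ev mevalC subrr sub0r -sumrN; apply: eq_bigr => i _.
  by rewrite mderivC meval0 rmorph0 !mul0r oppr0.
- exists (fun=> 0); split=> [l|]; first exact: pg00 gx.
  rewrite mmapX mmap1U evXU; transitivity (0 : K); last by rewrite big1 // => l _; rewrite mul0r.
  apply/eqP; rewrite subr_eq0 (bigD1 i) //= big1 ?addr0.
    rewrite mderivX mnm1E eqxx scale1r.
    have -> : (U_(i) - U_(i))%MM = 0%MM :> 'X_{1..n.+1}.
      by apply/mnmP => l; rewrite mnmBE mnm0E subnn.
    by rewrite mpolyX0 /ev meval1 rmorph1 mul1r.
  by move=> l li; rewrite mderivX mnm1E eq_sym (negPf li) scale0r /ev meval0 rmorph0 mul0r.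
- exists (fun i => a i + b i); split=> [i|].
    by rewrite -[X in reg _ _ X]addr0; exact: (pgD gx).
  under [RHS]eq_bigr => i _ do rewrite mulrDl.
  rewrite big_split /= -Fa -Gb rmorphD evD rmorphD.
  under eq_bigr => i _ do rewrite mderivD evD rmorphD mulrDl.
  rewrite big_split /=; ring.
- have [aG [daG GaG]] := taylor1 G.
  pose f0 := emb (ev F (rep x)); pose g0 := emb (ev G (rep x)).
  pose f1 := \sum_i emb (ev (mderiv i F) (rep x)) * y i.
  pose g1 := \sum_i emb (ev (mderiv i G) (rep x)) * y i.
  exists (fun i => f1 * emb (ev (mderiv i G) (rep x)) + a i * mmap emb xi G + (f0 + f1) * b i).
  have f10 : reg x f1 0.
    have := @pg_sum _ _ _ (reg x) _ (index_enum 'I_n.+1) xpredT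
      (fun i => emb (ev (mderiv i F) (rep x)) * y i) (fun=> 0) gx.
    rewrite big1_eq; apply=> i _ /=; rewrite -[X in reg _ _ X](mulr0 (ev (mderiv i F) (rep x))).
    by apply: (pgM gx); [exact: (pgC gx)|exact: reg_y].
  split=> [i|].
    have e : 0 * ev (mderiv i G) (rep x) + 0 * ev G (rep x) + (ev F (rep x) + 0) * 0 = 0 by ring.
    rewrite -[X in reg _ _ X]e.
    apply: (pgD gx); last first.
      by apply: (pgM gx) => //; apply: (pgD gx) => //; exact: (pgC gx).
    apply: (pgD gx); apply: (pgM gx) => //; [exact: (pgC gx)|exact: reg_xi].
  transitivity (f1 * g1 + (mmap emb xi F - f0 - f1) * mmap emb xi G + (f0 + f1) * (mmap emb xi G - g0 - g1)).
    rewrite rmorphM evM rmorphM -/f0 -/g0.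
    have -> : \sum_i emb (ev (mderiv i (F * G)) (rep x)) * y i = f1 * g0 + f0 * g1.
      rewrite /f1 /g1 mulr_suml mulr_sumr -big_split; apply: eq_bigr => i _ /=.
      by rewrite mderivM evD !evM rmorphD !rmorphM -/f0 -/g0; ring.
    ring.
  rewrite Fa Gb /g1 [f1 * _]mulr_sumr mulr_suml [(f0 + f1) * _]mulr_sumr -!big_split.
  by apply: eq_bigr => i _ /=; ring.
Qed.

(** By Euler's identity the gradient of F paired with the point gives a multiple of F(x). *)
Lemma tangent_rep : tangent C x (rep x).
Proof.
move=> F [d hF] F0; have := euler_homog hF => /(congr1 (fun P => ev P (rep x))).
rewrite ev_sum /ev mevalMn -/(ev F (rep x)) F0 // mul0rn => e; rewrite -[RHS]e.
by apply: eq_bigr => i _; rewrite mevalM mevalXU.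
Qed.

Definition grad (u : 'rV[k]_n.+1) := exists F, [/\ hom F,
  forall z, C z -> ev F (rep z) = 0 & forall i, ev (mderiv i F) (rep x) = u 0 i].

Lemma grad0 : grad 0.
Proof.
exists 0; split=> [|z _|i]; first by exists 0%N; exact: dhomog0.
  by rewrite /ev meval0.
by rewrite mderiv0 /ev meval0 mxE.
Qed.

(** Forms of different degrees are added after multiplication by powers of X_j. As both forms vanish
    at x, the product rule only rescales their gradients there, which the constants undo. *)
Lemma gradD a u v : grad u -> grad v -> grad (a *: u + v).
Proof.
move=> [F [[d hF] F0 Fu]] [G [[e hG] G0 Gv]].
pose c := rep x 0 j.
have hX m : ('X_j ^+ m : {mpoly k[n.+1]}) \is m.-homog.
  by have := dhomogMn m (hom_coord k j); rewrite mul1n.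
have evX m (z : 'rV[k]_n.+1) : ev ('X_j ^+ m) z = z 0 j ^+ m.
  by rewrite /ev rmorphXn /= mevalXU.
exists ((a * c ^- e) *: ('X_j ^+ e * F) + c ^- d *: ('X_j ^+ d * G)); split.
- exists (e + d)%N; apply: rpredD; apply: dhomogZ; first exact: dhomogM.
  by rewrite addnC; apply: dhomogM.
- move=> z Cz; rewrite evD /ev !mevalZ !mevalM -!/(ev _ _) F0 // G0 //; ring.
- move=> i; rewrite mderivD !mderivZ !mderivM evD /ev !mevalZ !mevalD !mevalM -!/(ev _ _).
  rewrite F0 // G0 // !evX -/c Fu Gv !mxE !mulr0 !add0r mulrA -[_ * _ * c ^+ e]mulrA.
  by rewrite mulVf ?mulr1 ?expf_neq0 // mulrA mulVf ?mul1r ?expf_neq0.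
Qed.

(** Dimension one makes the tangent space, with the point included, a plane in the vector space. The
    functional [m0] is the coordinate along the tangent direction; the uniformizer will be the
    corresponding linear form. *)
Lemma tangent_line : exists w0 : 'rV[k]_n.+1, [/\ tangent C x w0,
    forall v, tangent C x v -> exists a b, v = a *: rep x + b *: w0,
    forall b, w0 <> b *: rep x &
    exists m0 : 'rV[k]_n.+1, \sum_i m0 0 i * rep x 0 i = 0 /\ \sum_i m0 0 i * w0 0 i = 1].
Proof.
have [d [V [dC VT dimV]]] := sx.
have {dC} d1 : d = 1%N by have [_ _ dC1] := hC; exact: dimension_uniq dC dC1.
rewrite d1 in dimV.
have xV : rep x \in V by apply/VT; exact: tangent_rep.
have [w0 w0V w0x] : exists2 w0, w0 \in V & w0 \notin <[rep x]>%VS.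
  apply: contrapT => none; have : (V <= <[rep x]>)%VS.
    by apply/subvP => v vV; apply: contrapT => /negP vx; apply: none; exists v.
  by move=> /dimvS; rewrite dimV dim_vline rep_neq0.
have Vspan : V = (<[rep x]> + <[w0]>)%VS.
  apply/esym/eqP; rewrite eqEdim subv_add -!memvE xV w0V /= dimV.
  rewrite dimv_disjoint_sum ?dim_vline ?rep_neq0.
    by have -> : w0 != 0 by apply: contra w0x => /eqP ->; exact: mem0v.
  apply/eqP; rewrite -subv0; apply/subvP => v; rewrite memv_cap => /andP[vx /vlineP[b vb]].
  have [b0|b0] := eqVneq b 0; first by rewrite vb b0 scale0r mem0v.
  case/negP: w0x; rewrite vb in vx; rewrite -[w0](scalerK b0) ; exact: memvZ.
exists w0; split.
- exact/VT.
- move=> v /VT; rewrite Vspan => /memv_addP[_ /vlineP[a ->] [_ /vlineP[b ->] ->]].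
  by exists a, b.
- by move=> b e; case/negP: w0x; rewrite e memvZ ?memv_line.
pose S (u : 'rV[k]_n.+1) := exists b, u = b *: rep x.
have S0 : S 0 by exists 0; rewrite scale0r.
have SD a u v : S u -> S v -> S (a *: u + v).
  by move=> [b ->] [c ->]; exists (a * b + c); rewrite scalerDl scalerA.
have [|u [Su uw]] := subspace_sep S0 SD (u := w0).
  by move=> [b e]; case/negP: w0x; rewrite e memvZ ?memv_line.
pose s := \sum_i w0 0 i * u 0 i.
exists (s^-1 *: u); split.
  under eq_bigr => i _ do rewrite mxE -mulrA [u 0 i * _]mulrC.
  by rewrite -mulr_sumr Su ?mulr0 //; exists 1; rewrite scale1r.
under eq_bigr => i _ do rewrite mxE -mulrA [u 0 i * _]mulrC.
by rewrite -mulr_sumr -/s mulVf.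
Qed.

(** Double annihilator: tangent vectors are the annihilator of the subspace of gradients, and a
    functional outside that subspace would be detected by one of them. *)
Lemma grad_annihil (u : 'rV[k]_n.+1) : (forall v, tangent C x v -> \sum_i u 0 i * v 0 i = 0) -> grad u.
Proof.
move=> uT; apply: contrapT => ngu.
have [v [gv]] := subspace_sep grad0 gradD ngu; rewrite uT ?eqxx // => F hF F0.
rewrite -[RHS](gv (\row_i ev (mderiv i F) (rep x))).
  by apply: eq_bigr => i _; rewrite mxE.
by exists F; split=> // i; rewrite mxE.
Qed.

End Smooth.
End LocalRing.

(** * Uniformizers and the valuation rings of points *)

Section Uniformizer.
Variables (k : closedFieldType) (n : nat) (K : fieldType) (emb : {rmorphism k -> K}).
Variables (w : 'I_n.+1 -> K) (C : set (proj k n)).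
Hypotheses (gw : generic C emb w) (hC : curve C).
Local Notation evK := (mmap emb w).
Local Notation reg := (reg emb w).

Record uniformizer (x : proj k n) (t : K) : Prop := Uniformizer {
  unif0 : reg x t 0;
  unif_neq0 : t != 0;
  unif_div : forall q, reg x q 0 -> dom (reg x) (q / t) }.

Lemma regs_sum x (I : finType) (F : I -> K) : C x ->
  (forall i, reg x (F i) 0) -> reg x (\sum_i F i) 0.
Proof.
move=> Cx F0; have := @pg_sum _ _ _ (reg x) _ (index_enum I) xpredT F (fun=> 0) (reg_graph gw Cx).
by rewrite big1_eq; apply=> i _.
Qed.

Lemma regM0 x a b : C x -> dom (reg x) a -> reg x b 0 -> reg x (a * b) 0.
Proof.
by move=> Cx [c ac] b0; rewrite -[X in reg _ _ X](mulr0 c); exact: (pgM (reg_graph gw Cx)).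
Qed.

Lemma domM x a b : C x -> dom (reg x) a -> dom (reg x) b -> dom (reg x) (a * b).
Proof. by move=> Cx [c ac] [d bd]; exists (c * d); exact: (pgM (reg_graph gw Cx)). Qed.

Lemma domD x a b : C x -> dom (reg x) a -> dom (reg x) b -> dom (reg x) (a + b).
Proof. by move=> Cx [c ac] [d bd]; exists (c + d); exact: (pgD (reg_graph gw Cx)). Qed.

Lemma domN x a : C x -> dom (reg x) a -> dom (reg x) (- a).
Proof. by move=> Cx [c ac]; exists (- c); exact: (pgN (reg_graph gw Cx)). Qed.

Lemma domC x c : C x -> dom (reg x) (emb c).
Proof. by move=> Cx; exists c; exact: (pgC (reg_graph gw Cx)). Qed.

Lemma dom0 x : C x -> dom (reg x) 0.
Proof. by move=> Cx; exists 0; exact: (pg00 (reg_graph gw Cx)). Qed.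

Lemma dom1 x : C x -> dom (reg x) 1.
Proof. by move=> Cx; exists 1; exact: (pg11 (reg_graph gw Cx)). Qed.

Lemma dom_sum x (I : finType) (F : I -> K) : C x ->
  (forall i, dom (reg x) (F i)) -> dom (reg x) (\sum_i F i).
Proof.
move=> Cx dF; apply: (big_ind (dom (reg x))) => [|a b|i _]; [exact: dom0|exact: domD|exact: dF].
Qed.

Lemma exists_vanishing x : C x -> exists2 q, q != 0 & reg x q 0.
Proof.
move=> Cx; have [z Cz zx] := infinite_avoid hC (finite_set1 x).
have [|F [hF Fx Fz]] := @two_point_form _ _ x z; first by move=> e; apply: zx.
have [j xj] := coord_neq0 x.
have wj := gen_coord_neq0 gw Cx xj.
exists (evK F / evK 'X_j).
  rewrite mulf_neq0 ?invr_eq0 //; last by rewrite mmapX mmap1U.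
  exact: (gen_neq0 gw (ex_intro _ 1%N hF) Cz Fz).
rewrite -(mul0r (ev 'X_j (rep x))^-1) -Fx.
by apply: (reg_frac emb w hF (hom_coord k j)); rewrite evXU.
Qed.

(* Krull: otherwise q = t^i q_i for all i, and a relation between the numerators
   of the q_i, given by Hilbert's basis theorem, contradicts q_N <> 0. *)
Lemma unif_order x t q : C x -> uniformizer x t -> dom (reg x) q -> q != 0 ->
  exists N u c, [/\ c != 0, reg x u c & q = t ^+ N * u].
Proof.
move=> Cx ut dq q0; have gx := reg_graph gw Cx; have t0 := unif_neq0 ut.
have [j xj] := coord_neq0 x; have wj := gen_coord_neq0 gw Cx xj.
apply: contrapT => nodec.
have q0s i : reg x (q / t ^+ i) 0.
  elim: i => [|i IHi].
    rewrite expr0 divr1; case: dq => c qc; have [<-//|c0] := eqVneq c 0.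
    by case: nodec; exists 0%N, q, c; split=> //; rewrite expr0 mul1r.
  have [c qc] := unif_div ut IHi.
  have e : q / t ^+ i / t = q / t ^+ i.+1 by rewrite exprSr invfM mulrA.
  rewrite e in qc; have [<-//|c0] := eqVneq c 0.
  by case: nodec; exists i.+1, (q / t ^+ i.+1), c; split=> //; rewrite mulrC divfK // expf_neq0.
pose xi i := emb (rep x 0 j) / w j * w i.
have fracs i : exists FG : {mpoly k[n.+1]} * {mpoly k[n.+1]},
    mmap emb xi FG.1 = q / t ^+ i * mmap emb xi FG.2 /\ ev FG.2 (rep x) != 0.
  have [d [F [G [hF hG Gx qE _]]]] := q0s i; exists (F, G); split=> //=.
  have Gxi : mmap emb xi G != 0.
    by apply: (pg_neq0 gx) Gx; exact: (reg_xi gw Cx xj).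
  by rewrite qE (reg_affine emb xj hF hG wj) divfK.
have [FG {fracs}FGE] := choice fracs.
have [N [A AE]] := noetherian_mpoly (fun i => (FG i).1).
have [FN GN] := FGE N.
have qN0 : q / t ^+ N != 0 by rewrite mulf_neq0 ?invr_eq0 ?expf_neq0.
have GNE : mmap emb xi (FG N).2 = \sum_(i < N) (mmap emb xi (A i) * mmap emb xi (FG i).2) * t ^+ (N - i).
  apply: (mulfI qN0); rewrite -FN AE rmorph_sum mulr_sumr; apply: eq_bigr => i _ /=.
  rewrite rmorphM /= (FGE i).1.
  have -> : t ^+ N = t ^+ (N - i) * t ^+ i by rewrite -exprD subnK // ltnW.
  by rewrite invfM; field; rewrite ?expf_neq0.
move: GN; apply/negP; rewrite negbK; apply/eqP.
apply: (pg_fun gx (reg_xi gw Cx xj _)); rewrite -/xi GNE.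
apply: regs_sum => // i; apply: regM0 => //.
  by apply: domM => //; eexists; exact: (reg_xi gw Cx xj).
rewrite -(subnSK (ltn_ord i)) exprS mulrC; apply: regM0 => //; last exact: unif0.
by exists (0 ^+ (N - i.+1)); apply: (pgX _ gx); exact: unif0.
Qed.

Lemma unif_fraction x t q : C x -> uniformizer x t -> q != 0 ->
  exists (m : int) u c, [/\ c != 0, reg x u c & q = t ^ m * u].
Proof.
move=> Cx ut; have [d [F [G [hF hG G0 ->]]]] := gen_frac gw q => q0.
have gx := reg_graph gw Cx; have t0 := unif_neq0 ut.
have [j xj] := coord_neq0 x; have wj := gen_coord_neq0 gw Cx xj.
pose xi i := emb (rep x 0 j) / w j * w i.
have E := reg_affine emb xj hF hG wj; rewrite -/xi in E.
have : mmap emb xi F / mmap emb xi G != 0 by rewrite -E.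
rewrite mulf_eq0 negb_or invr_eq0 => /andP[F0 {}G0].
have dF : dom (reg x) (mmap emb xi F) by eexists; exact: (reg_xi gw Cx xj).
have dG : dom (reg x) (mmap emb xi G) by eexists; exact: (reg_xi gw Cx xj).
have [a [u [c [c0 uc FE]]]] := unif_order Cx ut dF F0.
have [b [v [e [e0 ve GE]]]] := unif_order Cx ut dG G0.
exists (a%:Z - b%:Z), (u / v), (c / e); split.
- by rewrite mulf_neq0 ?invr_eq0.
- by apply: (pgM gx) => //; exact: reg_local.
- by rewrite E FE GE expfzDr // -mulf_div -exprnP -exprnN.
Qed.

Lemma unif_exp x t (m : int) u c : C x -> uniformizer x t -> reg x u c -> (0 < m)%R ->
  reg x (t ^ m * u) 0.
Proof.
move=> Cx ut uc; case: m => [[//|m]|//] _; rewrite -exprnP.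
have -> : t ^+ m.+1 * u = (t ^+ m * u) * t by rewrite exprS; ring.
have rt := unif0 ut; apply: regM0 => //; apply: domM => //; last by exists c.
by exists (0 ^+ m); exact: (pgX _ (reg_graph gw Cx)).
Qed.

Lemma reg_valuation_ring x t q : C x -> uniformizer x t ->
  dom (reg x) q \/ reg x q^-1 0.
Proof.
move=> Cx ut; have [->|q0] := eqVneq q 0; first by left; exact: dom0.
have [m [u [c [c0 uc qE]]]] := unif_fraction Cx ut q0.
have t0 := unif_neq0 ut.
have [m0|m0|m0] := ltgtP m 0.
- right; rewrite qE invfM invr_expz; apply: unif_exp => //; last by rewrite oppr_gt0.
  exact: reg_local uc c0.
- by left; exists 0; rewrite qE; exact: unif_exp uc m0.
- by left; exists c; rewrite qE m0 expr0z mul1r.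
Qed.

(** Valuation rings are maximal for extension of places: if q were not regular, 1/q would have value
    0, and so would the product of q and 1/q. *)
Lemma reg_maximal x t H q c : C x -> uniformizer x t -> place_graph emb H ->
  (forall r d, reg x r d -> H r d) -> H q c -> reg x q c.
Proof.
move=> Cx ut gH regH Hq; have gx := reg_graph gw Cx.
have [[d qd]|qV] := @reg_valuation_ring x t q Cx ut.
  by rewrite (pg_fun gH Hq (regH _ _ qd)).
have [q0|q0] := eqVneq q 0.
  by rewrite q0 in Hq *; rewrite (pg0 gH Hq); exact: pg00 gx.
have := pgM gH Hq (regH _ _ qV); rewrite divff // mulr0 => e.
by have /eqP := pg_fun gH e (pg11 gH); rewrite eq_sym oner_eq0.
Qed.

Lemma reg_normalize x t (I : finType) (v : I -> K) i0 : C x -> uniformizer x t -> v i0 != 0 ->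
  exists j, v j != 0 /\ forall i, dom (reg x) (v i / v j).
Proof.
move=> Cx ut vi0.
have [H' [y [gH' HH' ys y0 dH']]] :=
  place_center_seq [seq v i | i <- enum I] (reg_graph gw Cx) vi0.
have vs i : v i \in v i0 :: [seq v i | i <- enum I].
  by rewrite inE map_f ?orbT // mem_enum.
have [j yj] : exists j, y = v j.
  by move: ys; rewrite inE => /orP[/eqP->|/mapP[j _ ->]]; [exists i0|exists j].
exists j; rewrite -yj; split=> // i; have [c Hc] := dH' _ (vs i).
by exists c; exact: (reg_maximal Cx ut gH' HH' Hc).
Qed.

(* Every place is centred on C: the coordinates can be normalised so that the
   place takes finite values on them. *)
Lemma place_center H : (forall x, C x -> exists t, uniformizer x t) ->
  zclosed C -> place_graph emb H ->
  exists2 x, C x & forall q c, H q c -> reg x q c.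
Proof.
move=> unif cC gH; have [p Cp] := infinite_setN0 (curve_infinite hC).
have [j0 pj0] := coord_neq0 p; have wj0 := gen_coord_neq0 gw Cp pj0.
have [H' [y [gH' HH' ys y0 dH']]] := place_center_seq [seq w i | i <- enum 'I_n.+1] gH wj0.
have vs i : w i \in w j0 :: [seq w i | i <- enum 'I_n.+1].
  by rewrite inE map_f ?orbT // mem_enum.
have [j yj] : exists j, y = w j.
  by move: ys; rewrite inE => /orP[/eqP->|/mapP[j _ ->]]; [exists j0|exists j].
rewrite {}yj {ys} in y0 dH'.
have [v Hv] := choice (fun i => dH' _ (vs i)).
have vj : v j = 1.
  by have := Hv j; rewrite divff // => e; exact: (pg_fun gH' e (pg11 gH')).
have [x xv] : exists x : proj k n, val x = <[\row_i v i]>%VS.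
  apply: exists_point; apply/eqP => /rowP/(_ j); rewrite !mxE vj => /eqP.
  by rewrite oner_eq0.
have wE d F : F \is d.-homog -> mmap emb (fun i => w i / w j) F = evK F / w j ^+ d.
  move=> hF; have := mmap_scale emb w (w j)^-1 hF; rewrite mulrC exprVn => <-.
  by apply: mmap_ext => i; rewrite mulrC.
have HF d F : F \is d.-homog -> H' (evK F / w j ^+ d) (ev F (\row_i v i)).
  move=> hF; rewrite -wE //; have -> : ev F (\row_i v i) = F.@[v].
    by apply: mmap_ext => i; rewrite mxE.
  exact: pg_mmap.
have Cx : C x.
  apply: contrapT => /(zclosed_sep cC)[F [[d hF] F0 /eqP]]; apply; apply/eqP.
  rewrite (ev_val_eq0 (ex_intro _ d hF) xv); apply/eqP; apply: (pg0 gH').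
  have /= := HF d F hF; have -> : evK F = 0 by apply/(gen_eq0 gw (ex_intro _ d hF)).
  by rewrite mul0r.
have [a a0 xa] := rep_val xv.
have frac d F G : F \is d.-homog -> G \is d.-homog -> ev G (rep x) != 0 ->
    [/\ evK F / evK G * (evK G / w j ^+ d) = evK F / w j ^+ d,
        ev F (rep x) / ev G (rep x) * ev G (\row_i v i) = ev F (\row_i v i) &
        ev G (\row_i v i) != 0].
  move=> hF hG Gx; have GK := gen_neq0 gw (ex_intro _ d hG) Cx Gx.
  have Gv : ev G (\row_i v i) != 0 by rewrite -(ev_val_eq0 (ex_intro _ d hG) xv).
  split=> //; first by rewrite mulrA divfK.
  rewrite xa (ev_scale _ _ hF) (ev_scale _ _ hG) -mulf_div divff ?mul1r ?divfK //.
  by rewrite expf_neq0.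
exists x => // q c /HH' Hqc; have [t ut] := unif x Cx.
have [q0|q0] := eqVneq q 0.
  by rewrite q0 in Hqc *; rewrite (pg0 gH' Hqc); exact: (pg00 (reg_graph gw Cx)).
have [[e qe]|] := reg_valuation_ring q Cx ut.
  have [d [F [G [hF hG Gx qE eE]]]] := qe; have [E1 E2 Gv] := frac d F G hF hG Gx.
  suff -> : c = e by [].
  apply: (mulIf Gv); rewrite eE E2.
  by apply: (pg_fun gH') (pgM gH' Hqc (HF _ _ hG)) _; rewrite qE E1; exact: HF.
move=> [d [F [G [hF hG Gx qE eE]]]]; have [E1 E2 Gv] := frac d F G hF hG Gx.
exfalso.
have e : q * (evK F / w j ^+ d) = evK G / w j ^+ d.
  by rewrite -E1 -qE mulVKf.
have F0 : ev F (\row_i v i) = 0 by rewrite -E2 -eE mul0r.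
have := pgM gH' Hqc (HF _ _ hF); rewrite e F0 mulr0 => G0.
by move/eqP: Gv; apply; exact: (pg_fun gH' (HF _ _ hG) G0).
Qed.

End Uniformizer.

Lemma der_frac (k K : fieldType) (emb : {rmorphism k -> K}) D (hD : derivation emb D) a b :
  b != 0 -> D (a / b) = (D a - a / b * D b) / b.
Proof.
move=> b0; rewrite (derM hD) (derV hD) //; by field.
Qed.

(** * Local parameters and derivations at a smooth point *)

Section SmoothPoint.
Variables (k : closedFieldType) (n : nat) (K : fieldType) (emb : {rmorphism k -> K}).
Variables (w : 'I_n.+1 -> K) (C : set (proj k n)).
Hypotheses (gw : generic C emb w) (hC : curve C).
Local Notation evK := (mmap emb w).
Local Notation reg := (reg emb w).

(** Modulo the square of the maximal ideal every [y i] is a multiple of [t], because the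
    corresponding differential kills the tangent space and so is the gradient of a form vanishing on
    C; Nakayama's lemma removes the square. The last clause says that a nonzero derivation, scaled
    by a suitable [r], preserves the local ring and sends [t] to a unit. *)
Lemma exists_uniformizer x : C x -> smooth_at C x -> exists t, [/\
  uniformizer emb w x t,
  exists A B, [/\ A \is 1.-homog, B \is 1.-homog, ev B (rep x) != 0 & t = evK A / evK B] &
  forall D, derivation emb D -> (exists q, D q != 0) -> exists r,
    [/\ r != 0, forall q, dom (reg x) q -> dom (reg x) (r * D q) &
        exists2 c, c != 0 & reg x (r * D t) c]].
Proof.
move=> Cx sx; have gx := reg_graph gw Cx.
have [j xj] := coord_neq0 x; have wj := gen_coord_neq0 gw Cx xj.
pose xi i := emb (rep x 0 j) / w j * w i.
pose y i := xi i - emb (rep x 0 i).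
have regy i : reg x (y i) 0 := reg_y gw Cx xj i.
have [w0 [Tw0 Tspan w0x [m0 [m0x m0w]]]] := tangent_line hC Cx sx.
pose t := \sum_i emb (m0 0 i) * y i.
have regt : reg x t 0.
  by apply: (regs_sum gw Cx) => i; apply: (regM0 gw Cx) => //; exact: (domC gw).
have yE i : exists c a, (forall l, reg x (a l) 0) /\ y i = emb c * t + \sum_l a l * y l.
  have [b bE] : exists b, b = rep x 0 i / rep x 0 j by eexists.
  have [c cE] : exists c, c = w0 0 i - b * w0 0 j by eexists.
  (* The differential of y_i - b y_j - c t. The constants make it vanish on [rep x] and on [w0]; the
     term with y_j costs nothing, since y_j = 0 by normalisation. *)
  pose u : 'rV[k]_n.+1 := \row_l ((l == i)%:R - b * (l == j)%:R - c * m0 0 l).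
  have uv (v : 'rV[k]_n.+1) : \sum_l u 0 l * v 0 l = v 0 i - b * v 0 j - c * (\sum_l m0 0 l * v 0 l).
    under eq_bigr => l _ do rewrite mxE !mulrBl -!mulrA.
    rewrite !sumrB -!mulr_sumr (bigD1 i) //= eqxx mul1r big1 ?addr0; last first.
      by move=> l /negPf ->; rewrite mul0r.
    rewrite (bigD1 j) //= eqxx mul1r big1 ?addr0; last first.
      by move=> l /negPf ->; rewrite mul0r.
    by ring.
  have [|F [hF F0 Fu]] := grad_annihil Cx xj (u := u).
    move=> v /Tspan[a1 [b1 ->]]; rewrite uv.
    have -> : \sum_l m0 0 l * (a1 *: rep x + b1 *: w0) 0 l = b1.
      under eq_bigr => l _ do rewrite !mxE mulrDr ![m0 0 l * (_ * _)]mulrCA.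
      by rewrite big_split -!mulr_sumr /= m0x m0w mulr0 add0r mulr1.
    rewrite !mxE cE bE; field; exact: xj.
  have [a [ra aE]] := taylor2 gw Cx xj F.
  exists c, (fun l => - a l); split.
    by move=> l; rewrite -[X in reg _ _ X]oppr0; exact: (pgN gx).
  move: aE; rewrite (xi_vanish gw x j hF F0) (F0 _ Cx) rmorph0 subr0 sub0r.
  under eq_bigr => l _ do rewrite Fu mxE.
  under [X in _ = X -> _]eq_bigr => l _ do rewrite -[a l]opprK mulNr.
  rewrite [X in _ = X -> _]sumrN => /oppr_inj e.
  rewrite -[X in _ = _ + X]e -[LHS]/(y i).
  have -> : \sum_l emb ((l == i)%:R - b * (l == j)%:R - c * m0 0 l) * y l =
      y i - emb b * y j - emb c * t.
    under eq_bigr => l _ do rewrite !rmorphB !rmorphM /= !mulrBl -!mulrA.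
    rewrite !sumrB -!mulr_sumr (bigD1 i) //= eqxx rmorph1 mul1r big1 ?addr0; last first.
      by move=> l /negPf ->; rewrite rmorph0 mul0r.
    rewrite (bigD1 j) //= eqxx rmorph1 mul1r big1 ?addr0; last first.
      by move=> l /negPf ->; rewrite rmorph0 mul0r.
    by rewrite -/t; ring.
  have yj : y j = 0 by rewrite /y /xi divfK // subrr.
  by rewrite yj; ring.
pose N q := exists2 a, dom (reg x) a & q = t * a.
have ND a b : N a -> N b -> N (a + b).
  move=> [c dc ->] [d dd ->]; exists (c + d); rewrite ?mulrDr //; exact: (domD gw).
have NM a b : dom (reg x) a -> N b -> N (a * b).
  move=> da [c dc ->]; exists (a * c); last by rewrite mulrCA.
  exact: (domM gw).
have Ny i : N (y i).
  have := @nakayama _ _ _ (reg x) N n.+1 (fun i => y (inord i)) gx (@reg_local _ _ _ _ _ x) ND NM.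
  move=> /(_ _ i (ltn_ord i)); rewrite inord_val; apply=> l ltl.
  have [c [a [ra e]]] := yE (inord l).
  exists (emb c * t), (fun i => a (inord i)); split=> //.
    by exists (emb c); [exact: (domC gw)|rewrite mulrC].
  by rewrite {1}e; congr (_ + _); apply: eq_bigr => m _; rewrite inord_val.
have N0 : N 0 by exists 0; [exact: (dom0 gw)|rewrite mulr0].
have Nreg q : reg x q 0 -> N q.
  move=> [d [F [G [hF hG Gx qE /esym/eqP Fx]]]].
  rewrite mulf_eq0 invr_eq0 (negPf Gx) orbF in Fx; move/eqP in Fx.
  rewrite qE (reg_affine emb xj hF hG wj) mulrC; apply: (NM).
    by exists (ev G (rep x))^-1; apply: reg_local => //; exact: (reg_xi gw Cx xj).
  have [a [da]] := taylor1 gw Cx xj F; rewrite Fx rmorph0 subr0 => ->.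
  by apply: (big_ind N) => // i _; apply: (NM) => //; exact: Ny.
have t0 : t != 0.
  have [q q0 /Nreg[a _ qE]] := exists_vanishing gw hC Cx.
  by apply: contra q0 => /eqP t0; rewrite qE t0 mul0r.
have ut : uniformizer emb w x t.
  by split=> // q /Nreg[a da ->]; rewrite mulrC mulKf.
exists t; split=> //.
  exists (rep x 0 j *: \sum_i m0 0 i *: 'X_i), 'X_j; split.
  - apply: dhomogZ; apply: rpred_sum => i _; apply: dhomogZ; exact: hom_coord.
  - exact: hom_coord.
  - by rewrite evXU.
  - rewrite mmapZ rmorph_sum mmapX mmap1U /= mulrAC mulr_sumr /t.
    under [RHS]eq_bigr => i _ do rewrite mmapZ mmapX mmap1U.
    transitivity (\sum_i (emb (m0 0 i) * xi i - emb (m0 0 i * rep x 0 i))).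
      by apply: eq_bigr => i _; rewrite /y rmorphM mulrBr.
    rewrite sumrB -rmorph_sum m0x rmorph0 subr0; apply: eq_bigr => i _.
    by rewrite /xi mulrCA.
move=> D hD [q0 Dq0].
have [i0 Dxi0] : exists i, D (xi i) != 0.
  apply: contrapT => /forallNP Dxi; move/negP: Dq0; apply; apply/eqP.
  have Dm F : D (mmap emb xi F) = 0.
    rewrite (der_mmap hD) big1 // => i _.
    by have /negP/negPn/eqP -> := Dxi i; rewrite mulr0.
  have [d [F [G [hF hG G0 ->]]]] := gen_frac gw q0.
  have := reg_affine emb xj hF hG wj; rewrite -/xi => ->.
  have G0' : mmap emb xi G != 0.
    rewrite (mmap_scale emb w _ hG) mulf_neq0 // expf_neq0 // mulf_neq0 ?invr_eq0 //.
    by rewrite fmorph_eq0.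
  by rewrite (der_frac hD) // !Dm mulr0 subrr mul0r.
(* Dividing by the derivative of least order makes all the derivatives of coordinates regular and
   one of them equal to 1. *)
have [j0 [Dj0 dj0]] := reg_normalize gw (v := fun i => D (xi i)) Cx ut Dxi0.
pose r := (D (xi j0))^-1.
have drxi i : dom (reg x) (r * D (xi i)) by rewrite mulrC; exact: dj0.
have [ka kaE] := choice drxi.
have kaj0 : ka j0 = 1.
  by have := kaE j0; rewrite mulVf // => e; exact: (pg_fun gx e (pg11 gx)).
have kaj : ka j = 0.
  have := kaE j; rewrite /xi divfK // (derC hD) mulr0 => e.
  exact: (pg_fun gx e (pg00 gx)).
have Dm F : reg x (r * D (mmap emb xi F)) (\sum_i ev (mderiv i F) (rep x) * ka i).
  rewrite (der_mmap hD) mulr_sumr.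
  apply: (@pg_sum _ _ _ (reg x) _ _ xpredT (fun i => r * (mmap emb xi (mderiv i F) * D (xi i)))
    (fun i => ev (mderiv i F) (rep x) * ka i) gx) => i _.
  by rewrite mulrCA; apply: (pgM gx) => //; exact: (reg_xi gw Cx xj).
(* The values of the scaled derivatives form a nonzero tangent vector whose coordinate [j] is 0,
   hence not a multiple of [rep x]. Its component along [w0] is the value of [r * D t]. *)
have Tka : tangent C x (\row_i ka i).
  move=> F hF F0; under eq_bigr => i _ do rewrite mxE.
  apply: (pg_fun gx (Dm F)); rewrite (xi_vanish gw x j hF F0) (der0 hD) mulr0.
  exact: (pg00 gx).
have [a [b kab]] := Tspan _ Tka.
have b0 : b != 0.
  apply/eqP => b0; rewrite b0 scale0r addr0 in kab.
  have /rowP/(_ j) := kab; rewrite !mxE kaj => /esym/eqP; rewrite mulf_eq0 (negPf xj) orbF => /eqP a0.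
  have /rowP/(_ j0) := kab; rewrite !mxE kaj0 a0 mul0r => /eqP; by rewrite oner_eq0.
exists r; split; first by rewrite invr_eq0.
- move=> _ [_ [d [F [G [hF hG Gx -> _]]]]].
  rewrite (reg_affine emb xj hF hG wj) -/xi.
  have rG := reg_xi gw Cx xj G; rewrite -/xi in rG.
  have G0 := pg_neq0 gx rG Gx.
  have dGV : dom (reg x) (mmap emb xi G)^-1 by exists (ev G (rep x))^-1; exact: reg_local.
  rewrite (der_frac hD) // mulrA; apply: (domM gw) => //.
  rewrite mulrBr; apply: (domD gw) => //; first by eexists; exact: Dm.
  apply: (domN gw) => //; rewrite mulrCA; apply: (domM gw) => //; last by eexists; exact: Dm.
  by apply: (domM gw) => //; eexists; exact: (reg_xi gw Cx xj).
- exists b => //; have -> : r * D t = \sum_i emb (m0 0 i) * (r * D (xi i)).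
    rewrite /t (der_sum hD) mulr_sumr; apply: eq_bigr => i _.
    by rewrite (derCM hD) /y (derB hD) (derC hD) subr0 mulrCA.
  have -> : b = \sum_i m0 0 i * ka i.
    have -> : \sum_i m0 0 i * ka i = \sum_i m0 0 i * (a *: rep x + b *: w0) 0 i.
      by rewrite -kab; apply: eq_bigr => i _; rewrite mxE.
    under eq_bigr => l _ do rewrite !mxE mulrDr ![m0 0 l * (_ * _)]mulrCA.
    by rewrite big_split -!mulr_sumr /= m0x m0w mulr0 add0r mulr1.
  apply: (@pg_sum _ _ _ (reg x) _ _ xpredT (fun i => emb (m0 0 i) * (r * D (xi i)))
    (fun i => m0 0 i * ka i) gx) => i _.
  by apply: (pgM gx) => //; exact: (pgC gx).
Qed.

End SmoothPoint.

(** * Derivations of the function field *)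

Section ExistsDerivation.
Variables (k : closedFieldType) (n : nat) (K : fieldType) (emb : {rmorphism k -> K}).
Variables (w : 'I_n.+1 -> K) (C : set (proj k n)).
Hypotheses (gw : generic C emb w) (hC : curve C) (hsm : smooth C).
Local Notation evK := (mmap emb w).
Local Notation reg := (reg emb w).
Local Notation I F := (hom F /\ forall x, C x -> ev F (rep x) = 0).

Variable i0 : 'I_n.+1.
Hypothesis wi0 : w i0 != 0.

Local Definition z i := w i / w i0.

Lemma z_homog d F : F \is d.-homog -> mmap emb z F = evK F / w i0 ^+ d.
Proof.
move=> hF; rewrite -exprVn mulrC -(mmap_scale emb w _ hF).
by apply: mmap_ext => i; rewrite mulrC.
Qed.

Definition gradmx r (F : 'I_r -> {mpoly k[n.+1]}) : 'M[K]_(r, n.+1) :=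
  \matrix_(l, i) mmap emb z (mderiv i (F l)).

(* Specialising at a point of C where the entries of a right inverse are regular. *)
Lemma grad_rank r (F : 'I_r -> {mpoly k[n.+1]}) :
  (forall l, I (F l)) -> row_free (gradmx F) -> (2 + r <= n.+1)%N.
Proof.
move=> IF /row_freeP[B AB].
have hX : hom ('X_i0 : {mpoly k[n.+1]}) by exists 1%N; exact: hom_coord.
have X0 : evK 'X_i0 != 0 by rewrite mmapX mmap1U.
have fin1 := curve_zeros_finite hC hX (gen_nonvanish gw hX X0).
have fin2 : finite_set (\bigcup_(il in [set: 'I_n.+1 * 'I_r])
    [set x | C x /\ ~ dom (reg x) (B il.1 il.2)]).
  by apply: bigcup_finite => [|il _]; [exact: finite_finset|exact: reg_finite gw hC _].
have fin : finite_set ([set x | C x /\ ev 'X_i0 (rep x) = 0] `|`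
    (\bigcup_(il in [set: 'I_n.+1 * 'I_r]) [set x | C x /\ ~ dom (reg x) (B il.1 il.2)])).
  by rewrite finite_setU.
have [y Cy /not_orP[ny1 ny2]] := infinite_avoid hC fin.
have yi0 : rep y 0 i0 != 0 by apply/eqP => e; apply: ny1; rewrite /= evXU.
have domB i l : dom (reg y) (B i l).
  by apply: contrapT => nd; apply: ny2; exists (i, l).
have [b bB] : exists b : 'I_n.+1 -> 'I_r -> k, forall i l, reg y (B i l) (b i l).
  have [b bE] := choice (fun il : 'I_n.+1 * 'I_r => domB il.1 il.2).
  by exists (fun i l => b (i, l)) => i l; exact: (bE (i, l)).
have gy := reg_graph gw Cy.
pose v i := rep y 0 i / rep y 0 i0.
have regz i : reg y (z i) (v i).
  have := reg_frac emb w (hom_coord k i) (hom_coord k i0) (x := y).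
  by rewrite !evXU !mmapX !mmap1U; apply.
pose M : 'M[k]_(r, n.+1) := \matrix_(l, i) (mderiv i (F l)).@[v].
have freeM : row_free M.
  apply/row_freeP; exists (\matrix_(i, l) b i l); apply/matrixP => l l'.
  apply: (@pg_fun _ _ _ (reg y) ((gradmx F *m B) l l') _ _ gy).
    rewrite !mxE; apply: (@pg_sum _ _ _ (reg y) _ _ xpredT
      (fun i => gradmx F l i * B i l') (fun i => M l i * (\matrix_(i, l) b i l) i l') gy) => i _.
    rewrite !mxE; apply: (pgM gy) => //; exact: pg_mmap.
  rewrite AB !mxE; case: (_ == _); [exact: (pg11 gy)|exact: (pg00 gy)].
have [w0 [Tw0 _ w0y _]] := tangent_line hC Cy (hsm Cy).
have kerM (u : 'rV[k]_n.+1) : tangent C y u -> (u <= kermx M^T)%MS.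
  move=> Tu; apply/sub_kermxP/rowP => l; rewrite !mxE.
  have [[d hF] F0] := IF l; have := Tu _ (IF l).1 F0 => e.
  rewrite -[RHS](mulr0 ((rep y 0 i0)^-1 ^+ d.-1)) -[in RHS]e mulr_sumr.
  apply: eq_bigr => i _; rewrite !mxE mulrC mulrA; congr (_ * _).
  rewrite -(ev_scale _ _ (dhomog_mderiv i hF)).
  by apply: mmap_ext => i'; rewrite mxE mulrC.
have lt2 : (1 < \rank (rep y + w0)%MS)%N.
  have r1 : \rank (rep y) = 1%N by rewrite rank_rV rep_neq0.
  rewrite -[X in (X < _)%N]r1; apply: rank_ltmx; rewrite /ltmx addsmxSl addsmx_sub submx_refl /=.
  by apply/negP => /sub_rVP[a e]; exact: (w0y a).
have : (\rank (rep y + w0)%MS <= \rank (kermx M^T))%N.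
  by apply: mxrankS; rewrite addsmx_sub !kerM //; exact: tangent_rep.
rewrite mxrank_ker mxrank_tr (eqP freeM) => le.
have := leq_trans lt2 le; have := rank_leq_col M; rewrite (eqP freeM); lia.
Qed.

(** A maximal independent family of gradients over K has corank at least two, so some vector killed
    by all gradients is not proportional to [z]. Subtracting a multiple of [z], which is killed too
    by Euler's identity, makes the coordinate [i0] zero. *)
Lemma exists_tangent : exists eta : 'I_n.+1 -> K, [/\ eta i0 = 0, exists i, eta i != 0 &
  forall F, I F -> \sum_i mmap emb z (mderiv i F) * eta i = 0].
Proof.
pose P r := `[< exists F : 'I_r -> {mpoly k[n.+1]}, (forall l, I (F l)) /\ row_free (gradmx F) >].
have exP : exists r, P r.
  exists 0%N; apply/asboolP; exists (fun=> 0); split; first by case.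
  by rewrite /row_free eqn_leq rank_leq_row.
have ubP r : P r -> (r <= n.+1)%N.
  by move=> /asboolP[F [IF freeF]]; have := grad_rank IF freeF; lia.
have [r /asboolP[F [IF freeF]] maxr] := ex_maxnP exP ubP.
have ler := grad_rank IF freeF; set A := gradmx F in freeF.
have spanA G : I G -> (\row_i mmap emb z (mderiv i G) <= A)%MS.
  move=> IG; apply: contrapT => /negP nsub.
  pose F' (l : 'I_r.+1) := if unlift ord_max l is Some l' then F l' else G.
  suff /maxr : P r.+1 by rewrite ltnn.
  apply/asboolP; exists F'; split.
    by move=> l; rewrite /F'; case: unliftP.
  rewrite /row_free eqn_leq rank_leq_row /=.
  set u := \row_i _ in nsub.
  have ltA : (\rank A < \rank (A + u)%MS)%N.
    by apply: rank_ltmx; rewrite /ltmx addsmxSl addsmx_sub submx_refl.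
  rewrite (eqP freeF) in ltA; apply: leq_trans ltA _; apply: mxrankS.
  rewrite addsmx_sub; apply/andP; split.
    apply/row_subP => l; have -> : row l A = row (lift ord_max l) (gradmx F').
      by apply/rowP => i; rewrite !mxE /F' liftK.
    exact: row_sub.
  have -> : u = row ord_max (gradmx F').
    by apply/rowP => i; rewrite !mxE /F' unlift_none.
  exact: row_sub.
have [l nl] : exists l, ~~ (row l (kermx A^T) <= \row_i z i)%MS.
  apply/row_subPn; apply/negP => /mxrankS.
  rewrite mxrank_ker mxrank_tr (eqP freeF) rank_rV.
  by case: (_ != 0) => /=; lia.
set de := row l _ in nl.
have deA : de *m A^T = 0 by rewrite -row_mul mulmx_ker row0.
have zi0 : z i0 = 1 by rewrite /z divff.
exists (fun i => de 0 i - de 0 i0 * z i); split.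
- by rewrite zi0 mulr1 subrr.
- apply: contrapT => /forallNP e0; case/negP: nl; apply/sub_rVP.
  exists (de 0 i0); apply/rowP => i; rewrite !mxE; apply/eqP; rewrite -subr_eq0.
  by have /negP/negPn := e0 i; rewrite !mxE.
- move=> G [[d hG] G0].
  under eq_bigr => i _ do rewrite mulrBr mulrCA.
  rewrite sumrB -mulr_sumr.
  have -> : \sum_i mmap emb z (mderiv i G) * z i = 0.
    have := euler_homog hG => /(congr1 (mmap emb z)).
    rewrite rmorph_sum rmorphMn /= (z_homog hG) (proj2 (gen_eq0 gw (ex_intro _ d hG)) G0) mul0r mul0rn.
    by move=> e; rewrite -[RHS]e; apply: eq_bigr => i _; rewrite rmorphM /= mmapX mmap1U.
  rewrite mulr0 subr0; have /submxP[X uX] := spanA G (conj (ex_intro _ d hG) G0).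
  have : (de *m (\row_i mmap emb z (mderiv i G))^T) 0 0 = 0.
    by rewrite uX trmx_mul mulmxA deA mul0mx mxE.
  by rewrite mxE => e; rewrite -[RHS]e; apply: eq_bigr => i _; rewrite mulrC; congr (_ * _); rewrite !mxE.
Qed.

Lemma exists_derivation : exists D : K -> K, derivation emb D /\ exists q, D q != 0.
Proof.
have [eta [eta0 [l etal] etaI]] := exists_tangent.
pose dz F := \sum_i mmap emb z (mderiv i F) * eta i.
have dzD F G : dz (F + G) = dz F + dz G.
  rewrite -big_split; apply: eq_bigr => i _ /=.
  by rewrite mderivD rmorphD mulrDl.
have dzM F G : dz (F * G) = mmap emb z F * dz G + dz F * mmap emb z G.
  rewrite /dz mulr_sumr mulr_suml -big_split; apply: eq_bigr => i _ /=.
  by rewrite mderivM rmorphD !rmorphM /=; ring.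
have dzN F : dz (- F) = - dz F.
  by rewrite /dz -sumrN; apply: eq_bigr => i _; rewrite mderivN rmorphN mulNr.
have dzC c : dz c%:MP = 0.
  by rewrite /dz big1 // => i _; rewrite mderivC rmorph0 mul0r.
have dzX i : dz 'X_i = eta i.
  rewrite /dz (bigD1 i) //= mderivX mnm1E eqxx scale1r big1 ?addr0.
    have -> : (U_(i) - U_(i))%MM = 0%MM :> 'X_{1..n.+1}.
      by apply/mnmP => m; rewrite mnmBE mnm0E subnn.
    by rewrite mpolyX0 rmorph1 mul1r.
  by move=> m mi; rewrite mderivX mnm1E eq_sym (negPf mi) scale0r rmorph0 mul0r.
pose DR q q' := exists d F G, [/\ F \is d.-homog, G \is d.-homog, mmap emb z G != 0,
  mmap emb z F = q * mmap emb z G & q' * mmap emb z G = dz F - q * dz G].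
have DRtot q : exists q', DR q q'.
  have [d [F [G [hF hG G0 ->]]]] := gen_frac gw q.
  have G0' : mmap emb z G != 0 by rewrite (z_homog hG) mulf_neq0 ?invr_eq0 ?expf_neq0.
  exists ((dz F - evK F / evK G * dz G) / mmap emb z G), d, F, G; split=> //.
    by rewrite (z_homog hF) (z_homog hG) mulrA divfK.
  by rewrite divfK.
(* Two fractions F/G and F'/G' for q give the form F G' - F' G, which vanishes on C; the tangency of
   [eta] to it is the equality of the two derivatives. *)
have DRfun q a b : DR q a -> DR q b -> a = b.
  move=> [d [F [G [hF hG G0 FG aE]]]] [e [F' [G' [hF' hG' G0' FG' bE]]]].
  have hH : F * G' - F' * G \is (d + e).-homog.
    by apply: rpredB; [exact: dhomogM|rewrite addnC; exact: dhomogM].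
  have IH : I (F * G' - F' * G).
    split; first by exists (d + e)%N.
    apply: (proj1 (gen_eq0 gw (ex_intro _ (d + e)%N hH))).
    have := z_homog hH; rewrite rmorphB !rmorphM /= FG FG'.
    have -> : q * mmap emb z G * mmap emb z G' - q * mmap emb z G' * mmap emb z G = 0 by ring.
    by move/esym/eqP; rewrite mulf_eq0 invr_eq0 (negPf (expf_neq0 _ wi0)) orbF => /eqP.
  have := etaI _ IH; rewrite -/(dz _) dzD dzN !dzM FG FG' => e0.
  apply: (mulIf (mulf_neq0 G0 G0')).
  have -> : a * (mmap emb z G * mmap emb z G') = (a * mmap emb z G) * mmap emb z G' by ring.
  have -> : b * (mmap emb z G * mmap emb z G') = (b * mmap emb z G') * mmap emb z G by ring.
  rewrite aE bE; apply/eqP; rewrite -subr_eq0; apply/eqP; rewrite -[RHS]e0; ring.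
have [D DE] := choice DRtot.
have DP q q' : DR q q' -> D q = q' by move=> h; exact: DRfun (DE q) h.
exists D; split; first split.
- move=> a b; apply: DP.
  have [d [F [G [hF hG G0 FG aE]]]] := DE a; have [e [F' [G' [hF' hG' G0' FG' bE]]]] := DE b.
  exists (d + e)%N, (F * G' + G * F'), (G * G'); split.
  + by apply: rpredD; exact: dhomogM.
  + exact: dhomogM.
  + by rewrite rmorphM mulf_neq0.
  + by rewrite rmorphD !rmorphM /= FG FG'; ring.
  + rewrite rmorphM dzD !dzM /=.
    have -> : (D a + D b) * (mmap emb z G * mmap emb z G') =
      (D a * mmap emb z G) * mmap emb z G' + (D b * mmap emb z G') * mmap emb z G by ring.
    rewrite aE bE FG FG'; ring.
- move=> a b; apply: DP.
  have [d [F [G [hF hG G0 FG aE]]]] := DE a; have [e [F' [G' [hF' hG' G0' FG' bE]]]] := DE b.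
  exists (d + e)%N, (F * F'), (G * G'); split.
  + exact: dhomogM.
  + exact: dhomogM.
  + by rewrite rmorphM mulf_neq0.
  + by rewrite !rmorphM /= FG FG'; ring.
  + rewrite rmorphM !dzM /=.
    have -> : (D a * b + a * D b) * (mmap emb z G * mmap emb z G') =
      b * (D a * mmap emb z G) * mmap emb z G' + a * (D b * mmap emb z G') * mmap emb z G by ring.
    rewrite aE bE FG FG'; ring.
- move=> c; apply: DP; exists 0%N, c%:MP, 1; split.
  + by rewrite -[c%:MP]mulr1 mul_mpolyC; apply: dhomogZ; exact: dhomog1.
  + exact: dhomog1.
  + by rewrite rmorph1 oner_eq0.
  + by rewrite mmapC rmorph1 mulr1.
  + by rewrite -mpolyC1 !dzC mul0r mulr0 subrr.
exists (z l); have -> // : D (z l) = eta l; apply: DP.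
exists 1%N, 'X_l, 'X_i0; rewrite !mmapX !mmap1U !dzX eta0 mulr0 subr0 /z divff // !mulr1.
by split=> //; [exact: hom_coord|exact: hom_coord|exact: oner_neq0].
Qed.

End ExistsDerivation.

Lemma derXz (k K : fieldType) (emb : {rmorphism k -> K}) D (hD : derivation emb D) t (m : int) :
  t != 0 -> D (t ^ m) = m%:~R * t ^ (m - 1) * D t.
Proof.
move=> t0; case: m => m.
  rewrite -exprnP (derX hD); case: m => [|m]; first by rewrite mulr0n !mul0r.
  have -> : m.+1%:Z - 1 = m%:Z by rewrite -natz -addn1 natrD addrK natz.
  by rewrite -exprnP /= -mulr_natl pmulrn mulrA.
have -> : t ^ Negz m = (t ^+ m.+1)^-1 by [].
rewrite (derV hD) ?expf_neq0 // (derX hD) /=.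
have -> : Negz m - 1 = Negz m.+1 by rewrite !NegzE; lia.
have -> : t ^ Negz m.+1 = (t ^+ m.+2)^-1 by [].
rewrite NegzE mulrNz -mulr_natl -pmulrn !exprS; set N := _%:R.
by field; rewrite t0 expf_neq0.
Qed.

Lemma infinite_inj (T : Type) (A : set T) (f : nat -> T) :
  (forall m, A (f m)) -> injective f -> infinite_set A.
Proof.
move=> Af injf finA; apply: infinite_nat.
pose l x := if pselect (exists m, f m = x) is left h then projT1 (cid h) else 0%N.
apply: (sub_finite_set _ (finite_image l finA)) => m _; exists (f m) => //.
rewrite /l; case: pselect => [h|]; last by case; exists m.
exact: injf (projT2 (cid h)).
Qed.

(** * Orders of functions and of their derivatives *)

Section DerivationOrder.
Variables (k : numClosedFieldType) (n : nat) (K : fieldType) (emb : {rmorphism k -> K}).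
Variables (w : 'I_n.+1 -> K) (C : set (proj k n)).
Hypotheses (gw : generic C emb w) (hC : curve C) (hsm : smooth C).
Local Notation evK := (mmap emb w).
Local Notation reg := (reg emb w).
Local Notation uniformizer := (uniformizer emb w).

Lemma natK_neq0 m : m.+1%:R != 0 :> K.
Proof. by rewrite -(rmorph_nat emb) fmorph_eq0 pnatr_eq0. Qed.

Lemma unif_exists x : C x -> exists t, uniformizer x t.
Proof. by move=> Cx; have [t []] := exists_uniformizer gw hC Cx (hsm Cx); exists t. Qed.

Lemma unif_mul x t u c : C x -> uniformizer x t -> reg x u c -> c != 0 -> uniformizer x (t * u).
Proof.
move=> Cx ut uc c0; have gx := reg_graph gw Cx; have u0 := pg_neq0 gx uc c0.
split; first by rewrite mulrC; apply: (regM0 gw Cx); [exists c|exact: unif0].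
  by rewrite mulf_neq0 // (unif_neq0 ut).
move=> q q0; rewrite invfM mulrA; apply: (domM gw) => //; first exact: unif_div.
by exists c^-1; exact: reg_local.
Qed.

Lemma unif_ratio x t s : C x -> uniformizer x t -> uniformizer x s ->
  exists u c, [/\ c != 0, reg x u c & s = t * u].
Proof.
move=> Cx ut us; have gx := reg_graph gw Cx.
have [c st] := unif_div ut (unif0 us); have [d ts] := unif_div us (unif0 ut).
exists (s / t), c; split=> //; last by rewrite mulrC divfK // (unif_neq0 ut).
have := pgM gx st ts; rewrite mulrA divfK ?(unif_neq0 ut) // divff ?(unif_neq0 us) // => e.
apply/eqP => c0; rewrite c0 mul0r in e.
by have /eqP := pg_fun gx e (pg11 gx); rewrite eq_sym oner_eq0.
Qed.

Lemma center H : place_graph emb H -> exists2 x, C x & forall q c, H q c -> reg x q c.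
Proof.
move=> gH; have [cC _ _] := hC.
by apply: (place_center gw hC _ cC gH) => x Cx; exact: unif_exists.
Qed.

Lemma normalize x (I : finType) (v : I -> K) i0 : C x -> v i0 != 0 ->
  exists j, v j != 0 /\ forall i, dom (reg x) (v i / v j).
Proof.
by move=> Cx vi0; have [t ut] := unif_exists Cx; exact: (reg_normalize gw Cx ut vi0).
Qed.

Lemma nonconstant_vanish q x : C x -> (forall c, q != emb c) -> dom (reg x) q ->
  exists c t N u d, [/\ uniformizer x t, reg x q c, d != 0, reg x u d & q - emb c = t ^+ N.+1 * u].
Proof.
move=> Cx qc [c qx]; have gx := reg_graph gw Cx; have [t ut] := unif_exists Cx.
have q0 : reg x (q - emb c) 0.
  by rewrite -[X in reg _ _ X](subrr c); apply: (pgB gx) => //; exact: (pgC gx).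
have [||N [u [d [d0 ud qE]]]] := unif_order gw Cx ut (q := q - emb c).
- by exists 0.
- by rewrite subr_eq0.
case: N qE => [qE|N qE]; last by exists c, t, N, u, d.
rewrite expr0 mul1r in qE; rewrite -qE in ud.
by move: d0; rewrite (pg_fun gx ud q0) eqxx.
Qed.

Section Derivation.
Variable D : K -> K.
Hypotheses (hD : derivation emb D) (D0 : exists q, D q != 0).

Lemma der_local x : C x -> exists t r, [/\ uniformizer x t, r != 0,
  forall q, dom (reg x) q -> dom (reg x) (r * D q) &
  exists2 c, c != 0 & reg x (r * D t) c].
Proof.
move=> Cx; have [t [ut _ /(_ D hD D0)[r [r0 rD rt]]]] := exists_uniformizer gw hC Cx (hsm Cx).
by exists t, r.
Qed.

Lemma der_unif x t r s : C x -> uniformizer x t ->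
  (forall q, dom (reg x) q -> dom (reg x) (r * D q)) ->
  (exists2 c, c != 0 & reg x (r * D t) c) -> uniformizer x s ->
  exists2 c, c != 0 & reg x (r * D s) c.
Proof.
move=> Cx ut rD [c c0 rt] us; have gx := reg_graph gw Cx.
have [u [d [d0 ud ->]]] := unif_ratio Cx ut us.
exists (c * d + 0); first by rewrite addr0 mulf_neq0.
have -> : r * D (t * u) = r * D t * u + t * (r * D u) by rewrite (derM hD); ring.
apply: (pgD gx); first exact: (pgM gx).
by rewrite mulrC; apply: (regM0 gw Cx); [apply: rD; exists d|exact: unif0].
Qed.

(** Differentiation lowers a nonzero order by exactly one: the new leading value has the factor m,
    nonzero in characteristic zero. *)
Lemma der_order x t r c (m : int) u d : C x -> uniformizer x t ->
  (forall q, dom (reg x) q -> dom (reg x) (r * D q)) ->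
  reg x (r * D t) c -> reg x u d ->
  exists2 u', r * D (t ^ m * u) = t ^ (m - 1) * u' & reg x u' (m%:~R * c * d).
Proof.
move=> Cx ut rD rt ud; have gx := reg_graph gw Cx; have t0 := unif_neq0 ut.
exists (m%:~R * (r * D t) * u + t * (r * D u)).
  rewrite (derM hD) (derXz hD) //.
  have -> : t ^ m = t ^ (m - 1) * t.
    by rewrite -[X in _ * X]expr1z -expfzDr // subrK.
  by ring.
rewrite -[X in reg _ _ X]addr0; apply: (pgD gx).
  apply: (pgM gx) => //; apply: (pgM gx) => //.
  by rewrite -(rmorph_int emb); exact: (pgC gx).
by rewrite mulrC; apply: (regM0 gw Cx); [apply: rD; exists d|exact: unif0].
Qed.

(** At a point where q is regular, q minus its value has a positive finite order, and the derivative
    has order one less. *)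
Lemma der_neq0 q : (forall c, q != emb c) -> D q != 0.
Proof.
move=> qc; have [x Cx nx] := infinite_avoid hC (reg_finite gw hC q).
have dq : dom (reg x) q by apply: contrapT => nd; apply: nx.
have gx := reg_graph gw Cx.
have [c [s [N [u [d [us qx d0 ud qE]]]]]] := nonconstant_vanish Cx qc dq.
have [t [r [ut r0 rD rt]]] := der_local Cx.
have [e e0 rs] := der_unif Cx ut rD rt us.
have [u' uE u'd] := der_order N.+1%:Z Cx us rD rs ud.
have : r * D q = s ^ (N.+1%:Z - 1) * u'.
  by rewrite -uE -exprnP -qE (derB hD) (derC hD) subr0.
have : u' != 0.
  apply: (pg_neq0 gx u'd); rewrite !mulf_neq0 //.
  by rewrite intr_eq0.
move=> u'0 e1; apply/eqP => Dq; move/eqP: e1; rewrite Dq mulr0 eq_sym.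
by rewrite mulf_eq0 (negPf u'0) orbF expfz_eq0 (negPf (unif_neq0 us)) andbF.
Qed.

Variable g : K.
Hypothesis Dg : D g = 1.

(** Since D(g - c) = 1, the factor [r] is itself a unit when g - c is a local parameter, so D
    already preserves the local ring. *)
Lemma unram_dom x c q : C x -> uniformizer x (g - emb c) -> dom (reg x) q -> dom (reg x) (D q).
Proof.
move=> Cx ug dq; have gx := reg_graph gw Cx.
have [t [r [ut r0 rD rt]]] := der_local Cx.
have [e e0] := der_unif Cx ut rD rt ug; rewrite (derB hD) (derC hD) subr0 Dg mulr1 => re.
rewrite -[D q](mulKf r0); apply: (domM gw) => //; last exact: rD.
by exists e^-1; exact: reg_local.
Qed.

(** Off a finite set g and the derivatives of the affine coordinates are regular, so D preserves the
    local ring. If g - c had order at least two there, its derivative 1 would vanish. *)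
Lemma unram_finite : finite_set [set x | C x /\ ~ exists c, uniformizer x (g - emb c)].
Proof.
have [p Cp] := infinite_setN0 (curve_infinite hC).
have [j pj] := coord_neq0 p; have wj := gen_coord_neq0 gw Cp pj.
have hX : hom ('X_j : {mpoly k[n.+1]}) by exists 1%N; exact: hom_coord.
have X0 : evK 'X_j != 0 by rewrite mmapX mmap1U.
have fin1 := curve_zeros_finite hC hX (gen_nonvanish gw hX X0).
have fin2 : finite_set (\bigcup_(i in [set: 'I_n.+1]) [set x | C x /\ ~ dom (reg x) (D (w i / w j))]).
  by apply: bigcup_finite => [|i _]; [exact: finite_finset|exact: reg_finite gw hC _].
apply: (@sub_finite_set _ _ ([set x | C x /\ ev 'X_j (rep x) = 0] `|`
  ((\bigcup_(i in [set: 'I_n.+1]) [set x | C x /\ ~ dom (reg x) (D (w i / w j))]) `|`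
   [set x | C x /\ ~ dom (reg x) g]))); last first.
  by rewrite !finite_setU; split=> //; split=> //; exact: reg_finite gw hC _.
move=> x [Cx nu]; apply: contrapT => /not_orP[n1 /not_orP[n2 n3]]; apply: nu.
have gx := reg_graph gw Cx.
have xj : rep x 0 j != 0 by apply/eqP => e; apply: n1; rewrite /= evXU.
have dg : dom (reg x) g by apply: contrapT => nd; apply: n3.
have dDz i : dom (reg x) (D (w i / w j)) by apply: contrapT => nd; apply: n2; exists i.
pose xi i := emb (rep x 0 j) / w j * w i.
have dDxi i : dom (reg x) (D (xi i)).
  have -> : xi i = emb (rep x 0 j) * (w i / w j) by rewrite /xi mulrAC mulrA.
  by rewrite (derCM hD); apply: (domM gw) => //; exact: (domC gw).
have dxi F : dom (reg x) (mmap emb xi F) by eexists; exact: (reg_xi gw Cx xj).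
have dDF F : dom (reg x) (D (mmap emb xi F)).
  by rewrite (der_mmap hD); apply: (dom_sum gw) => // i; exact: (domM gw).
have dD q : dom (reg x) q -> dom (reg x) (D q).
  move=> [_ [d [F [G [hF hG Gx -> _]]]]].
  rewrite (reg_affine emb xj hF hG wj) -/xi.
  have rG := reg_xi gw Cx xj G; rewrite -/xi in rG.
  have G0 := pg_neq0 gx rG Gx.
  have dGV : dom (reg x) (mmap emb xi G)^-1 by exists (ev G (rep x))^-1; exact: reg_local.
  rewrite (der_frac hD) //; apply: (domM gw) => //; apply: (domD gw) => //.
  by apply: (domN gw) => //; apply: (domM gw) => //; exact: (domM gw).
have gc c : g != emb c.
  by apply/eqP => gc; move: Dg; rewrite gc (derC hD) => /eqP; rewrite eq_sym oner_eq0.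
have [c [t [N [u [d [ut gx' d0 ud gE]]]]]] := nonconstant_vanish Cx gc dg.
exists c; case: N gE => [|N] gE; first by rewrite gE expr1; exact: unif_mul ut ud d0.
have : reg x (D (g - emb c)) 0.
  rewrite gE (derM hD) (derX hD) /=.
  have -> : (t ^+ N.+1 * D t) *+ N.+2 * u + t ^+ N.+2 * D u =
      (N.+2%:R * t ^+ N * D t * u + t ^+ N.+1 * D u) * t.
    by rewrite -mulr_natl !exprS; ring.
  have dt : dom (reg x) t by exists 0; exact: unif0.
  have dtX m : dom (reg x) (t ^+ m) by case: dt => e te; exists (e ^+ m); exact: (pgX _ gx).
  have du : dom (reg x) u by exists d.
  apply: (regM0 gw Cx); last exact: unif0.
  apply: (domD gw) => //; last by apply: (domM gw) => //; exact: dD.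
  do 2![apply: (domM gw) => //]; last exact: dD.
  by apply: (domM gw) => //; rewrite -(rmorph_nat emb); exact: (domC gw).
rewrite (derB hD) (derC hD) subr0 Dg => e.
by have /eqP := pg_fun gx (pg11 gx) e; rewrite oner_eq0.
Qed.

End Derivation.

Definition ev2K (P : {poly {poly k}}) (a b : K) : K :=
  (map_poly (fun p : {poly k} => (map_poly emb p).[a]) P).[b].

Let ev1 (a : K) (p : {poly k}) := (map_poly emb p).[a].
Let ev1_zmod a : zmod_morphism (ev1 a).
Proof. by move=> p q; rewrite /ev1 rmorphB hornerD hornerN. Qed.
Let ev1_monoid a : monoid_morphism (ev1 a).
Proof. by split=> [|p q]; rewrite /ev1 ?rmorph1 ?hornerC // rmorphM hornerM. Qed.
HB.instance Definition _ a := GRing.isZmodMorphism.Build _ _ (ev1 a) (ev1_zmod a).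
HB.instance Definition _ a := GRing.isMonoidMorphism.Build _ _ (ev1 a) (ev1_monoid a).

Lemma reg_ev2K x P a b c d : C x -> reg x a c -> reg x b d ->
  reg x (ev2K P a b) P.[d%:P].[c].
Proof.
move=> Cx ac bd; have gx := reg_graph gw Cx.
have -> : P.[d%:P].[c] = \sum_(i < size P) (P`_i).[c] * d ^+ i.
  by rewrite [P.[_]]horner_coef horner_sum; apply: eq_bigr => i _; rewrite hornerM horner_exp hornerC.
rewrite /ev2K (@horner_coef_wide _ (size P)) ?size_poly //.
apply: (@pg_sum _ _ _ (reg x) _ _ xpredT (fun i : 'I_(size P) => (map_poly (ev1 a) P)`_i * b ^+ i)
   (fun i : 'I_(size P) => (P`_i).[c] * d ^+ i) gx) => i _.
rewrite coef_map; apply: (pgM gx); last exact: (pgX _ gx).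
exact: (pg_horner _ gx).
Qed.

(* If g, q were algebraically independent, g would vanish at a point where q = c
   for each c in k. *)
Lemma algebraic_over g q : (forall c, g != emb c) ->
  exists2 P : {poly {poly k}}, P != 0 & ev2K P g q = 0.
Proof.
move=> gc; apply: contrapT => indep.
have {}indep P : ev2K P g q = 0 -> P = 0.
  by move=> P0; apply: contrapT => /eqP nP; apply: indep; exists P.
have evD P Q : ev2K (P + Q) g q = ev2K P g q + ev2K Q g q.
  by rewrite /ev2K -/(ev1 g) rmorphD hornerD.
have evM P Q : ev2K (P * Q) g q = ev2K P g q * ev2K Q g q.
  by rewrite /ev2K -/(ev1 g) rmorphM hornerM.
have evC c : ev2K c%:P%:P g q = emb c.
  by rewrite /ev2K -/(ev1 g) map_polyC hornerC /= /ev1 map_polyC hornerC.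
have pt (s : k) : exists x, [/\ C x, reg x g 0 & reg x q s].
  pose H a c := exists P, a = ev2K P g q /\ c = P.[s%:P].[0].
  have gH : place_graph emb H.
    split.
    - by move=> c; exists c%:P%:P; rewrite evC !hornerC.
    - by move=> _ _ _ _ [P [-> ->]] [Q [-> ->]]; exists (P + Q); rewrite evD !hornerD.
    - by move=> _ _ _ _ [P [-> ->]] [Q [-> ->]]; exists (P * Q); rewrite evM !hornerM.
    - by move=> c [P [/esym/indep -> ->]]; rewrite !horner0.
  have [x Cx regx] := center gH; exists x; split=> //; apply: regx.
    exists ('X)%:P; rewrite !hornerC hornerX /ev2K -/(ev1 g) map_polyC hornerC /= /ev1.
    by rewrite map_polyX hornerX.
  by exists 'X; rewrite !hornerX hornerC /ev2K -/(ev1 g) map_polyX hornerX.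
have [pts ptsE] := choice pt.
have : g = 0; last by apply/eqP; rewrite -(rmorph0 emb).
apply: (reg_all0 gw hC); apply: (infinite_inj (f := fun m => pts m%:R)).
  by move=> m; have [Cm rm _] := ptsE m%:R.
move=> m m' e; have [Cm _ rm] := ptsE m%:R; have [_ _ rm'] := ptsE m'%:R.
rewrite -e in rm'; have /eqP := pg_fun (reg_graph gw Cm) rm rm'.
by rewrite eqr_nat => /eqP.
Qed.

End DerivationOrder.

(** * Maps to projective space *)

(* v is a vector of homogeneous coordinates of the value at x of the rational map Phi. *)
Definition pval (k : closedFieldType) n (K : fieldType) (emb : {rmorphism k -> K})
    (w : 'I_n.+1 -> K) m (Phi : 'I_m.+1 -> K) (x : proj k n) (v : 'rV[k]_m.+1) : Prop :=
  exists2 s, s != 0 & forall i, reg emb w x (s * Phi i) (v 0 i).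

Lemma vlineZ (F : fieldType) (vT : vectType F) (a : F) (v : vT) : a != 0 ->
  (<[a *: v]> = <[v]>)%VS.
Proof.
move=> a0; apply/eqP; rewrite eqEsubv -!memvE memvZ ?memv_line //=.
by rewrite -[X in X \in _](scalerK a0) memvZ ?memv_line.
Qed.

Section RegularMap.
Variables (k : closedFieldType) (n m : nat) (K : fieldType) (emb : {rmorphism k -> K}).
Variables (w : 'I_n.+1 -> K) (C : set (proj k n)) (Phi : 'I_m.+1 -> K).
Hypothesis gw : generic C emb w.
Local Notation evK := (mmap emb w).
Local Notation reg := (reg emb w).
Local Notation pval := (pval emb w Phi).

Lemma pval_neq0 x v i : C x -> pval x v -> v 0 i != 0 -> Phi i != 0.
Proof.
move=> Cx [s s0 sv] vi; have := pg_neq0 (reg_graph gw Cx) (sv i) vi.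
by rewrite mulf_eq0 negb_or => /andP[].
Qed.

Lemma pval_ratio x v i j : C x -> pval x v -> v 0 j != 0 ->
  reg x (Phi i / Phi j) (v 0 i / v 0 j).
Proof.
move=> Cx [s s0 sv] vj; have gx := reg_graph gw Cx.
have -> : Phi i / Phi j = s * Phi i * (s * Phi j)^-1.
  by rewrite invfM mulrACA divff // mul1r.
by apply: (pgM gx) => //; exact: reg_local.
Qed.

Lemma pval_intro x (v : 'rV[k]_m.+1) j : Phi j != 0 -> (forall i, reg x (Phi i / Phi j) (v 0 i)) -> pval x v.
Proof. by move=> Pj rv; exists (Phi j)^-1 => [|i]; rewrite ?invr_eq0 // mulrC. Qed.

Lemma pvalZ x v a : C x -> a != 0 -> pval x v -> pval x (a *: v).
Proof.
move=> Cx a0 [s s0 sv]; have gx := reg_graph gw Cx.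
exists (emb a * s) => [|i]; first by rewrite mulf_neq0 // fmorph_eq0.
by rewrite mxE -mulrA; apply: (pgM gx) => //; exact: (pgC gx).
Qed.

Lemma pval_form x v d F : C x -> pval x v -> F \is d.-homog ->
  exists2 s, s != 0 & reg x (s * mmap emb Phi F) (ev F v).
Proof.
move=> Cx [s s0 sv] hF; exists (s ^+ d); first by rewrite expf_neq0.
rewrite -(mmap_scale emb Phi s hF); apply: (pg_mmap _ (reg_graph gw Cx)).
exact: sv.
Qed.

Lemma neq0_coord (v : 'rV[k]_m.+1) : v != 0 -> exists j, v 0 j != 0.
Proof. by move=> /rV0Pn. Qed.

Lemma pval_uniq x v v' : C x -> v != 0 -> v' != 0 -> pval x v -> pval x v' ->
  exists2 a, a != 0 & v' = a *: v.
Proof.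
move=> Cx v0 v'0 pv pv'; have gx := reg_graph gw Cx.
have [j vj] := neq0_coord v0; have [l vl] := neq0_coord v'0.
have r1 i := pval_ratio i Cx pv vj; have r2 i := pval_ratio i Cx pv' vl.
have Pj := pval_neq0 Cx pv vj; have Pl := pval_neq0 Cx pv' vl.
have prod : (v 0 l / v 0 j) * (v' 0 j / v' 0 l) = 1.
  apply: (pg_fun gx (pgM gx (r1 l) (r2 j))).
  by rewrite mulrA divfK // divff //; exact: (pg11 gx).
have vl0 : v 0 l != 0.
  by apply/eqP => e; move: prod; rewrite e !mul0r => /eqP; rewrite eq_sym oner_eq0.
exists (v' 0 l / v 0 l); first by rewrite mulf_neq0 ?invr_eq0.
apply/rowP => i; rewrite mxE.
have : v' 0 i / v' 0 l = v 0 i / v 0 j / (v 0 l / v 0 j).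
  apply: (pg_fun gx (r2 i)).
  have -> : Phi i / Phi l = Phi i / Phi j * (Phi l / Phi j)^-1 by rewrite invf_div mulrA divfK.
  by apply: (pgM gx) => //; apply: reg_local => //; rewrite mulf_neq0 ?invr_eq0.
move=> e; apply: (mulIf (invr_neq0 vl)); rewrite e; field; by rewrite vj vl0 vl.
Qed.

(* Near x the map is given by the numerators of the Phi i / Phi j over a common denominator. *)
Lemma pval_regular (phi : proj k n -> proj k m) :
  (forall x, C x -> exists2 v, pval x v & val (phi x) = <[v]>%VS) ->
  regular_map C phi.
Proof.
move=> phiE x Cx; have gx := reg_graph gw Cx.
have [v pv xv] := phiE x Cx; have v0 := line_neq0 xv.
have [j vj] := neq0_coord v0; have Pj := pval_neq0 Cx pv vj.
have fr i : exists dFG : nat * ({mpoly k[n.+1]} * {mpoly k[n.+1]}),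
    [/\ dFG.2.1 \is dFG.1.-homog, dFG.2.2 \is dFG.1.-homog, ev dFG.2.2 (rep x) != 0 &
    Phi i / Phi j = evK dFG.2.1 / evK dFG.2.2].
  have [d [F [G [hF hG Gx e _]]]] := pval_ratio i Cx pv vj; by exists (d, (F, G)).
have [dFG frE] := choice fr.
pose d i := (dFG i).1; pose F i := (dFG i).2.1; pose G i := (dFG i).2.2.
pose GG := \prod_i G i; pose FF i := F i * \prod_(l | l != i) G l.
have homprod (P : pred 'I_m.+1) : \prod_(l | P l) G l \is (\sum_(l | P l) d l).-homog.
  apply: (big_rec2 (fun (e : nat) (H : {mpoly k[n.+1]}) => H \is e.-homog)).
    exact: dhomog1.
  by move=> l e H _ hH; apply: dhomogM => //; have [] := frE l.
have hGG : GG \is (\sum_l d l).-homog := homprod _.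
have homGG : hom GG by exists (\sum_l d l)%N.
have hFF i : FF i \is (\sum_l d l).-homog.
  by rewrite (bigD1 i) //=; apply: dhomogM; [have [] := frE i|exact: homprod].
have evprod (P : pred 'I_m.+1) y : ev (\prod_(l | P l) G l) (rep y) = \prod_(l | P l) ev (G l) (rep y).
  exact: rmorph_prod.
exists [set y | ev GG (rep y) != 0]; split.
- exact: zopen_form.
- rewrite /= evprod; apply/prodf_neq0 => l _; by have [] := frE l.
exists (\sum_l d l)%N, FF; split=> // y Cy /= GGy.
have gy := reg_graph gw Cy.
have GGE i : GG = G i * \prod_(l | l != i) G l by rewrite /GG (bigD1 i).
have py i : reg y (Phi i / Phi j) (ev (FF i) (rep y) / ev GG (rep y)).
  have -> : Phi i / Phi j = evK (FF i) / evK GG.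
    have nz : evK (\prod_(l | l != i) G l) != 0.
      have := gen_neq0 gw homGG Cy GGy; rewrite (GGE i) rmorphM mulf_eq0 negb_or.
      by case/andP.
    rewrite (GGE i) !rmorphM /= -mulf_div (divff nz) mulr1.
    by have [] := frE i.
  exact: reg_frac.
pose v' := (ev GG (rep y))^-1 *: \row_i ev (FF i) (rep y).
have pv' : pval y v'.
  by apply: (pval_intro Pj) => i; rewrite !mxE [X in reg _ _ X]mulrC; exact: py.
have v'0 : v' != 0.
  apply/eqP => /rowP/(_ j); rewrite !mxE => e.
  have := py j; rewrite divff // [X in reg _ _ X]mulrC e => e1.
  by have /eqP := pg_fun gy e1 (pg11 gy); rewrite eq_sym oner_eq0.
have [u pu uE] := phiE y Cy; have u0 := line_neq0 uE.
have [a a0 e] := pval_uniq Cy u0 v'0 pu pv'.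
have eu : \row_i ev (FF i) (rep y) = (ev GG (rep y) * a) *: u.
  by rewrite -scalerA -e scalerA divff // scale1r.
by rewrite uE eu vlineZ // mulf_neq0.
Qed.

End RegularMap.

(** * Injective immersions are isomorphisms onto their images *)

Section Embedding.
Variables (k : numClosedFieldType) (n m : nat) (K : fieldType) (emb : {rmorphism k -> K}).
Variables (w : 'I_n.+1 -> K) (C : set (proj k n)) (Phi : 'I_m.+1 -> K).
Hypotheses (gw : generic C emb w) (hC : curve C) (hsm : smooth C).
Local Notation evK := (mmap emb w).
Local Notation regD := (reg emb Phi).
Local Notation reg := (reg emb w).
Local Notation pval := (pval emb w Phi).
Local Notation uniformizer := (uniformizer emb w).

Hypothesis Phi_neq0 : exists j, Phi j != 0.
Hypothesis Phi_inj : forall x x' v, C x -> C x' -> v != 0 -> pval x v -> pval x' v -> x = x'.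
Hypothesis Phi_imm : forall x, C x -> exists v A B,
  [/\ v != 0, pval x v, A \is 1.-homog, B \is 1.-homog &
  [/\ ev A v = 0, ev B v != 0 & uniformizer x (mmap emb Phi A / mmap emb Phi B)]].

Definition image_curve : set (proj k m) :=
  [set y | exists x v, [/\ C x, pval x v & val y = <[v]>%VS]].
Local Notation E := image_curve.

Lemma pval_exists x : C x -> exists2 v, v != 0 & pval x v.
Proof.
move=> Cx; have [j0 Pj0] := Phi_neq0; have [j [Pj dP]] := normalize gw hC hsm Cx Pj0.
have [v vE] := choice dP; exists (\row_i v i); last first.
  by apply: (pval_intro Pj) => i; rewrite mxE.
apply/eqP => /rowP/(_ j); rewrite !mxE => e; have := vE j; rewrite divff // e => e1.
by have /eqP := pg_fun (reg_graph gw Cx) e1 (pg11 (reg_graph gw Cx)); rewrite eq_sym oner_eq0.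
Qed.

Lemma image_rep y : E y -> exists2 x, C x & pval x (rep y).
Proof.
move=> [x [v [Cx pv yv]]]; exists x => //.
by have [a a0 ->] := rep_val yv; exact: (pvalZ gw).
Qed.

Lemma image_intro x v : C x -> v != 0 -> pval x v -> exists2 y, E y & val y = <[v]>%VS.
Proof. by move=> Cx v0 pv; have [y yv] := exists_point v0; exists y => //; exists x, v. Qed.

Lemma pval_zeros F d : F \is d.-homog -> mmap emb Phi F != 0 ->
  finite_set [set x | C x /\ exists v, [/\ v != 0, pval x v & ev F v = 0]].
Proof.
move=> hF F0; have [j Pj] := Phi_neq0.
pose q := mmap emb Phi F / Phi j ^+ d.
have q0 : q != 0 by rewrite mulf_neq0 ?invr_eq0 ?expf_neq0.
have fin1 := reg_nz_finite gw hC q0.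
have fin2 : finite_set (\bigcup_(i in [set: 'I_m.+1]) [set x | C x /\ ~ dom (reg x) (Phi i / Phi j)]).
  by apply: bigcup_finite => [|i _]; [exact: finite_finset|exact: reg_finite gw hC _].
apply: (@sub_finite_set _ _ ([set x | C x /\ ~ exists2 c, c != 0 & reg x q c] `|`
  \bigcup_(i in [set: 'I_m.+1]) [set x | C x /\ ~ dom (reg x) (Phi i / Phi j)])); last first.
  by rewrite finite_setU.
move=> x [Cx [v [v0 pv Fv]]]; apply: contrapT => /not_orP[n1 n2].
have [c c0 qc] : exists2 c, c != 0 & reg x q c by apply: contrapT => nd; apply: n1.
have gx := reg_graph gw Cx.
have dP i : dom (reg x) (Phi i / Phi j) by apply: contrapT => nd; apply: n2; exists i.
have [u uE] := choice dP.
have pu : pval x (\row_i u i) by apply: (pval_intro Pj) => i; rewrite mxE.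
have u0 : \row_i u i != 0.
  apply/eqP => /rowP/(_ j); rewrite !mxE => e; have := uE j; rewrite divff // e => e1.
  by have /eqP := pg_fun gx e1 (pg11 gx); rewrite eq_sym oner_eq0.
have [a a0 e] := pval_uniq gw Cx v0 u0 pv pu.
move/eqP: c0; apply; apply: (pg_fun gx qc).
have <- : ev F (\row_i u i) = 0 by rewrite e (ev_scale _ _ hF) Fv mulr0.
have -> : q = mmap emb (fun i => (Phi j)^-1 * Phi i) F.
  by rewrite (mmap_scale emb Phi _ hF) exprVn mulrC.
apply: (pg_mmap _ gx) => i; rewrite mxE mulrC; exact: uE.
Qed.

Lemma image_eq0 F : hom F ->
  (mmap emb Phi F = 0 <-> forall y, E y -> ev F (rep y) = 0).
Proof.
move=> [d hF]; split=> [F0 y /image_rep[x Cx pv]|F0].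
  have [s s0] := pval_form gw Cx pv hF; rewrite F0 mulr0 => e.
  exact: (pg0 (reg_graph gw Cx)).
apply: contrapT => /eqP nF; apply: (curve_infinite hC).
apply: sub_finite_set (pval_zeros hF nF) => x Cx; split=> //.
have [v v0 pv] := pval_exists Cx; exists v; split=> //.
have [y Ey yv] := image_intro Cx v0 pv.
by apply/eqP; rewrite -(ev_val_eq0 (ex_intro _ d hF) yv); apply/eqP; exact: F0.
Qed.

Section At.
Variables (x : proj k n) (y : proj k m).
Hypotheses (Cx : C x) (pxy : pval x (rep y)).
Let gx := reg_graph gw Cx.

Let gy : place_graph emb (regD y).
Proof.
apply: reg_graph_at => F [d hF] F0; have [s s0] := pval_form gw Cx pxy hF.
by rewrite F0 mulr0; exact: (pg0 gx).
Qed.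

Lemma regD_reg q c : regD y q c -> reg x q c.
Proof.
move=> [d [F [G [hF hG Gy -> ->]]]]; have [s s0 sy] := pxy.
have rF H : H \is d.-homog -> reg x (s ^+ d * mmap emb Phi H) (ev H (rep y)).
  by move=> hH; rewrite -(mmap_scale emb Phi s hH); apply: (pg_mmap _ gx); exact: sy.
have -> : mmap emb Phi F / mmap emb Phi G =
    (s ^+ d * mmap emb Phi F) * (s ^+ d * mmap emb Phi G)^-1.
  by rewrite invfM mulrACA divff ?mul1r // expf_neq0.
by apply: (pgM gx); [exact: rF|apply: reg_local => //; exact: rF].
Qed.

(* Otherwise the place y of K extends to one where 1/q vanishes; its centre maps to y. *)
Lemma reg_integral q : dom (reg x) q -> integral (regD y) q.
Proof.
move=> [c qc]; have [->|q0] := eqVneq q 0.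
  exists 'X; split; [exact: monicX| |exact: hornerX].
  move=> i; rewrite coefX; case: (_ == _); [exists 1; exact: (pg11 gy)|exists 0; exact: (pg00 gy)].
apply: contrapT => nint.
have gH := pext_inv0 gy (@reg_local _ _ _ emb Phi y) q0 nint.
have [x' Cx' regx'] := center gw hC hsm gH.
have [j yj] := coord_neq0 y.
have Pj : Phi j != 0 := pval_neq0 gw Cx pxy yj.
have px' : pval x' ((rep y 0 j)^-1 *: rep y).
  apply: (pval_intro Pj) => i; apply: regx'; apply: (pext_sub _ _ gy).
  rewrite mxE [X in regD _ _ X]mulrC.
  have := reg_frac emb Phi (hom_coord k i) (hom_coord k j) (x := y).
  by rewrite !evXU !mmapX !mmap1U; apply.
have yj' : (rep y 0 j)^-1 != 0 by rewrite invr_eq0.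
have xx' : x = x'.
  apply: (Phi_inj Cx Cx' _ _ px'); last exact: (pvalZ gw).
  by rewrite scaler_eq0 negb_or yj' rep_neq0.
have : reg x' q^-1 0 by apply: regx'; exact: (pext_gen _ _ gy).
rewrite -xx' => qV; have := pgM gx qc qV; rewrite divff // mulr0 => e.
by have /eqP := pg_fun gx e (pg11 gx); rewrite eq_sym oner_eq0.
Qed.

(** The local ring at x lies in a finite module over the local ring at y, generated by integral
    elements. The immersion hypothesis puts a uniformizer at x in the maximal ideal at y, and both
    residue fields are k; by Nakayama's lemma the two rings are equal. *)
Lemma reg_regD q c : reg x q c -> regD y q c.
Proof.
suff : dom (reg x) q -> dom (regD y) q.
  move=> h qc; have [d qd] := h (ex_intro _ c qc).
  by rewrite (pg_fun gx qc (regD_reg qd)).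
pose A := dom (regD y).
have A0 : A 0 by exists 0; exact: (pg00 gy).
have A1 : A 1 by exists 1; exact: (pg11 gy).
have AN a : A a -> A (- a) by move=> [d ad]; exists (- d); exact: (pgN gy).
have AD a b : A a -> A b -> A (a + b).
  by move=> [d ad] [e be]; exists (d + e); exact: (pgD gy).
have AM a b : A a -> A b -> A (a * b).
  by move=> [d ad] [e be]; exists (d * e); exact: (pgM gy).
have Areg a : A a -> dom (reg x) a by move=> [d ad]; exists d; exact: regD_reg.
have [j xj] := coord_neq0 x; have wj := gen_coord_neq0 gw Cx xj.
pose xi i := emb (rep x 0 j) / w j * w i.
have rxi F : reg x (mmap emb xi F) (ev F (rep x)) := reg_xi gw Cx xj F.
have [|e [Ae se eM eB]] := @integral_span K A A0 A1 AN AD AM [seq xi i | i <- enum 'I_n.+1].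
  move=> _ /mapP[i _ ->]; have [|P [Pm PA P0]] := reg_integral (q := xi i); last by exists P.
  by exists (rep x 0 i); exact: (reg_coord _ _ i xj).
pose M := span_of A e.
have M0 : M 0 := span_of0 A0 e.
have MD a b : M a -> M b -> M (a + b) by exact: span_ofD.
have MA a : A a -> M a by exact: Ae.
have Mxi i : M (xi i) by apply: se; rewrite map_f // mem_enum.
have MF F : M (mmap emb xi F).
  elim/mpoly_ring_ind: F => [c'|i|F G MF MG|F G MF MG].
  - by rewrite mmapC; apply: MA; exists c'; exact: (pgC gy).
  - by rewrite mmapX mmap1U.
  - by rewrite rmorphD; exact: MD.
  - by rewrite rmorphM; exact: eM.
have ereg a : a \in e -> dom (reg x) a.
  apply: eB; [exact: (dom1 gw)|by move=> a' b; exact: (domM gw)|].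
  by move=> _ /mapP[i _ ->]; exists (rep x 0 i); exact: (reg_coord _ _ i xj).
(* The inverse is integral over the local ring at y; its monic equation, multiplied by a power of u,
   writes it as a polynomial in u. Hence denominators not vanishing at x stay inside the module. *)
have MV u : M u -> u != 0 -> dom (reg x) u^-1 -> M u^-1.
  move=> Mu u0 /reg_integral[P [Pm PA P0]].
  have MX i : M (u ^+ i).
    by elim: i => [|i IHi]; [rewrite expr0; exact: MA|rewrite exprS; exact: eM].
  have szP : size P = (size P).-1.+1 by rewrite prednK // lt0n size_poly_eq0 monic_neq0.
  set l := (size P).-1 in szP.
  case: l szP => [|l] szP.
    move: P0; have := Pm; rewrite monicE lead_coefE szP /= => /eqP c1.
    by rewrite horner_coef szP big_ord1 expr0 mulr1 c1 => /eqP; rewrite oner_eq0.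
  have Pl : P`_l.+1 = 1 by have := Pm; rewrite monicE lead_coefE szP /= => /eqP.
  have -> : u^-1 = \sum_(i < l.+1) - P`_i * u ^+ (l - i).
    have : u ^+ l * P.[u^-1] = 0 by rewrite P0 mulr0.
    rewrite horner_coef szP big_ord_recr /= Pl mul1r mulrDr.
    have -> : u ^+ l * u^-1 ^+ l.+1 = u^-1.
      by rewrite exprS mulrCA -exprMn divff // expr1n mulr1.
    move/eqP; rewrite addrC addr_eq0 => /eqP ->; rewrite mulr_sumr -sumrN.
    apply: eq_bigr => i _; rewrite mulNr; congr (- _); rewrite mulrCA; congr (_ * _).
    by rewrite exprVn expfB_cond // (negPf u0) add0n -ltnS.
  apply: (big_ind M M0 MD) => i _; apply: (span_ofM AM); [exact: (AN _ (PA i))|exact: MX].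
have MO a : dom (reg x) a -> M a.
  move=> [_ [d [F [G [hF hG Gx -> _]]]]].
  rewrite (reg_affine emb xj hF hG wj) -/xi; apply: eM; first exact: MF.
  apply: MV; [exact: MF|exact: (pg_neq0 gx (rxi G) Gx)|].
  by exists (ev G (rep x))^-1; apply: reg_local => //; exact: rxi.
have [v [F [G [v0 pv hF hG [Fv Gv ut]]]]] := Phi_imm Cx.
set t := _ / _ in ut; have t0 := unif_neq0 ut.
have [a a0 yv] := pval_uniq gw Cx v0 (rep_neq0 y) pv pxy.
have tD : regD y t 0.
  have Fy : ev F (rep y) = 0 by rewrite yv (ev_scale _ _ hF) Fv mulr0.
  rewrite -[X in regD _ _ X](mul0r (ev G (rep y))^-1) -[X in regD _ _ (X * _)]Fy.
  by apply: (reg_frac emb Phi hF hG); rewrite yv (ev_scale _ _ hG) mulf_neq0 ?expf_neq0.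
(* Each generator is its value at x plus [t] times an element of the module, which is the hypothesis
   of Nakayama's lemma relative to the submodule [A]. *)
have eA i : (i < size e)%N -> A (e`_i).
  apply: (nakayama gy (@reg_local _ _ _ emb Phi y)) => // l ltl.
  have [d ed] := ereg _ (mem_nth 0 ltl).
  have : reg x (e`_l - emb d) 0.
    by rewrite -[X in reg _ _ X](subrr d); apply: (pgB gx) => //; exact: (pgC gx).
  move=> /(unif_div ut)/MO[r [Ar rE]].
  exists (emb d), (fun i => t * r i); split.
  - by exists d; exact: (pgC gy).
  - move=> i'; have [c' rc] := Ar i'; rewrite -[X in regD _ _ X](mul0r c').
    exact: (pgM gy).
  - rewrite -[LHS](subrK (emb d)) addrC; congr (_ + _).
    rewrite -[LHS](divfK t0) rE mulr_suml; apply: eq_bigr => i' _; ring.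
move=> /MO[r [Ar ->]]; apply: (big_ind A A0 AD) => i _; exact: AM (eA _ _).
Qed.

End At.

Lemma image_generic : generic E emb Phi.
Proof.
split=> [|q]; first exact: image_eq0.
have [x Cx nx] := infinite_avoid hC (reg_finite gw hC q).
have [c qc] : dom (reg x) q by apply: contrapT => nd; apply: nx.
have [v v0 pv] := pval_exists Cx; have [y Ey yv] := image_intro Cx v0 pv.
have pxy : pval x (rep y) by have [a a0 ->] := rep_val yv; exact: (pvalZ gw).
have [d [F [G [hF hG Gy qE _]]]] := reg_regD Cx pxy qc.
exists d, F, G; split=> //; apply/eqP => G0.
by move/eqP: Gy; apply; exact: (proj1 (image_eq0 (ex_intro _ d hG)) G0).
Qed.

(** A point that no form separates from the image is a specialisation of the generic point [Phi], so
    its place has a centre on C, and this centre is mapped to it. *)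
Lemma image_closed : zclosed E.
Proof.
apply: zclosed_intro => y nEy; apply: contrapT => none; apply: nEy.
have gy : place_graph emb (regD y).
  apply: reg_graph_at => F hF F0; apply: contrapT => /eqP Fy; apply: none.
  by exists F; split=> //; exact: (proj1 (image_eq0 hF) F0).
have [x Cx regx] := center gw hC hsm gy.
have [j yj] := coord_neq0 y.
have Pj : Phi j != 0.
  apply/eqP => Pj; apply: none; exists 'X_j; rewrite evXU; split=> //.
    by exists 1%N; exact: hom_coord.
  have hX : hom ('X_j : {mpoly k[m.+1]}) by exists 1%N; exact: hom_coord.
  by apply: (proj1 (image_eq0 hX)); rewrite mmapX mmap1U.
exists x, ((rep y 0 j)^-1 *: rep y); split=> //.
  apply: (pval_intro Pj) => i; apply: regx.
  rewrite mxE [X in regD _ _ X]mulrC.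
  have := reg_frac emb Phi (hom_coord k i) (hom_coord k j) (x := y).
  by rewrite !evXU !mmapX !mmap1U; apply.
by rewrite val_rep vlineZ // invr_eq0.
Qed.

Lemma image_proper_finite Z y : zclosed Z -> E y -> ~ Z y -> finite_set (Z `&` E).
Proof.
move=> cZ Ey nZy; have [F [[d hF] FZ Fy]] := zclosed_sep cZ nZy.
have F0 : mmap emb Phi F != 0.
  by apply: contra Fy => /eqP F0; apply/eqP; exact: (proj1 (image_eq0 (ex_intro _ d hF)) F0).
have fin := pval_zeros hF F0.
pose R x (z : proj k m) := exists2 v, pval x v & val z = <[v]>%VS.
have [f fE] : exists f : proj k n -> proj k m, forall x, C x -> R x (f x).
  have h x : exists z : proj k m, C x -> R x z.
    have [Cx|?] := pselect (C x); last by exists y.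
    have [v v0 pv] := pval_exists Cx; have [y' Ey' yv] := image_intro Cx v0 pv.
    by exists y' => _; exists v.
  by have [f fE] := choice h; exists f.
apply: sub_finite_set (finite_image f fin) => z [Zz Ez].
have [x Cx pv] := image_rep Ez; exists x; first by split=> //; exists (rep z); rewrite rep_neq0 FZ.
have [v pv' xv] := fE x Cx.
have [a a0 e] := pval_uniq gw Cx (line_neq0 xv) (rep_neq0 z) pv' pv.
by apply: val_inj; rewrite xv val_rep e vlineZ.
Qed.

Lemma image_infinite : infinite_set E.
Proof.
move=> finE; apply: (curve_infinite hC).
have h (y : proj k m) : exists x, E y -> C x /\ pval x (rep y).
  have [Ey|?] := pselect (E y); last by have [p _] := infinite_setN0 (curve_infinite hC); exists p.
  by have [x Cx pv] := image_rep Ey; exists x.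
have [f fE] := choice h.
apply: sub_finite_set (finite_image f finE) => x Cx.
have [v v0 pv] := pval_exists Cx; have [y Ey yv] := image_intro Cx v0 pv.
exists y => //; have [Cfy pfy] := fE y Ey.
apply: (Phi_inj Cfy Cx (rep_neq0 y)) => //.
by have [a a0 ->] := rep_val yv; exact: (pvalZ gw).
Qed.

(** Closed sets that miss a point of the infinite set [E] meet it in a finite set. This yields
    irreducibility, and it reduces the middle term of a chain of length two to a point. *)
Lemma image_curve_curve : curve E.
Proof.
have [y0 Ey0] := infinite_setN0 image_infinite.
have irrE : irreducible E.
  split; first by exists y0.
  move=> A B cA cB EAB; apply: contrapT => /not_orP[nA nB].
  have [y1 Ey1 nAy1] : exists2 y, E y & ~ A y.
    by apply: contrapT => h; apply: nA => y Ey; apply: contrapT => nAy; apply: h; exists y.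
  have [y2 Ey2 nBy2] : exists2 y, E y & ~ B y.
    by apply: contrapT => h; apply: nB => y Ey; apply: contrapT => nAy; apply: h; exists y.
  apply: image_infinite; apply: (@sub_finite_set _ _ ((A `&` E) `|` (B `&` E))).
    by move=> y Ey; case: (EAB y Ey); [left|right].
  by rewrite finite_setU; split; [exact: (image_proper_finite cA Ey1 nAy1)|exact: (image_proper_finite cB Ey2 nBy2)].
split=> //; first exact: image_closed.
split.
  exists (fun i => if i is 0%N then [set y0] else E); split.
    case=> [|[|//]] _; split=> //; [exact: zclosed1|exact: irreducible1|by move=> y ->|].
    exact: image_closed.
  case=> // _; split; first by move=> y ->.
  by move=> Ey; apply: image_infinite; apply: sub_finite_set Ey _; exact: finite_set1.
move=> [Z [Z1 Z2]].
have [c0 irr0 Z0E] := Z1 0%N isT; have [c1 irr1 Z1E] := Z1 1%N isT; have [c2 irr2 Z2E] := Z1 2%N isT.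
have [Z01 nZ01] := Z2 0%N isT; have [Z12 nZ12] := Z2 1%N isT.
have [y Z2y nZ1y] : exists2 y, Z 2%N y & ~ Z 1%N y.
  by apply: contrapT => h; apply: nZ12 => y Zy; apply: contrapT => nZy; apply: h; exists y.
have finZ1 : finite_set (Z 1%N).
  apply: sub_finite_set (image_proper_finite c1 (Z2E _ Z2y) nZ1y) => z Zz; split=> //.
  exact: Z1E.
have [[p Z0p] _] := irr0.
have cp : zclosed (Z 1%N `\ p) by apply: finite_zclosed; exact: finite_setD.
have cov : Z 1%N `<=` [set p] `|` (Z 1%N `\ p).
  by move=> z Zz; have [->|zp] := pselect (z = p); [left|right].
have [h|h] := irr1.2 _ _ (zclosed1 p) cp cov.
  by apply: nZ01 => z /h ->.
by have [_] := h _ (Z01 _ Z0p); apply.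
Qed.

Lemma image_isomorphic : isomorphic C E.
Proof.
have [y0 _] := infinite_setN0 image_infinite.
have [x0 _] := infinite_setN0 (curve_infinite hC).
have [phi phiE] : exists f : proj k n -> proj k m, forall x, C x -> E (f x) /\ pval x (rep (f x)).
  have h x : exists y, C x -> E y /\ pval x (rep y).
    have [Cx|?] := pselect (C x); last by exists y0.
    have [v v0 pv] := pval_exists Cx; have [y' Ey' yv] := image_intro Cx v0 pv.
    by exists y' => _; split=> //; have [a a0 ->] := rep_val yv; exact: (pvalZ gw).
  by have [f fE] := choice h; exists f.
have [psi psiE] : exists f : proj k m -> proj k n, forall y, E y -> C (f y) /\ pval (f y) (rep y).
  have h y : exists x, E y -> C x /\ pval x (rep y).
    have [Ey|?] := pselect (E y); last by exists x0.
    by have [x Cx pv] := image_rep Ey; exists x.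
  by have [f fE] := choice h; exists f.
have [_ cE irrE] := image_curve_curve.
exists phi, psi; split.
- apply: (pval_regular gw) => x Cx; have [_ pv] := phiE x Cx.
  by exists (rep (phi x)); [exact: pv|exact: val_rep].
(* The inverse is given on the image by the original coordinates [w], regular there because the
   local rings agree. *)
- apply: (pval_regular image_generic) => y Ey; have [Cx pv] := psiE y Ey.
  exists (rep (psi y)); last exact: val_rep.
  have [j xj] := coord_neq0 (psi y); have wj := gen_coord_neq0 gw Cx xj.
  exists (emb (rep (psi y) 0 j) / w j); first by rewrite mulf_neq0 ?invr_eq0 // fmorph_eq0.
  by move=> i; apply: (reg_regD Cx pv); exact: reg_coord.
- move=> x Cx; have [Ey pv] := phiE x Cx; split=> //.
  have [Cx' pv'] := psiE _ Ey; exact: (Phi_inj Cx' Cx (rep_neq0 _) pv' pv).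
- move=> y Ey; have [Cx pv] := psiE y Ey; split=> //.
  have [_ pv'] := phiE _ Cx.
  have [a a0 e] := pval_uniq gw Cx (rep_neq0 _) (rep_neq0 _) pv pv'.
  exact: proj_eq e.
Qed.

End Embedding.

(** * Algebraic functions on pairs of points *)

Lemma infinite_numClosed (k : numClosedFieldType) : infinite_set [set: k].
Proof.
apply: (infinite_inj (f := fun m => m%:R)) => // m m' /eqP.
by rewrite eqr_nat => /eqP.
Qed.

Lemma finite_roots (k : closedFieldType) (p : {poly k}) : p != 0 -> finite_set [set c | p.[c] = 0].
Proof.
move=> p0; have [r rE] := closed_field_poly_normal p.
apply: (sub_finite_set _ (finite_seq r)) => c /= pc.
have : root p c by apply/rootP.
by rewrite rE rootZ ?lead_coef_eq0 // root_prod_XsubC.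
Qed.

Lemma avoid_finite (k : numClosedFieldType) (B : set k) : finite_set B -> exists s, ~ B s.
Proof.
move=> fB; have [s [_ nB]] := infinite_setN0 (infinite_setD (@infinite_numClosed k) fB).
by exists s.
Qed.

Lemma horner2_map (k : comNzRingType) (P : {poly {poly k}}) (p : {poly k}) c :
  P.[p].[c] = (map_poly (horner_eval c) P).[p.[c]].
Proof. by rewrite -[LHS]/(horner_eval c P.[p]) -horner_map. Qed.

Section FunctionRing.
Variables (k : comNzRingType) (T : pointedType) (gz : T -> k).

(** All functions on a nonempty set form a nonzero commutative ring with zero divisors. Integrality
    over the pulled back polynomials is available there and gives the closure under sums and
    products. *)
Definition pullback (p : {poly k}) : T -> k := fun z => p.[gz z].

Let pullback_zmod : zmod_morphism pullback.
Proof. by move=> p q; rewrite /pullback; apply/funext => z; rewrite hornerD hornerN. Qed.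
Let pullback_monoid : monoid_morphism pullback.
Proof. by split=> [|p q]; rewrite /pullback; apply/funext => z; rewrite ?hornerC ?hornerM. Qed.
HB.instance Definition _ := GRing.isZmodMorphism.Build _ _ pullback pullback_zmod.
HB.instance Definition _ := GRing.isMonoidMorphism.Build _ _ pullback pullback_monoid.

Definition evalat (z : T) (f : T -> k) : k := f z.
Let evalat_zmod z : zmod_morphism (evalat z). Proof. by []. Qed.
Let evalat_monoid z : monoid_morphism (evalat z). Proof. by []. Qed.
HB.instance Definition _ z := GRing.isZmodMorphism.Build _ _ (evalat z) (evalat_zmod z).
HB.instance Definition _ z := GRing.isMonoidMorphism.Build _ _ (evalat z) (evalat_monoid z).

Lemma pullback_root (Q : {poly {poly k}}) (psi : T -> k) z :
  (map_poly pullback Q).[psi] z = Q.[(psi z)%:P].[gz z].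
Proof.
rewrite horner2_map hornerC -[LHS]/(evalat z _) -horner_map -map_poly_comp.
by congr (_.[_]); apply: eq_map_poly => p.
Qed.

Lemma integral_pullback (psi : T -> k) : integralOver pullback psi <->
  exists2 Q, Q \is monic & forall z, Q.[(psi z)%:P].[gz z] = 0.
Proof.
split=> [[Q Qm /rootP Q0]|[Q Qm Q0]].
  by exists Q => // z; rewrite -pullback_root Q0.
exists Q => //; apply/rootP; apply/funext => z; rewrite pullback_root Q0 //.
Qed.

End FunctionRing.

Section AlgebraicFunctions.
Variables (k : numClosedFieldType) (T : Type) (gz : T -> k).
Implicit Types (E : set T) (psi : T -> k).

(* On E, psi is algebraic over k[gz], uniformly. *)
Definition algf E psi := exists2 P : {poly {poly k}}, P != 0 &
  forall z, E z -> P.[(psi z)%:P].[gz z] = 0.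

Definition integf E psi := exists2 P : {poly {poly k}}, P \is monic &
  forall z, E z -> P.[(psi z)%:P].[gz z] = 0.

(** Multiplying the equation by the power d^m of its leading coefficient makes it monic in d psi. *)
Lemma algf_integf E psi : algf E psi ->
  exists2 d : {poly k}, d != 0 & integf E (fun z => d.[gz z] * psi z).
Proof.
move=> [P P0 PE]; exists (lead_coef P); first by rewrite lead_coef_eq0.
have szP : size P = (size P).-1.+1 by rewrite prednK // lt0n size_poly_eq0.
set d := lead_coef P; case: (size P).-1 szP => [|m] szP.
  (* A constant equation says that d itself vanishes at the values of [gz] on E, so d psi is
     zero. *)
  exists 'X; first exact: monicX.
  move=> z /PE; rewrite (size1_polyC (eq_leq szP)) hornerC => e.
  by rewrite hornerX hornerC -[d]/(P`_(size P).-1) szP /= e mul0r.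
pose q := \poly_(i < m.+1) (P`_i * d ^+ (m - i)).
have szq : (size q <= m.+1)%N := size_poly _ _.
exists ('X^(m.+1) + q).
  rewrite monicE lead_coefDl ?lead_coefXn //.
  by rewrite size_polyXn ltnS.
move=> z /PE; rewrite !horner2_map !hornerC => e.
rewrite rmorphD hornerD /= map_polyXn hornerXn.
transitivity (d.[gz z] ^+ m * (map_poly (horner_eval (gz z)) P).[psi z]); last by rewrite e mulr0.
rewrite (@horner_coef_wide _ m.+1 (map_poly _ q)) ?(leq_trans (size_poly _ _)) //.
rewrite (@horner_coef_wide _ m.+2 (map_poly _ P)) ?(leq_trans (size_poly _ _)) ?szP //.
rewrite [in RHS]big_ord_recr /= mulrDr addrC; congr (_ + _).
  rewrite mulr_sumr; apply: eq_bigr => i _.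
  rewrite !coef_map /= coef_poly ltn_ord /horner_eval hornerM horner_exp exprMn.
  have -> : d.[gz z] ^+ m = d.[gz z] ^+ (m - i) * d.[gz z] ^+ i.
    by rewrite -exprD subnK // -ltnS.
  by ring.
rewrite coef_map /= -[P`_m.+1]/(P`_(m.+2).-1) -szP -/(lead_coef P) -/d /horner_eval exprMn exprS.
by ring.
Qed.

Lemma integf_algf E psi (d : {poly k}) : d != 0 -> integf E (fun z => d.[gz z] * psi z) ->
  algf E psi.
Proof.
move=> d0 [Q Qm QE]; exists (Q \Po (d *: 'X)).
  rewrite -size_poly_eq0 size_comp_poly2 ?size_poly_eq0 ?monic_neq0 //.
  by rewrite size_scale // size_polyX.
move=> z /QE; rewrite horner2_map hornerC => e.
by rewrite horner_comp hornerZ hornerX horner2_map hornerM hornerC.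
Qed.

Lemma integf_ring E psi1 psi2 : integf E psi1 -> integf E psi2 ->
  integf E (fun z => psi1 z + psi2 z) /\ integf E (fun z => psi1 z * psi2 z).
Proof.
move=> [P Pm PE] [Q Qm QE]; have [[z0 Ez0]|E0] := pselect (exists z, E z); last first.
  by split; exists 'X; rewrite ?monicX // => z Ez; case: E0; exists z.
pose TT : pointedType := HB.pack T (gen_eqMixin T) (gen_choiceMixin T) (isPointed.Build T z0).
(* A retraction onto E: equations valid only on E become equations between functions on the whole
   type. *)
pose r (z : TT) : T := if pselect (E z) is left _ then z else z0.
have Er z : E (r z) by rewrite /r; case: pselect.
have rE z : E z -> r z = z by rewrite /r; case: pselect => //.
have iP : integralOver (pullback (gz \o r : TT -> k)) (psi1 \o r).
  by apply/integral_pullback; exists P => // z; exact: PE.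
have iQ : integralOver (pullback (gz \o r : TT -> k)) (psi2 \o r).
  by apply/integral_pullback; exists Q => // z; exact: QE.
split.
  have := integral_add iP iQ.
  move=> /integral_pullback[S Sm SE].
  by exists S => [//|z Ez]; rewrite -[RHS](SE z) /= -[in LHS](rE z Ez).
have /integral_pullback[S Sm SE] := integral_mul iP iQ.
by exists S => [//|z Ez]; rewrite -[RHS](SE z) /= -[in LHS](rE z Ez).
Qed.

Lemma integf_poly E (d : {poly k}) : integf E (fun z => d.[gz z]).
Proof.
exists ('X - d%:P); first exact: monicXsubC.
by move=> z _; rewrite hornerD hornerN hornerX hornerC hornerD hornerN hornerC subrr.
Qed.

Lemma integf_ext E psi1 psi2 : (forall z, E z -> psi1 z = psi2 z) -> integf E psi1 -> integf E psi2.
Proof. by move=> e [P Pm PE]; exists P => // z Ez; rewrite -e // PE. Qed.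

Lemma algf_ext E psi1 psi2 : (forall z, E z -> psi1 z = psi2 z) -> algf E psi1 -> algf E psi2.
Proof. by move=> e [P Pm PE]; exists P => // z Ez; rewrite -e // PE. Qed.

Lemma algf_sub E E' psi : E' `<=` E -> algf E psi -> algf E' psi.
Proof. by move=> sE [P P0 PE]; exists P => // z /sE/PE. Qed.

Lemma algfD E psi1 psi2 : algf E psi1 -> algf E psi2 -> algf E (fun z => psi1 z + psi2 z).
Proof.
move=> /algf_integf[d1 d10 i1] /algf_integf[d2 d20 i2].
apply: (@integf_algf _ _ (d1 * d2)); first by rewrite mulf_neq0.
have [_ j1] := integf_ring (integf_poly E d2) i1.
have [_ j2] := integf_ring (integf_poly E d1) i2.
have [j _] := integf_ring j1 j2; apply: integf_ext j => z _ /=.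
by rewrite hornerM; ring.
Qed.

Lemma algfM E psi1 psi2 : algf E psi1 -> algf E psi2 -> algf E (fun z => psi1 z * psi2 z).
Proof.
move=> /algf_integf[d1 d10 i1] /algf_integf[d2 d20 i2].
apply: (@integf_algf _ _ (d1 * d2)); first by rewrite mulf_neq0.
have [_ j] := integf_ring i1 i2; apply: integf_ext j => z _ /=.
by rewrite hornerM; ring.
Qed.

Lemma algf_const E s : algf E (fun=> s).
Proof.
exists ('X - s%:P%:P); first by rewrite monic_neq0 ?monicXsubC.
by move=> z _; rewrite hornerD hornerN hornerX !hornerC hornerD hornerN !hornerC subrr.
Qed.

Lemma algfN E psi : algf E psi -> algf E (fun z => - psi z).
Proof.
move=> a; apply: algf_ext (algfM (algf_const E (-1)) a) => z _; by rewrite mulN1r.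
Qed.

Lemma algfV E psi : algf E psi -> (forall z, E z -> psi z != 0) -> algf E (fun z => (psi z)^-1).
Proof.
move=> [P P0 PE] nz.
have szP : size P = (size P).-1.+1 by rewrite prednK // lt0n size_poly_eq0.
set m := (size P).-1 in szP.
exists (\poly_(i < m.+1) P`_(m - i)).
  apply/eqP => /(congr1 (fun p : {poly {poly k}} => p`_0)); rewrite coef_poly subn0 coef0 => /eqP.
  by rewrite -/(lead_coef P) lead_coef_eq0 (negPf P0).
move=> z Ez; rewrite horner_poly horner_sum.
transitivity ((psi z)^-1 ^+ m * P.[(psi z)%:P].[gz z]); last by rewrite PE // mulr0.
rewrite [P.[_]]horner_coef horner_sum szP mulr_sumr (reindex_inj rev_ord_inj) /=.
apply: eq_bigr => i _; rewrite subSS subKn -1?ltnS // !hornerM !horner_exp !hornerC mulrCA.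
congr (_ * _); have -> : (psi z)^-1 ^+ m = (psi z)^-1 ^+ (m - i) * (psi z)^-1 ^+ i.
  by rewrite -exprD subnK // -ltnS.
by rewrite -mulrA -exprMn mulVf ?expr1n ?mulr1 // nz.
Qed.

(** The exceptional levels are the roots of P specialised at one base value [c] where its leading
    coefficient is nonzero. For any other level s, P at psi = s is a nonzero polynomial in the base
    variable, and its roots bound the values of [gz]. *)
Lemma algf_level E psi : algf E psi -> exists2 B, finite_set B &
  forall s, ~ B s -> finite_set [set c | exists2 z, E z & gz z = c /\ psi z = s].
Proof.
move=> [P P0 PE].
have [c nc] : exists c, (lead_coef P).[c] != 0.
  have [|c nc] := avoid_finite (finite_roots (p := lead_coef P) _).
    by rewrite lead_coef_eq0.
  by exists c; apply/eqP.
have Pc0 : map_poly (horner_eval c) P != 0.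
  apply/eqP => /(congr1 (fun p : {poly k} => p`_(size P).-1)); rewrite coef_map coef0 /= => /eqP.
  by rewrite -/(lead_coef P) -[horner_eval c _]/((lead_coef P).[c]) (negPf nc).
exists [set s | (map_poly (horner_eval c) P).[s] = 0]; first exact: finite_roots.
move=> s nB; have Ws : P.[s%:P] != 0.
  by apply/eqP => e; apply: nB; rewrite /= -[s in X in X = _](hornerC s c) -horner2_map e horner0.
apply: sub_finite_set (finite_roots Ws) => d [z Ez [<- <-]]; exact: PE.
Qed.

End AlgebraicFunctions.

(** * General linear forms *)

Section Values.
Variables (k : numClosedFieldType) (n : nat) (K : fieldType) (emb : {rmorphism k -> K}).
Variables (w : 'I_n.+1 -> K) (C : set (proj k n)).
Hypothesis gw : generic C emb w.
Local Notation evK := (mmap emb w).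
Local Notation reg := (reg emb w).
Local Notation uniformizer := (uniformizer emb w).

(* 0 if q is not regular at x. *)
Definition vl (x : proj k n) (q : K) : k := xget 0 [set c | reg x q c].

Section At.
Variable x : proj k n.
Hypothesis Cx : C x.
Let gx := reg_graph gw Cx.

Lemma vlE q c : reg x q c -> vl x q = c.
Proof. by move=> qc; rewrite /vl; apply: xget_unique => // d qd; exact: (pg_fun gx qd qc). Qed.

Lemma vl_reg q : dom (reg x) q -> reg x q (vl x q).
Proof. by move=> [c qc]; rewrite (vlE qc). Qed.

Lemma vlD p q : dom (reg x) p -> dom (reg x) q -> vl x (p + q) = vl x p + vl x q.
Proof. by move=> /vl_reg hp /vl_reg hq; apply: vlE; exact: (pgD gx). Qed.

Lemma vlM p q : dom (reg x) p -> dom (reg x) q -> vl x (p * q) = vl x p * vl x q.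
Proof. by move=> /vl_reg hp /vl_reg hq; apply: vlE; exact: (pgM gx). Qed.

Lemma vlC c : vl x (emb c) = c.
Proof. by apply: vlE; exact: (pgC gx). Qed.

Lemma vlX q m : dom (reg x) q -> vl x (q ^+ m) = vl x q ^+ m.
Proof. by move=> /vl_reg hq; apply: vlE; exact: (pgX _ gx). Qed.

Lemma domX q m : dom (reg x) q -> dom (reg x) (q ^+ m).
Proof. by move=> [c qc]; exists (c ^+ m); exact: (pgX _ gx). Qed.

Lemma vl_ratio d F G : F \is d.-homog -> G \is d.-homog -> ev G (rep x) != 0 ->
  dom (reg x) (evK F / evK G) /\ vl x (evK F / evK G) = ev F (rep x) / ev G (rep x).
Proof.
move=> hF hG G0; have r := reg_frac emb w hF hG G0.
by split; [exists (ev F (rep x) / ev G (rep x))|exact: vlE].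
Qed.

Variable t : K.
Hypothesis ut : uniformizer x t.

(** The coefficient of [t] in the expansion of q at x: a k-valued derivation of the local ring,
    nonzero exactly on functions that are local parameters up to a constant. *)
Definition jet q := vl x ((q - emb (vl x q)) / t).

Lemma jet_dom q : dom (reg x) q -> dom (reg x) ((q - emb (vl x q)) / t).
Proof.
move=> /vl_reg hq; apply: (unif_div ut); rewrite -[X in reg _ _ X](subrr (vl x q)).
by apply: (pgB gx) => //; exact: (pgC gx).
Qed.

Lemma jetD p q : dom (reg x) p -> dom (reg x) q -> jet (p + q) = jet p + jet q.
Proof.
move=> hp hq; rewrite /jet (vlD hp hq) -(vlD (jet_dom hp) (jet_dom hq)).
by congr (vl x _); rewrite rmorphD /=; ring.
Qed.

Lemma jetM p q : dom (reg x) p -> dom (reg x) q -> jet (p * q) = jet p * vl x q + vl x p * jet q.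
Proof.
move=> hp hq; have jp := jet_dom hp; have jq := jet_dom hq.
have dc c : dom (reg x) (emb c) by exact: (domC gw).
have e : (p * q - emb (vl x p * vl x q)) / t =
    (p - emb (vl x p)) / t * q + emb (vl x p) * ((q - emb (vl x q)) / t).
  by rewrite rmorphM /=; ring.
rewrite /jet (vlM hp hq) e (vlD (domM gw Cx jp hq) (domM gw Cx (dc _) jq)).
by rewrite (vlM jp hq) (vlM (dc _) jq) vlC.
Qed.

Lemma jetC c : jet (emb c) = 0.
Proof. by rewrite /jet vlC subrr mul0r -(rmorph0 emb) vlC. Qed.

Lemma jetCM c q : dom (reg x) q -> jet (emb c * q) = c * jet q.
Proof. by move=> hq; rewrite jetM ?jetC ?mul0r ?add0r ?vlC //; exact: (domC gw). Qed.

Lemma jet_unif q : dom (reg x) q -> (jet q != 0 <-> uniformizer x (q - emb (vl x q))).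
Proof.
move=> hq; have jq := jet_dom hq; split=> [q0|uq].
  rewrite -[q - _](mulfVK (unif_neq0 ut)) mulrC.
  by apply: (unif_mul gw Cx ut _ q0); exact: vl_reg.
have [u [c [c0 uc e]]] := unif_ratio gw Cx ut uq.
by rewrite /jet e mulrAC divff ?(unif_neq0 ut) // mul1r (vlE uc).
Qed.

End At.

End Values.

Section GenericForms.
Variables (k : numClosedFieldType) (n : nat).
Local Notation form := {mpoly k[n.+1]}.
Implicit Types (P Q : form -> Prop) (u v : form).

(* Formalises "a general linear form satisfies P". *)
Definition generically P := (exists2 u, u \is 1.-homog & P u) /\
  forall u v, u \is 1.-homog -> v \is 1.-homog -> P u ->
    finite_set [set s | ~ P (u + s *: v)] /\ finite_set [set s | ~ P (v + s *: u)].

(** Conditions are added one at a time on the line joining a form good for the earlier conditions to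
    a form good for the next one; each condition excludes only finitely many parameters of the
    line. *)
Lemma generically_forall (T : choiceType) (A : set T) (P : T -> form -> Prop) :
  finite_set A -> (forall z, A z -> generically (P z)) ->
  generically (fun u => forall z, A z -> P z u).
Proof.
move=> fA gP; split; last first.
  move=> u v hu hv Pu; split.
    apply: (@sub_finite_set _ _ (\bigcup_(z in A) [set s | ~ P z (u + s *: v)])).
      by move=> s /existsNP[z /not_implyP[Az nP]]; exists z.
    by apply: bigcup_finite => // z Az; have [_ /(_ u v hu hv (Pu z Az))[]] := gP z Az.
  apply: (@sub_finite_set _ _ (\bigcup_(z in A) [set s | ~ P z (v + s *: u)])).
    by move=> s /existsNP[z /not_implyP[Az nP]]; exists z.
  by apply: bigcup_finite => // z Az; have [_ /(_ u v hu hv (Pu z Az))[]] := gP z Az.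
have [s sA] := (finite_seqP A).1 fA.
have {gP} : forall z, z \in s -> generically (P z) by move=> z zs; apply: gP; rewrite sA.
suff H : (forall z, z \in s -> generically (P z)) ->
    exists2 u, u \is 1.-homog & forall z, z \in s -> P z u.
  by move=> /H[u hu Pu]; exists u => // z; rewrite sA; exact: Pu.
elim: s {sA} => [_|z s IH gP]; first by exists 0; rewrite ?dhomog0.
have [|u hu Pu] := IH; first by move=> y ys; apply: gP; rewrite inE ys orbT.
have [[v hv Pv] gv] := gP z (mem_head _ _).
have [_ fv] := gv v u hv hu Pv.
have fu : finite_set (\bigcup_(y in [set` s]) [set c | ~ P y (u + c *: v)]).
  apply: bigcup_finite; first exact: finite_seq.
  move=> y /= ys; have gy : generically (P y) by apply: gP; rewrite inE ys orbT.
  by have [_ /(_ u v hu hv (Pu y ys))[]] := gy.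
have [c /not_orP[n1 n2]] : exists c, ~ ([set c | ~ P z (u + c *: v)] `|`
    \bigcup_(y in [set` s]) [set c | ~ P y (u + c *: v)]) c.
  by apply: avoid_finite; rewrite finite_setU.
exists (u + c *: v); first by apply: rpredD => //; apply: rpredZ.
move=> y; rewrite inE => /orP[/eqP ->|ys]; first exact: contrapT n1.
by apply: contrapT => nP; apply: n2; exists y.
Qed.

Lemma genericallyI P Q : generically P -> generically Q -> generically (fun u => P u /\ Q u).
Proof.
move=> gP gQ.
have [||[u hu PQ] gPQ] := @generically_forall bool setT (fun b => if b then P else Q).
- exact: finite_finset.
- by case.
split.
  by exists u => //; exact: (conj (PQ true I) (PQ false I)).
move=> a b ha hb [Pa Qa]; have [|f1 f2] := gPQ a b ha hb; first by case.
split; [apply: sub_finite_set f1|apply: sub_finite_set f2] => s nPQ all; apply: nPQ.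
  exact: (conj (all true I) (all false I)).
exact: (conj (all true I) (all false I)).
Qed.

Lemma generically_linear (l : form -> k) :
  (forall u v s, u \is 1.-homog -> v \is 1.-homog -> l (u + s *: v) = l u + s * l v) ->
  (exists2 u, u \is 1.-homog & l u != 0) -> generically (fun u => l u != 0).
Proof.
move=> ll ex; split=> // u v hu hv lu; split.
  have [v0|v0] := eqVneq (l v) 0.
    apply: (@sub_finite_set _ _ set0) => // s /=.
    by rewrite ll // v0 mulr0 addr0 lu.
  apply: (sub_finite_set _ (finite_set1 (- l u / l v))) => s /=.
  rewrite ll // => /negP/negPn; rewrite addrC addr_eq0 => /eqP <-.
  by rewrite mulfK.
apply: (sub_finite_set _ (finite_set1 (- l v / l u))) => s /=.
rewrite ll // => /negP/negPn; rewrite addrC addr_eq0 => /eqP <-.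
by rewrite mulfK.
Qed.

Lemma lin_homog u v s : u \is 1.-homog -> v \is 1.-homog -> u + s *: v \is 1.-homog.
Proof. by move=> hu hv; apply: rpredD => //; apply: rpredZ. Qed.

End GenericForms.

(** * A general pencil of linear forms *)

Section Pencil.
Variables (k : numClosedFieldType) (n : nat) (K : fieldType) (emb : {rmorphism k -> K}).
Variables (w : 'I_n.+1 -> K) (C : set (proj k n)).
Hypotheses (gw : generic C emb w) (hC : curve C) (hsm : smooth C).
Local Notation evK := (mmap emb w).
Local Notation reg := (reg emb w).
Local Notation uniformizer := (uniformizer emb w).
Local Notation vl := (vl emb w).
Local Notation jet := (jet emb w).
Local Notation form := {mpoly k[n.+1]}.

Lemma evZ s (u : form) (v : 'rV[k]_n.+1) : ev (s *: u) v = s * ev u v.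
Proof. exact: mevalZ. Qed.

Lemma evKZ s (u : form) : evK (s *: u) = emb s * evK u.
Proof. exact: mmapZ. Qed.

Lemma generically_ev (x : proj k n) : generically (fun u : form => ev u (rep x) != 0).
Proof.
apply: generically_linear => [u v s _ _|]; first by rewrite evD evZ.
have [i xi] := coord_neq0 x; exists 'X_i; first exact: hom_coord.
by rewrite evXU.
Qed.

Lemma generically_sep (x y : proj k n) (c d : k) : x <> y -> d != 0 ->
  generically (fun u : form => ev u (rep x) * c - ev u (rep y) * d != 0).
Proof.
move=> xy d0; apply: generically_linear => [u v s _ _|]; first by rewrite !evD !evZ; ring.
have [u [hu ux uy]] := two_point_form xy; exists u => //.
by rewrite ux mul0r sub0r oppr_eq0 mulf_neq0.
Qed.

(** Some uniformizer is a quotient A/B of linear forms with B nonzero at x. If the jet of (B/b) q is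
    zero, then the jet of (A/b) q, its product with A/B, is the jet of A/B times a nonzero value. *)
Lemma generically_jet x t (b : form) q : C x -> uniformizer x t -> b \is 1.-homog ->
  ev b (rep x) != 0 -> dom (reg x) q -> vl x q != 0 ->
  generically (fun u : form => jet x t (evK u / evK b * q) != 0).
Proof.
move=> Cx ut hb bx dq q0.
have du (u : form) : u \is 1.-homog -> dom (reg x) (evK u / evK b * q).
  by move=> hu; apply: (domM gw) => //; have [] := vl_ratio gw Cx hu hb bx.
apply: generically_linear => [u v s hu hv|].
  have -> : evK (u + s *: v) / evK b * q = evK u / evK b * q + emb s * (evK v / evK b * q).
    by rewrite rmorphD /= evKZ; ring.
  have dv := du v hv.
  rewrite (jetD gw Cx ut) ?(jetCM gw Cx ut) //; first exact: du.
  by apply: (domM gw) => //; exact: (domC gw).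
have [t' [ut' [A [B [hA hB Bx tE]]] _]] := exists_uniformizer gw hC Cx (hsm Cx).
have [B0|B0] := eqVneq (jet x t (evK B / evK b * q)) 0; last by exists B.
exists A => //.
have dt' : dom (reg x) t' by exists 0; exact: unif0.
have vt' : vl x t' = 0 by apply: (vlE gw Cx); exact: unif0.
have Bn : evK B != 0 by apply: (gen_neq0 gw _ Cx Bx); exists 1%N.
have -> : evK A / evK b * q = t' * (evK B / evK b * q).
  by rewrite tE; field; rewrite Bn (gen_neq0 gw _ Cx bx) //; exists 1%N.
have [db vb] := vl_ratio gw Cx hB hb bx.
rewrite (jetM gw Cx ut dt' (du B hB)) B0 mulr0 addr0 (vlM gw Cx db dq) vb.
rewrite !mulf_neq0 ?invr_eq0 //; apply/(jet_unif gw Cx ut dt').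
by rewrite vt' rmorph0 subr0.
Qed.

Lemma der_normalize g : (forall c, g != emb c) -> exists D, derivation emb D /\ D g = 1.
Proof.
move=> gc; have [p Cp] := infinite_setN0 (curve_infinite hC).
have [j pj] := coord_neq0 p; have wj := gen_coord_neq0 gw Cp pj.
have [D [hD D0]] := exists_derivation gw hC hsm wj.
have Dg := der_neq0 gw hC hsm hD D0 gc.
exists (fun q => (D g)^-1 * D q); split; last by rewrite mulVf.
split=> [p1 q|p1 q|c]; first by rewrite (derD hD) mulrDr.
  by rewrite (derM hD); ring.
by rewrite (derC hD) mulr0.
Qed.

Lemma unif_nonconstant x q c : C x -> uniformizer x (q - emb c) -> forall d, q != emb d.
Proof.
move=> Cx uq d; apply/eqP => e; have gx := reg_graph gw Cx.
have := unif_neq0 uq; have := unif0 uq; rewrite e -rmorphB => r0.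
have -> : d - c = 0 by exact: (pg_fun gx (pgC gx _) r0).
by rewrite rmorph0 eqxx.
Qed.

(** The quotient g0 = b0/a is made to separate the zeros of h and to be unramified there, and b is
    b0 - s a. So a/b is 1/(g0 - s), which keeps these properties and has its poles where g0 takes
    the value s. *)
Lemma exists_pencil : exists h a b : form, [/\ h \is 1.-homog, a \is 1.-homog & b \is 1.-homog] /\
  [/\ exists2 p, C p & ev h (rep p) = 0,
      finite_set [set x | C x /\ ev h (rep x) = 0],
      forall x, C x -> ev h (rep x) = 0 -> ev b (rep x) != 0 &
  [/\ forall x y, C x -> C y -> ev h (rep x) = 0 -> ev h (rep y) = 0 -> x <> y ->
        ev a (rep x) / ev b (rep x) != ev a (rep y) / ev b (rep y),
      forall x, C x -> ev h (rep x) = 0 ->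
        uniformizer x (evK a / evK b - emb (ev a (rep x) / ev b (rep x))),
      forall x, C x -> ev b (rep x) = 0 -> ev a (rep x) != 0 &
      forall x, C x -> ev b (rep x) = 0 -> uniformizer x (evK b / evK a)]].
Proof.
have [p Cp] := infinite_setN0 (curve_infinite hC).
have [p' Cp' pp'] := infinite_avoid hC (finite_set1 p).
have [h [hh hp hp']] := two_point_form (fun e : p = p' => pp' (esym e)).
have finH : finite_set [set x | C x /\ ev h (rep x) = 0].
  by apply: (curve_zeros_finite hC); [exists 1%N|exists p'].
have [[a ha a0] _] := generically_forall finH (fun x _ => generically_ev x).
have finA : finite_set [set x | C x /\ ev a (rep x) = 0].
  by apply: (curve_zeros_finite hC); [exists 1%N|exists p => //; exact: a0].
have an : evK a != 0 by apply: (gen_neq0 gw _ Cp); [exists 1%N|exact: a0].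
have exT x : exists t, C x -> uniformizer x t.
  have [Cx|nC] := pselect (C x); last by exists 0.
  by have [t ut] := unif_exists gw hC hsm Cx; exists t.
have [T TE] := choice exT.
have [[b0 hb0 [B1 [B2 B3]]] _] :
    generically (fun u : form => (forall x, C x /\ ev a (rep x) = 0 -> ev u (rep x) != 0) /\
    (forall z : (proj k n * proj k n)%type, ([set x | C x /\ ev h (rep x) = 0] `*` [set x | C x /\ ev h (rep x) = 0]) z ->
       z.1 <> z.2 -> ev u (rep z.1) * ev a (rep z.2) - ev u (rep z.2) * ev a (rep z.1) != 0) /\
    (forall x, C x /\ ev h (rep x) = 0 -> jet x (T x) (evK u / evK a * 1) != 0)).
  apply: genericallyI; last apply: genericallyI.
  - by apply: generically_forall => // x _; exact: generically_ev.
  - apply: generically_forall; first exact: finite_setX.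
    move=> [x y] /= [[Cx hx] [Cy hy]]; have [->|xy] := pselect (x = y).
      split; last by move=> u v _ _ _; split; apply: (@sub_finite_set _ _ set0) => // s /=; case.
      by exists 0; rewrite ?dhomog0.
    have [[u hu gu] gg] := generically_sep (ev a (rep y)) xy (a0 x (conj Cx hx)).
    split; first by exists u.
    move=> u1 v hu1 hv Pu1; have [f1 f2] := gg u1 v hu1 hv (Pu1 xy).
    by split; [apply: sub_finite_set f1|apply: sub_finite_set f2] => s /= nP e; apply: nP.
  - apply: generically_forall => // x [Cx hx].
    apply: generically_jet => //; [exact: TE|exact: a0|exact: (dom1 gw)|].
    by rewrite -(rmorph1 emb) (vlC gw) // oner_neq0.
pose g0 := evK b0 / evK a.
have g0E x : C x -> ev a (rep x) != 0 -> dom (reg x) g0 /\ vl x g0 = ev b0 (rep x) / ev a (rep x).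
  by move=> Cx ax; exact: (vl_ratio gw Cx hb0 ha ax).
have g0u x : C x -> ev h (rep x) = 0 -> uniformizer x (g0 - emb (ev b0 (rep x) / ev a (rep x))).
  move=> Cx hx; have [dg <-] := g0E x Cx (a0 x (conj Cx hx)).
  by apply/(jet_unif gw Cx (TE x Cx) dg); rewrite -[g0]mulr1; exact: B3.
have g0c := unif_nonconstant Cp (g0u p Cp hp).
have [D [hD Dg0]] := der_normalize g0c.
have finR := unram_finite gw hC hsm hD Dg0.
have finRH := conj finR finH; rewrite -finite_setU in finRH.
(* Avoiding the values of g0 at its ramification points makes b/a a local parameter at every zero of
   b; avoiding those at the zeros of h keeps b nonzero there. *)
have [s ns] := avoid_finite (finite_image (fun x => ev b0 (rep x) / ev a (rep x))
  finRH).
exists h, a, (b0 - s *: a); split.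
  by split=> //; rewrite -scaleNr; exact: lin_homog.
have bE x : ev (b0 - s *: a) (rep x) = ev b0 (rep x) - s * ev a (rep x).
  by rewrite -scaleNr evD evZ mulNr.
have bH x : C x -> ev h (rep x) = 0 -> ev (b0 - s *: a) (rep x) != 0.
  move=> Cx hx; rewrite bE subr_eq0; apply/eqP => e; apply: ns; exists x; first by right.
  by rewrite e mulfK //; exact: a0.
have ab x : C x -> ev (b0 - s *: a) (rep x) = 0 -> ev a (rep x) != 0.
  move=> Cx; rewrite bE => bx; apply/eqP => ax.
  by move: bx; rewrite ax mulr0 subr0; apply/eqP; exact: B1.
have bn : evK (b0 - s *: a) != 0.
  apply: (gen_neq0 gw _ Cp); [exists 1%N|exact: bH].
  by rewrite -scaleNr; exact: lin_homog.
have bKE : evK (b0 - s *: a) = evK a * (g0 - emb s).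
  by rewrite -scaleNr rmorphD /= evKZ rmorphN /g0; field.
split; [by exists p|exact: finH|exact: bH|split].
- move=> x y Cx Cy hx hy xy; rewrite eqr_div ?bH //.
  have := B2 (x, y) (conj (conj Cx hx) (conj Cy hy)) xy; rewrite /= !bE; apply: contra => /eqP e.
  apply/eqP; transitivity (ev a (rep y) * (ev b0 (rep x) - s * ev a (rep x)) -
    ev a (rep x) * (ev b0 (rep y) - s * ev a (rep y))); first by ring.
  by rewrite e; ring.
- move=> x Cx hx; have gx := reg_graph gw Cx; have ax := a0 x (conj Cx hx).
  have [dg gv] := g0E x Cx ax; have bx := bH x Cx hx; rewrite bE in bx.
  set c := ev b0 (rep x) / ev a (rep x).
  have cs : c - s != 0.
    have -> : c - s = (ev b0 (rep x) - s * ev a (rep x)) / ev a (rep x) by rewrite mulrBl mulfK.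
    by rewrite mulf_neq0 ?invr_eq0.
  have r0 : reg x (g0 - emb s) (c - s).
    by apply: (pgB gx); [rewrite /c -gv; exact: (vl_reg gw)|exact: (pgC gx)].
  have n0 := pg_neq0 gx r0 cs.
  have -> : evK a / evK (b0 - s *: a) - emb (ev a (rep x) / ev (b0 - s *: a) (rep x)) =
      (g0 - emb c) * (- (emb (c - s))^-1 * (g0 - emb s)^-1).
    have -> : ev a (rep x) / ev (b0 - s *: a) (rep x) = (c - s)^-1.
      rewrite bE /c; move: (ev a _) (ev b0 _) ax bx => p1 p2 ax bx.
      by field; rewrite ax; move: bx; rewrite mulNr.
    have cs' : emb (c - s) != 0 by rewrite fmorph_eq0.
    rewrite bKE fmorphV; move: cs'; rewrite rmorphB => cs'.
    by field; rewrite n0 an cs'.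
  apply: (unif_mul gw Cx (g0u x Cx hx) (c := - (c - s)^-1 * (c - s)^-1)); last first.
    by rewrite mulf_neq0 ?oppr_eq0 ?invr_eq0.
  apply: (pgM gx); last exact: reg_local.
  by apply: (pgN gx); rewrite -fmorphV; exact: (pgC gx).
- exact: ab.
- move=> x Cx bx; have gx := reg_graph gw Cx; have ax := ab x Cx bx.
  have [dg gv] := g0E x Cx ax.
  have vs : vl x g0 = s.
    by rewrite gv; apply: (canLR (mulfK ax)); apply/eqP; rewrite -subr_eq0 -bE bx.
  have -> : evK (b0 - s *: a) / evK a = g0 - emb s by rewrite bKE mulrAC divff // mul1r.
  apply: contrapT => nu; apply: ns; exists x; last by rewrite -gv.
  left; split=> // - [c uc]; apply: nu; rewrite -vs.
  have -> : vl x g0 = c; last by [].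
  apply: (vlE gw Cx); rewrite -[g0](subrK (emb c)) -[X in reg _ _ X]add0r.
  by apply: (pgD gx); [exact: unif0|exact: (pgC gx)].
Qed.

End Pencil.

Lemma finite_affine_zeros (k : fieldType) (T : Type) (A : set T) (c p q : T -> k) :
  finite_set A -> (forall z, A z -> p z != 0) ->
  finite_set [set s | exists2 z, A z & (s + c z) * p z + q z = 0].
Proof.
move=> fA p0; apply: (sub_finite_set _ (finite_image (fun z => - q z / p z - c z) fA)).
move=> s /= [z Az e]; exists z => //.
by apply/eqP; rewrite subr_eq eq_sym -(can2_eq (mulfK (p0 z Az)) (mulfVK (p0 z Az))) -addr_eq0 e.
Qed.

(** * Choice of the parameters *)

Section Selection.
Variables (k : numClosedFieldType) (n : nat) (K : fieldType) (emb : {rmorphism k -> K}).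
Variables (w : 'I_n.+1 -> K) (C : set (proj k n)).
Hypotheses (gw : generic C emb w) (hC : curve C) (hsm : smooth C).
Local Notation evK := (mmap emb w).
Local Notation reg := (reg emb w).
Local Notation uniformizer := (uniformizer emb w).
Local Notation vl := (vl emb w).
Local Notation jet := (jet emb w).
Local Notation form := {mpoly k[n.+1]}.
Variables (h a b : form).
Hypotheses (hh : h \is 1.-homog) (ha : a \is 1.-homog) (hb : b \is 1.-homog).
Hypotheses (h_fin : finite_set [set x | C x /\ ev h (rep x) = 0])
  (hb0 : forall x, C x -> ev h (rep x) = 0 -> ev b (rep x) != 0)
  (ab0 : forall x, C x -> ev b (rep x) = 0 -> ev a (rep x) != 0)
  (bn : evK b != 0).
Let g := evK a / evK b.
Let gv x := ev a (rep x) / ev b (rep x).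
Variable D : K -> K.
Hypotheses (hD : derivation emb D) (Dg : D g = 1).
Variables (cs : seq k) (r : nat).
Hypothesis csP : forall x, C x -> ev b (rep x) != 0 -> ~ uniformizer x (g - emb (gv x)) ->
  gv x \in cs.

Let aff x := [/\ C x, ev h (rep x) != 0 & ev b (rep x) != 0].
Let U x := aff x /\ gv x \notin cs.
(** For positive [r] this is u b^(r-1) / h^r, with poles only at zeros of h. Its value at x is that
    of u times a factor independent of u, so the forms still separate points and tangent
    directions. *)
Definition psi (u : form) : K := evK u / evK b * (evK b / evK h) ^+ r.

Let gconst c : g != emb c.
Proof.
by apply/eqP => gc; move: Dg; rewrite gc (derC hD) => /eqP; rewrite eq_sym oner_eq0.
Qed.

Let D_neq0 : exists q, D q != 0.
Proof. by exists g; rewrite Dg oner_neq0. Qed.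

Lemma reg_pencil x : C x -> ev b (rep x) != 0 -> reg x g (gv x).
Proof. by move=> Cx bx; exact: (reg_frac emb w ha hb bx). Qed.

Lemma U_unif x : U x -> uniformizer x (g - emb (gv x)).
Proof.
move=> [[Cx hx bx] nc]; apply: contrapT => nu; move/negP: nc; apply; exact: csP.
Qed.

Lemma U_der x q : U x -> dom (reg x) q -> dom (reg x) (D q).
Proof. by move=> Ux; have [[Cx _ _] _] := Ux; exact: (unram_dom gw hC hsm hD D_neq0 Dg Cx (U_unif Ux)). Qed.

Let kap x := (ev b (rep x) / ev h (rep x)) ^+ r.

Lemma kapP x : aff x -> [/\ dom (reg x) ((evK b / evK h) ^+ r),
  vl x ((evK b / evK h) ^+ r) = kap x & kap x != 0].
Proof.
move=> [Cx hx bx]; have [d v] := vl_ratio gw Cx hb hh hx; split; first exact: (domX gw).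
  by rewrite (vlX gw) // v.
by rewrite expf_neq0 // mulf_neq0 ?invr_eq0.
Qed.

Lemma psi_vl x u : aff x -> u \is 1.-homog ->
  dom (reg x) (psi u) /\ vl x (psi u) = ev u (rep x) / ev b (rep x) * kap x.
Proof.
move=> ax hu; have [Cx hx bx] := ax; have [d v] := vl_ratio gw Cx hu hb bx.
have [d' v' _] := kapP ax; split; first exact: (domM gw).
by rewrite (vlM gw) // v v'.
Qed.

Lemma psi_lin u v s : psi (u + s *: v) = psi u + emb s * psi v.
Proof. by rewrite /psi rmorphD /= evKZ; ring. Qed.

Lemma fibre_finite c : finite_set [set x | C x /\ reg x g c].
Proof.
have gc : g - emb c != 0 by rewrite subr_eq0.
apply: sub_finite_set (reg_nz_finite gw hC gc) => x [Cx gx]; split=> // [[d d0 gd]].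
move/eqP: d0; apply; have gr := reg_graph gw Cx.
by apply: (pg_fun gr gd); rewrite -[X in reg _ _ X](subrr c); apply: (pgB gr) => //; exact: (pgC gr).
Qed.

Local Notation pt := (proj k n).
Let Z := [set z : pt * pt | [/\ U z.1, U z.2, z.1 <> z.2 & gv z.1 = gv z.2]].
Let gz (z : pt * pt) := gv z.1.
Let V q (z : pt * pt) := vl z.1 q - vl z.2 q.

Lemma pairs_fibres_finite (S : set k) : finite_set S -> finite_set [set z : pt * pt |
  [/\ aff z.1, aff z.2, gv z.1 = gv z.2 & S (gv z.1)]].
Proof.
move=> fS; pose F c := [set x | C x /\ reg x g c].
apply: (@sub_finite_set _ _ (\bigcup_(c in S) (F c `*` F c))).
  move=> [x y] /= [[Cx _ bx] [Cy _ yb] e Sx]; exists (gv x) => //.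
  by split; split=> //=; [exact: reg_pencil|rewrite e; exact: reg_pencil].
by apply: bigcup_finite => // c _; apply: finite_setX; exact: fibre_finite.
Qed.

(** A relation between g and q on C holds at both members of a pair, with the common value of g as
    base variable; the difference of two algebraic functions is algebraic. *)
Lemma algf_V q : (forall x, U x -> dom (reg x) q) -> algf gz Z (V q).
Proof.
move=> dq; have [P P0 Pq] := algebraic_over gw hC hsm q gconst.
have Px x : U x -> P.[(vl x q)%:P].[gv x] = 0.
  move=> Ux; have [[Cx hx bx] _] := Ux.
  have := reg_ev2K gw P Cx (reg_pencil Cx bx) (vl_reg gw Cx (dq x Ux)).
  by rewrite Pq => /(pg0 (reg_graph gw Cx)).
apply: algfD; first by exists P => // z [U1 _ _ _]; exact: Px.
by apply: algfN; exists P => // z [_ U2 _ e]; rewrite /gz e; exact: Px.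
Qed.

Lemma level_finite E f : E `<=` Z -> algf gz E f -> exists2 B, finite_set B &
  forall s, ~ B s -> finite_set [set z | E z /\ f z = s].
Proof.
move=> EZ /algf_level[B fB BP]; exists B => // s /BP fin.
apply: sub_finite_set (pairs_fibres_finite fin) => z [Ez fz].
have [[a1 _] [a2 _] _ e] := EZ z Ez; split=> //; by exists z.
Qed.

Let dpsi u x : u \is 1.-homog -> U x -> dom (reg x) (psi u).
Proof. by move=> hu [ax _]; have [] := psi_vl ax hu. Qed.

Lemma V_lin z u v s : Z z -> u \is 1.-homog -> v \is 1.-homog ->
  V (psi (u + s *: v)) z = V (psi u) z + s * V (psi v) z.
Proof.
move=> [U1 U2 _ _] hu hv; have [[C1 _ _] _] := U1; have [[C2 _ _] _] := U2.
have lin x : C x -> dom (reg x) (psi u) -> dom (reg x) (psi v) ->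
    vl x (psi (u + s *: v)) = vl x (psi u) + s * vl x (psi v).
  move=> Cx du dv; have dc := domC gw s Cx.
  by rewrite psi_lin (vlD gw Cx du (domM gw Cx dc dv)) (vlM gw Cx dc dv) (vlC gw).
by rewrite /V !lin //; [ring|exact: dpsi..].
Qed.

(** The vanishing at s is the level s of the algebraic function - V(psi u) / V(psi v). *)
Lemma ratio_level u v : u \is 1.-homog -> v \is 1.-homog -> exists2 B, finite_set B &
  forall s, ~ B s -> finite_set [set z | [/\ Z z, V (psi v) z != 0 & V (psi (u + s *: v)) z = 0]].
Proof.
move=> hu hv; pose E := Z `&` [set z | V (psi v) z != 0].
have sE : E `<=` Z by move=> z [].
have [|B fB BP] := @level_finite E (fun z => - V (psi u) z * (V (psi v) z)^-1) sE.
  apply: algfM; first by apply: algfN; apply: algf_sub sE _; apply: algf_V => x; exact: dpsi.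
  apply: algfV; last by move=> z [].
  by apply: algf_sub sE _; apply: algf_V => x; exact: dpsi.
exists B => // s /BP; apply: sub_finite_set => z [Zz v0].
rewrite V_lin // => /eqP; rewrite addr_eq0 => /eqP e; split=> //.
by rewrite e opprK mulfK.
Qed.

(** If V vanished at a pair for every coordinate form, the two points would be proportional. A
    suitable form is assembled by adding the coordinate forms one at a time, with coefficients off
    the finitely many bad levels. *)
Lemma generically_V : generically (fun u => finite_set [set z | Z z /\ V (psi u) z = 0]).
Proof.
split.
  suff H m : (m <= n.+1)%N -> exists2 u : form, u \is 1.-homog & finite_set [set z | [/\ Z z,
      V (psi u) z = 0 & exists i : 'I_n.+1, (i < m)%N /\ V (psi 'X_i) z != 0]].
    have [u hu fu] := H n.+1 (leqnn _); exists u => //.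
    apply: sub_finite_set fu => z [Zz e]; split=> //.
    have [[a1 _] [a2 _] d _] := Zz; have [_ _ k1] := kapP a1; have [_ _ k2] := kapP a2.
    have [_ _ b1] := a1; have [_ _ b2] := a2.
    apply: contrapT => no; apply: d.
    apply: (@proj_eq _ _ _ _ (kap z.2 / ev b (rep z.2) / (kap z.1 / ev b (rep z.1)))).
    apply/rowP => i; rewrite mxE.
    have : V (psi 'X_i) z = 0 by apply: contrapT => /eqP ne; apply: no; exists i.
    have hX := @hom_coord k n i.
    rewrite /V (psi_vl a1 hX).2 (psi_vl a2 hX).2 !evXU => /eqP; rewrite subr_eq0 => /eqP e2.
    apply: (mulIf (x := kap z.1 / ev b (rep z.1))); first by rewrite mulf_neq0 ?invr_eq0.
    transitivity (rep z.1 0 i / ev b (rep z.1) * kap z.1); first by ring.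
    rewrite e2; move: (ev b (rep z.1)) b1 (ev b (rep z.2)) b2 => p1 b1 p2 b2.
    by field; rewrite b1 b2 k1.
  elim: m => [_|m IH lm].
    exists 0; first exact: rpred0.
    by apply: (@sub_finite_set _ _ set0) => // z [_ _ [i []]].
  have [u hu fu] := IH (ltnW lm); pose i := Ordinal lm.
  have [B fB BP] := ratio_level hu (@hom_coord k n i).
  have [s ns] := avoid_finite fB; exists (u + s *: 'X_i).
    by apply: lin_homog => //; exact: hom_coord.
  have fin2 := conj (BP s ns) fu; rewrite -finite_setU in fin2.
  apply: sub_finite_set fin2 => z [Zz e [l [lm' l0]]].
  have [e0|e0] := eqVneq (V (psi 'X_i) z) 0; last by left.
  right; split=> //.
    by move: e; rewrite V_lin //; [rewrite e0 mulr0 addr0|exact: hom_coord].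
  exists l; split=> //; move: lm'; rewrite ltnS leq_eqVlt => /orP[/eqP lE|//].
  by move: l0; rewrite (_ : l = i) ?e0 ?eqxx //; exact: val_inj.
move=> u v hu hv fu; split.
  have [B fB BP] := ratio_level hu hv; apply: sub_finite_set fB => s nP.
  apply: contrapT => /BP fin; apply: nP.
  have fin2 := conj fin fu; rewrite -finite_setU in fin2.
  apply: sub_finite_set fin2 => z [Zz e].
  have [e0|e0] := eqVneq (V (psi v) z) 0; last by left.
  by right; split=> //; move: e; rewrite V_lin // e0 mulr0 addr0.
have [B fB BP] := ratio_level hv hu; apply: sub_finite_set fB => s nP.
apply: contrapT => /BP fin; apply: nP.
have fin2 := conj fin fu; rewrite -finite_setU in fin2.
apply: sub_finite_set fin2 => z [Zz e].
by have [e0|e0] := eqVneq (V (psi u) z) 0; [right|left].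
Qed.

Lemma ramified_finite : finite_set [set x | aff x /\ ~ uniformizer x (g - emb (gv x))].
Proof.
apply: sub_finite_set (unram_finite gw hC hsm hD Dg) => x [[Cx hx bx] nu]; split=> // - [c uc].
apply: nu; have -> : gv x = c; last by [].
have gx := reg_graph gw Cx; apply: (pg_fun gx (reg_pencil Cx bx)).
by rewrite -[g](subrK (emb c)) -[c in reg _ _ c]add0r; apply: (pgD gx (unif0 uc)); exact: (pgC gx).
Qed.

(** [L0] leaves finitely many pairs unseparated, [L1] separates those, [l2] leaves finitely many
    pairs where both values can agree, and [l1] removes the rest. *)
Lemma exists_projection (m : nat) : exists L0 L1 l1 l2, [/\ L0 \is 1.-homog, L1 \is 1.-homog & l2 != 0] /\
  let f := (emb l1 + emb l2 * g) * psi L0 + psi L1 in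
  [/\ forall x, C x -> ev h (rep x) = 0 ->
        (l1 + l2 * gv x) * ev L0 (rep x) + ev L1 (rep x) != 0,
      forall x y, C x -> C y -> ev b (rep x) = 0 -> ev b (rep y) = 0 -> x <> y ->
        ev L0 (rep x) / ev h (rep x) * (ev a (rep x) / ev h (rep x)) ^+ m !=
        ev L0 (rep y) / ev h (rep y) * (ev a (rep y) / ev h (rep y)) ^+ m &
  [/\ forall x y, aff x -> aff y -> gv x = gv y -> gv x \in cs -> x <> y -> vl x f <> vl y f,
      forall x, aff x -> ~ uniformizer x (g - emb (gv x)) -> uniformizer x (f - emb (vl x f)) &
      forall x y, U x -> U y -> gv x = gv y -> x <> y -> vl x f = vl y f ->
        vl x (D f) <> vl y (D f)]].
Proof.
have exT x : exists t, C x -> uniformizer x t.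
  have [Cx|nC] := pselect (C x); last by exists 0.
  by have [t ut] := unif_exists gw hC hsm Cx; exists t.
have [T TE] := choice exT.
pose Bp := [set z : pt * pt | [/\ aff z.1, aff z.2, gv z.1 = gv z.2 & gv z.1 \in cs]]
  `&` [set z : pt * pt | z.1 <> z.2].
have fB : finite_set Bp.
  have := pairs_fibres_finite (finite_seq cs); apply: sub_finite_set => z [] //.
have b_fin : finite_set [set x | C x /\ ev b (rep x) = 0].
  have [|x Cx bx] := gen_nonvanish gw _ bn; first by exists 1%N.
  by apply: (curve_zeros_finite hC); [exists 1%N|exists x].
pose Ip := ([set x | C x /\ ev b (rep x) = 0] `*` [set x | C x /\ ev b (rep x) = 0])
  `&` [set z : pt * pt | z.1 <> z.2].
have fI : finite_set Ip by apply: sub_finite_set (finite_setX b_fin b_fin) => z [].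
pose Rr := [set x | aff x /\ ~ uniformizer x (g - emb (gv x))].
have fR : finite_set Rr := ramified_finite.
have h0 x : C x -> ev b (rep x) = 0 -> ev h (rep x) != 0.
  by move=> Cx bx; apply/eqP => hx; have := hb0 Cx hx; rewrite bx eqxx.
pose im x := (ev a (rep x) / ev h (rep x)) ^+ m / ev h (rep x).
have sep z (u : form) : aff z.1 -> aff z.2 -> u \is 1.-homog ->
    V (psi u) z = ev u (rep z.1) * (kap z.1 / ev b (rep z.1)) - ev u (rep z.2) * (kap z.2 / ev b (rep z.2)).
  by move=> a1 a2 hu; rewrite /V (psi_vl a1 hu).2 (psi_vl a2 hu).2; ring.
have kb x : aff x -> kap x / ev b (rep x) != 0.
  by move=> ax; have [_ _ kx] := kapP ax; have [_ _ bx] := ax; rewrite mulf_neq0 ?invr_eq0.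
have [[L0 hL0 [P1 [P2 [P3 [P4 P5]]]]] _] : generically (fun u : form =>
    (forall x, C x /\ ev h (rep x) = 0 -> ev u (rep x) != 0) /\
    (forall z, Bp z -> ev u (rep z.1) * (kap z.1 / ev b (rep z.1)) -
       ev u (rep z.2) * (kap z.2 / ev b (rep z.2)) != 0) /\
    (forall z, Ip z -> ev u (rep z.1) * im z.1 - ev u (rep z.2) * im z.2 != 0) /\
    (forall x, Rr x -> jet x (T x) (psi u) != 0) /\
    finite_set [set z | Z z /\ V (psi u) z = 0]).
  apply: genericallyI; last apply: genericallyI; last apply: genericallyI; last apply: genericallyI.
  - by apply: generically_forall => // x _; exact: generically_ev.
  - apply: generically_forall => // z [[a1 a2 _ _] ne].
    by apply: (generically_sep _ ne); exact: kb.
  - apply: generically_forall => // z [[[C1 b1] [C2 b2]] ne].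
    apply: (generically_sep _ ne); rewrite /im mulf_neq0 ?invr_eq0 ?h0 // expf_neq0 //.
    by rewrite mulf_neq0 ?invr_eq0 ?h0 ?ab0.
  - apply: generically_forall => // x [ax _]; have [Cx _ bx] := ax.
    have [dk vk k0] := kapP ax.
    by apply: (generically_jet gw hC hsm Cx (TE x Cx) hb bx dk); rewrite vk.
  - exact: generically_V.
(* At these finitely many pairs l1 and l2 have no influence on the difference of the values, so [L1]
   alone has to separate. *)
have [[L1 hL1 Q1] _] : generically (fun u : form => forall z, (Z z /\ V (psi L0) z = 0) ->
    ev u (rep z.1) * (kap z.1 / ev b (rep z.1)) - ev u (rep z.2) * (kap z.2 / ev b (rep z.2)) != 0).
  apply: generically_forall => // z [[[a1 _] [a2 _] ne _] _].
  by apply: (generically_sep _ ne); exact: kb.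
pose E := Z `&` [set z | V (psi L0) z != 0].
have sE : E `<=` Z by move=> z [].
(* Equality of the values of f forces l1 + l2 g = - V(psi L1) / V(psi L0) at the pair; inserted in
   the equality of the derivatives, this forces l2 to be [eta]. *)
pose eta z := - (V (D (psi L1)) z + - V (psi L1) z * (V (psi L0) z)^-1 * V (D (psi L0)) z) * (V (psi L0) z)^-1.
have dD u : u \is 1.-homog -> forall x, U x -> dom (reg x) (D (psi u)).
  by move=> hu x Ux; apply: U_der => //; exact: dpsi.
have aV q : (forall x, U x -> dom (reg x) q) -> algf gz E (V q).
  by move=> dq; apply: algf_sub sE _; exact: algf_V.
have aI : algf gz E (fun z => (V (psi L0) z)^-1).
  by apply: algfV; [apply: aV => x; exact: dpsi|move=> z []].
have [|S fS SP] := @level_finite E eta sE.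
  apply: algfM (aI); apply: algfN; apply: algfD; first by apply: aV; exact: dD.
  apply: algfM; last by apply: aV; exact: dD.
  by apply: algfM (aI); apply: algfN; apply: aV => x; exact: dpsi.
(* Off [S] the level set of [eta] is finite; l2 must also be nonzero, since the images of the zeros
   of b are distinguished by a coordinate proportional to l2. *)
have [l2 n2] : exists l2, ~ (S `|` [set 0]) l2.
  by apply: avoid_finite; rewrite finite_setU; split.
have {n2}[/SP fW /eqP l20] : ~ S l2 /\ l2 <> 0 by split=> e; apply: n2; [left|right].
(* What remains is affine in l1 with nonzero slope at each of finitely many points or pairs: a pole
   at the zeros of h, separation on branch fibres, immersion at ramification points, and the pairs
   with [eta] equal to l2. *)
have f1 := finite_affine_zeros (fun x => l2 * gv x) (fun x => ev L1 (rep x)) h_fin P1.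
have P2' z : Bp z -> V (psi L0) z != 0.
  by move=> Bz; have [[a1 a2 _ _] _] := Bz; rewrite sep //; exact: P2.
have f2 := finite_affine_zeros (fun z => l2 * gv z.1) (V (psi L1)) fB P2'.
have f3 := finite_affine_zeros (fun x => l2 * gv x) (fun x => jet x (T x) (psi L1)) fR P4.
have fW0 z : (E z /\ eta z = l2) -> V (psi L0) z != 0 by move=> [[]].
have f4 := finite_affine_zeros (fun z => l2 * gv z.1) (V (psi L1)) fW fW0.
have := conj f1 (conj f2 (conj f3 f4)); rewrite -!finite_setU => /avoid_finite[l1].
move=> /not_orP[n1 /not_orP[n2 /not_orP[n3 n4]]].
exists L0, L1, l1, l2; split; first by split.
have du x (u : form) : aff x -> u \is 1.-homog -> dom (reg x) (psi u).
  by move=> ax hu; have [] := psi_vl ax hu.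
have dl x : aff x -> dom (reg x) (emb l1 + emb l2 * g) /\ vl x (emb l1 + emb l2 * g) = l1 + l2 * gv x.
  move=> [Cx _ bx]; have gx := reg_graph gw Cx.
  have r2 : reg x (emb l1 + emb l2 * g) (l1 + l2 * gv x).
    apply: (pgD gx); [exact: (pgC gx)|apply: (pgM gx); [exact: (pgC gx)|exact: reg_pencil]].
  by split; [exists (l1 + l2 * gv x)|exact: (vlE gw Cx)].
set f := (emb l1 + emb l2 * g) * psi L0 + psi L1.
have fE x : aff x -> dom (reg x) f /\ vl x f = (l1 + l2 * gv x) * vl x (psi L0) + vl x (psi L1).
  move=> ax; have [d v] := dl x ax; have [Cx _ bx] := ax.
  have d0 := du x _ ax hL0; have d1 := du x _ ax hL1.
  split; first by apply: (domD gw) => //; exact: (domM gw).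
  by rewrite /f (vlD gw Cx (domM gw Cx d d0) d1) (vlM gw Cx d d0) v.
split.
- by move=> x Cx hx; apply/eqP => e; apply: n1; exists x.
- move=> x y Cx Cy bx yb xy; have := P3 (x, y) (conj (conj (conj Cx bx) (conj Cy yb)) xy).
  rewrite /im /= subr_eq0; apply: contra => /eqP e; apply/eqP.
  transitivity (ev L0 (rep x) / ev h (rep x) * (ev a (rep x) / ev h (rep x)) ^+ m); first by ring.
  by rewrite e; ring.
split.
- move=> x y ax ay e xcs xy; have [_ ->] := fE x ax; have [_ ->] := fE y ay => e2.
  apply: n2; exists (x, y); first by [].
  by move/eqP: e2; rewrite -e -subr_eq0 => /eqP e2; rewrite -[RHS]e2 /V /=; ring.
- move=> x ax nu; have [Cx _ bx] := ax; have [df _] := fE x ax; have gx := reg_graph gw Cx.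
  apply/(jet_unif gw Cx (TE x Cx) df); apply/eqP => jf.
  apply: n3; exists x => //; rewrite -jf /f.
  have [d v] := dl x ax; have d0 := du x _ ax hL0; have d1 := du x _ ax hL1.
  have rg := reg_pencil Cx bx; have dg : dom (reg x) g by exists (gv x).
  have jg : jet x (T x) g = 0.
    apply: contrapT => /eqP jg; apply: nu; rewrite -(vlE gw Cx rg).
    by apply/(jet_unif gw Cx (TE x Cx) dg).
  have dc c := domC gw c Cx.
  rewrite (jetD gw Cx (TE x Cx) (domM gw Cx d d0) d1) (jetM gw Cx (TE x Cx) d d0) v.
  rewrite (jetD gw Cx (TE x Cx) (dc l1) (domM gw Cx (dc l2) dg)).
  by rewrite (jetCM gw Cx (TE x Cx) l2 dg) jg (jetC gw Cx) mulr0 addr0 mul0r add0r.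
- move=> x y Ux Uy e xy; have [ax _] := Ux; have [ay _] := Uy.
  have [_ ->] := fE x ax; have [_ ->] := fE y ay => e0 e1.
  have Zz : Z (x, y) by [].
  have {}e0 : (l1 + l2 * gv x) * V (psi L0) (x, y) + V (psi L1) (x, y) = 0.
    by rewrite /V /=; move/eqP: e0; rewrite -e -subr_eq0 => /eqP <-; ring.
  have [v0|v0] := eqVneq (V (psi L0) (x, y)) 0.
    have := Q1 (x, y) (conj Zz v0); rewrite -(sep (x, y) _ ax ay hL1).
    by move: e0; rewrite v0 mulr0 add0r => ->; rewrite eqxx.
  have Dv q : U q -> vl q (D f) = l2 * vl q (psi L0) + (l1 + l2 * gv q) * vl q (D (psi L0)) + vl q (D (psi L1)).
    move=> Uq; have [aq _] := Uq; have [Cq _ _] := aq.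
    have [d v] := dl q aq; have d0 := du q _ aq hL0.
    have D0 := dD _ hL0 q Uq; have D1 := dD _ hL1 q Uq; have dc := domC gw l2 Cq.
    have -> : D f = emb l2 * psi L0 + (emb l1 + emb l2 * g) * D (psi L0) + D (psi L1).
      by rewrite /f (derD hD) (derM hD) (derD hD) (derC hD) (derCM hD) Dg add0r mulr1.
    have m1 := domM gw Cq dc d0; have m2 := domM gw Cq d D0.
    rewrite (vlD gw Cq (domD gw Cq m1 m2) D1) (vlD gw Cq m1 m2) (vlM gw Cq dc d0).
    by rewrite (vlM gw Cq d D0) v (vlC gw).
  apply: n4; exists (x, y) => //; split; first by [].
  move: e1; rewrite !Dv // -e => /eqP; rewrite -subr_eq0 => /eqP e1.
  have ll : l1 + l2 * gv x = - V (psi L1) (x, y) / V (psi L0) (x, y).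
    by apply: (canRL (mulfK v0)); apply/eqP; rewrite -addr_eq0 e0.
  rewrite /eta -ll; apply: (canLR (mulfK v0)); apply/eqP; rewrite eq_sym -addr_eq0; apply/eqP.
  by rewrite -[RHS]e1 /V /=; ring.
Qed.

End Selection.

(** * Local behaviour of the lift *)

Section LocalDerivation.
Variables (k : numClosedFieldType) (n : nat) (K : fieldType) (emb : {rmorphism k -> K}).
Variables (w : 'I_n.+1 -> K) (C : set (proj k n)).
Hypotheses (gw : generic C emb w) (hC : curve C) (hsm : smooth C).
Local Notation reg := (reg emb w).
Local Notation uniformizer := (uniformizer emb w).
Local Notation vl := (vl emb w).
Variables (D : K -> K) (g : K).
Hypotheses (hD : derivation emb D) (Dg : D g = 1).
Variables (x : proj k n) (c : k).
Hypothesis Cx : C x.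
Let gx := reg_graph gw Cx.

Lemma g_nonconst d : g - emb d != 0.
Proof.
rewrite subr_eq0; apply/eqP => gc.
by move: Dg; rewrite gc (derC hD) => /eqP; rewrite eq_sym oner_eq0.
Qed.

(* At a point where g has ramification index e the derivation D lowers orders by at most e. *)
Lemma der_vanish q : reg x g c -> dom (reg x) q -> reg x ((g - emb c) * D q) 0.
Proof.
move=> gc dq; have D0 : exists p, D p != 0 by exists g; rewrite Dg oner_neq0.
have g0 : reg x (g - emb c) 0.
  by rewrite -[X in reg _ _ X](subrr c); apply: (pgB gx) => //; exact: (pgC gx).
have [t [s [ut s0 sD [e e0 se]]]] := der_local gw hC hsm hD D0 Cx.
have [|[|N] [u [d [d0 ud gE]]]] := unif_order gw Cx ut _ (g_nonconst c); first by exists 0.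
  rewrite expr0 mul1r in gE; rewrite gE in g0.
  by move: d0; rewrite (pg_fun gx ud g0) eqxx.
have [u' uE u'd] := der_order gw hD N.+1%:Z Cx ut sD se ud.
have t0 := unif_neq0 ut.
have u'0 : u' != 0.
  by apply: (pg_neq0 gx u'd); rewrite !mulf_neq0 // intr_eq0.
have sE : s = t ^+ N * u'.
  move: uE; rewrite -exprnP -gE (derB hD) (derC hD) Dg subr0 mulr1 => ->.
  by have -> : N.+1%:Z - 1 = N%:Z by lia.
have -> : (g - emb c) * D q = (u / u' * (s * D q)) * t.
  by rewrite {1}sE gE exprS; field.
apply: (regM0 gw Cx); last exact: unif0.
apply: (domM gw) => //; last exact: sD.
exists (d * (N.+1%:Z%:~R * e * d)^-1); apply: (pgM gx) => //; apply: reg_local => //.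
by rewrite !mulf_neq0 // intr_eq0.
Qed.

Hypothesis ug : uniformizer x (g - emb c).

(** The leading value is multiplied by -N, so a genuine pole deepens at each derivative; the form of
    the conclusion allows iteration. *)
Lemma der_pole F N u d : F * (g - emb c) ^+ N = u -> reg x u d ->
  exists2 u', D F * (g - emb c) ^+ N.+1 = u' & reg x u' (- N%:R * d).
Proof.
move=> FE ud; have D0 : exists p, D p != 0 by exists g; rewrite Dg oner_neq0.
have Du : dom (reg x) (D u) by apply: (unram_dom gw hC hsm hD D0 Dg Cx ug); exists d.
eexists; first by [].
have -> : D F * (g - emb c) ^+ N.+1 = D u * (g - emb c) + - N%:R * u.
  rewrite -FE (derM hD) (derX hD) (derB hD) (derC hD) Dg subr0 mulr1.
  by case: N {FE} => [|N] /=; [rewrite mulr0n expr0|rewrite -[_ *+ _]mulr_natl !exprS]; ring.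
rewrite -[X in reg _ _ X]add0r; apply: (pgD gx).
  by apply: (regM0 gw Cx) => //; exact: unif0.
by apply: (pgM gx) => //; apply: (pgN gx); rewrite -(rmorph_nat emb); exact: (pgC gx).
Qed.

End LocalDerivation.

Definition vec4 (R : nzRingType) (s : seq R) : 'rV[R]_4 := \row_(i < 4) s`_i.

(* The Legendrian lift of the plane curve (g, f), where D is the derivation with D g = 1. *)
Definition contact_lift (K : fieldType) (D : K -> K) (g f : K) : 'I_4 -> K :=
  fun i => [:: 1; f - 2%:R^-1 * g * D f; g; 2%:R^-1 * D f]`_i.

Lemma forall_ord4 (P : 'I_4 -> Prop) : P 0 -> P 1 -> P 2%:R -> P 3%:R -> forall i, P i.
Proof.
move=> P0 P1 P2 P3 [[|[|[|[|//]]]] lt].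
- by rewrite (_ : Ordinal _ = 0) //; exact: val_inj.
- by rewrite (_ : Ordinal _ = 1) //; exact: val_inj.
- by rewrite (_ : Ordinal _ = 2%:R) //; exact: val_inj.
- by rewrite (_ : Ordinal _ = 3%:R) //; exact: val_inj.
Qed.

Section LocalForms.
Variables (k : numClosedFieldType) (n : nat) (K : fieldType) (emb : {rmorphism k -> K}).
Variables (w : 'I_n.+1 -> K) (C : set (proj k n)).
Hypotheses (gw : generic C emb w) (hC : curve C) (hsm : smooth C).
Local Notation reg := (reg emb w).
Local Notation uniformizer := (uniformizer emb w).
Local Notation vl := (vl emb w).
Variables (D : K -> K) (g f : K).
Hypotheses (hD : derivation emb D) (Dg : D g = 1).
Local Notation Phi := (contact_lift D g f).
Local Notation pval := (pval emb w Phi).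
Variable x : proj k n.
Hypothesis Cx : C x.
Let gx := reg_graph gw Cx.

Let half (q : K) d : reg x q d -> reg x (2%:R^-1 * q) (2%:R^-1 * d).
Proof.
move=> qd; apply: (pgM gx) => //; rewrite -(rmorph_nat emb) -fmorphV; exact: (pgC gx).
Qed.

Let two_neq0 : 2%:R != 0 :> K. Proof. exact: (natK_neq0 emb 1). Qed.

Definition immersed (v : 'rV[k]_4) := exists A B : {mpoly k[4]}, [/\ A \is 1.-homog, B \is 1.-homog,
  ev A v = 0, ev B v != 0 & uniformizer x (mmap emb Phi A / mmap emb Phi B)].

Lemma immersed_intro (v : 'rV[k]_4) i j d e s : i != j -> v 0 i * d = e * v 0 j -> v 0 j != 0 ->
  uniformizer x s -> emb d * Phi i - emb e * Phi j = s * Phi j -> Phi j != 0 -> immersed v.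
Proof.
move=> ij vE vj us PE Pj; exists (d *: 'X_i - e *: 'X_j), 'X_j.
have hX := @hom_coord k 3; split=> //.
- by apply: rpredB; apply: rpredZ.
- by rewrite -scaleNr evD !evZ !evXU mulrC vE mulNr subrr.
- by rewrite evXU.
- by rewrite rmorphB /= !evKZ !mmapX !mmap1U PE mulfK.
Qed.

Lemma pval_finite c p q : reg x g c -> reg x f p -> reg x (D f) q ->
  pval x (vec4 [:: 1; p - 2%:R^-1 * c * q; c; 2%:R^-1 * q]).
Proof.
move=> gc fp fq; apply: (@pval_intro _ _ _ _ emb w Phi _ _ 0); first exact: oner_neq0.
apply: forall_ord4; rewrite mxE /contact_lift /= divr1 //.
- exact: (pg11 gx).
- by apply: (pgB gx) => //; rewrite -!mulrA; apply: half; exact: (pgM gx).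
- exact: half.
Qed.

Lemma immersed_finite c p q : reg x g c -> reg x f p -> reg x (D f) q ->
  uniformizer x (g - emb c) \/ uniformizer x (D f - emb q) ->
  immersed (vec4 [:: 1; p - 2%:R^-1 * c * q; c; 2%:R^-1 * q]).
Proof.
have two0 : 2%:R != 0 :> k by rewrite pnatr_eq0.
move=> gc fp fq [us|us].
  apply: (immersed_intro (i := 2%:R) (j := 0) (d := 1) (e := c) _ _ _ us) => //.
  - by rewrite !mxE /= mulr1.
  - by rewrite mxE /= oner_neq0.
  - by rewrite /contact_lift /= rmorph1 mul1r !mulr1.
  - exact: oner_neq0.
apply: (immersed_intro (i := 3%:R) (j := 0) (d := 2%:R) (e := q) _ _ _ us) => //.
- by rewrite !mxE /= mulr1 mulrAC mulVf // mul1r.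
- by rewrite mxE /= oner_neq0.
- by rewrite /contact_lift /= rmorph_nat mulrA divff // mul1r !mulr1.
- exact: oner_neq0.
Qed.

(** The derivation with respect to the local parameter 1/g is D2 = - g^2 D. As f' = om - D2(om)/g,
    both f' and om have value [e], so (f - g f'/2)/g = om - f'/2 has value e/2. *)
Lemma infinite_point om e : reg x g^-1 0 -> uniformizer x g^-1 -> f = g * om -> reg x om e ->
  pval x (vec4 [:: 0; 2%:R^-1 * e; 1; 0]) /\ immersed (vec4 [:: 0; 2%:R^-1 * e; 1; 0]).
Proof.
move=> gi0 ui fE ome.
have g0 : g != 0 by have := g_nonconst hD Dg 0; rewrite rmorph0 subr0.
pose D2 q := - g ^+ 2 * D q.
have hD2 : derivation emb D2.
  split=> [p q|p q|c]; rewrite /D2; first by rewrite (derD hD) mulrDr.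
    by rewrite (derM hD); ring.
  by rewrite (derC hD) mulr0.
have D2g : D2 g^-1 = 1 by rewrite /D2 (derV hD) // Dg; field.
have [e' ome'] : dom (reg x) (D2 om).
  have D0 : exists p, D2 p != 0 by exists g^-1; rewrite D2g oner_neq0.
  apply: (unram_dom gw hC hsm hD2 D0 D2g (c := 0) Cx); last by exists e.
  by rewrite rmorph0 subr0.
have Df : reg x (D f) e.
  have -> : D f = om - D2 om * g^-1 by rewrite fE (derM hD) Dg /D2; field.
  rewrite -[X in reg _ _ X]subr0; apply: (pgB gx) => //; apply: (regM0 gw Cx) => //.
  by exists e'.
split.
  apply: (@pval_intro _ _ _ _ emb w Phi _ _ 2%:R) => //.
  apply: forall_ord4; rewrite mxE /contact_lift /=.
  - by rewrite mul1r.
  - have -> : (f - 2%:R^-1 * g * D f) / g = om - 2%:R^-1 * D f.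
      by rewrite fE; field; rewrite ?two_neq0 ?g0.
    have -> : 2%:R^-1 * e = e - 2%:R^-1 * e by field.
    by apply: (pgB gx) => //; exact: half.
  - by rewrite divff //; exact: (pg11 gx).
  - by apply: (regM0 gw Cx) => //; exists (2%:R^-1 * e); exact: half.
apply: (immersed_intro (i := 0) (j := 2%:R) (d := 1) (e := 0) _ _ _ ui) => //.
- by rewrite !mxE /= !mul0r.
- by rewrite mxE /= oner_neq0.
- by rewrite /contact_lift /= rmorph1 rmorph0 mul0r subr0 mulr1 mulVf.
Qed.

(** f' has a deeper pole than f, so division by f'/2 leaves only the limit (0 : -c : 0 : 1). With t
    = g - c, the second coordinate plus c becomes 2 f/f' - t, which is t times a unit of value
    -(N+3)/(N+1). *)
Lemma pole_point c N u d : uniformizer x (g - emb c) -> f * (g - emb c) ^+ N.+1 = u ->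
  reg x u d -> d != 0 ->
  pval x (vec4 [:: 0; - c; 0; 1]) /\ immersed (vec4 [:: 0; - c; 0; 1]).
Proof.
move=> us fE ud d0.
have [rho rE rd] := der_pole gw hC hsm hD Dg Cx us fE ud.
set t := g - emb c in us fE rE.
have rv0 : - N.+1%:R * d != 0 by rewrite mulNr oppr_eq0 mulf_neq0 // pnatr_eq0.
have rho0 := pg_neq0 gx rd rv0; have t0 := unif_neq0 us.
have Df0 : D f != 0 by apply/eqP => e; move: rho0; rewrite -rE e mul0r eqxx.
have rt : dom (reg x) t by exists 0; exact: unif0.
have gc : reg x g c.
  by rewrite -[g](subrK (emb c)) -[c in reg _ _ c]add0r; apply: (pgD gx (unif0 us)); exact: (pgC gx).
have dri : reg x rho^-1 (- N.+1%:R * d)^-1 by exact: reg_local.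
have r2 : reg x 2%:R 2%:R by rewrite -(rmorph_nat emb); exact: (pgC gx).
have z1 : reg x (2%:R * rho^-1 * t ^+ N.+2) 0.
  apply: (regM0 gw Cx).
    by exists (2%:R * (- N.+1%:R * d)^-1); exact: (pgM gx).
  by rewrite exprSr; apply: (regM0 gw Cx); [exact: (domX gw)|exact: unif0].
have P3 : Phi 3%:R = 2%:R^-1 * D f by [].
have P30 : Phi 3%:R != 0 by rewrite P3 mulf_neq0 // invr_eq0.
have iE : (Phi 3%:R)^-1 = 2%:R * rho^-1 * t ^+ N.+2.
  rewrite P3 -rE; move: (t ^+ N.+2) (expf_neq0 N.+2 t0) => T T0.
  by rewrite !invfM invrK -!mulrA mulVf ?mulr1.
have fD : f / Phi 3%:R = 2%:R * (u / rho) * t.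
  rewrite iE -fE [t ^+ N.+2]exprSr; ring.
split.
  apply: (pval_intro P30); apply: forall_ord4; rewrite mxE /=.
  - by rewrite [Phi 0]/= mul1r iE.
  - have -> : Phi 1 / Phi 3%:R = 2%:R * (u / rho) * t - g.
      by rewrite [Phi 1]/= mulrBl fD P3; congr (_ - _); field; rewrite ?Df0 ?two_neq0.
    rewrite -[X in reg _ _ X]add0r; apply: (pgB gx) => //; apply: (regM0 gw Cx); last exact: unif0.
    by exists (2%:R * (d * (- N.+1%:R * d)^-1)); do !apply: (pgM gx).
  - by rewrite [Phi 2%:R]/= iE; apply: (regM0 gw Cx) => //; exists c.
  - by rewrite divff //; exact: (pg11 gx).
apply: (immersed_intro (i := 1) (j := 3%:R) (d := 1) (e := - c) (s := t * (2%:R * (u / rho) - 1))) => //.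
- by rewrite !mxE /= !mulr1.
- by rewrite mxE /= oner_neq0.
- apply: (unif_mul gw Cx us (c := 2%:R * (d * (- N.+1%:R * d)^-1) - 1)).
    by apply: (pgB gx); [do !apply: (pgM gx)|exact: (pg11 gx)].
  have -> : 2%:R * (d * (- N.+1%:R * d)^-1) - 1 = - (N.+3%:R / N.+1%:R) :> k.
    have nn : N.+1%:R != 0 :> k by rewrite pnatr_eq0.
    have -> : N.+3%:R = 2%:R + N.+1%:R :> k by rewrite -natrD.
    by move: (N.+1%:R : k) nn => M nn; field; rewrite nn d0.
  by rewrite oppr_eq0 mulf_neq0 ?invr_eq0 ?pnatr_eq0.
- have -> : t * (2%:R * (u / rho) - 1) * Phi 3%:R = (2%:R * (u / rho) * t) * Phi 3%:R - t * Phi 3%:R by ring.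
  rewrite -fD divfK // rmorph1 rmorphN P3 /t -[Phi 1]/(f - 2%:R^-1 * g * D f); ring.
Qed.

End LocalForms.

(** * Injectivity and immersion of the lift *)

Section Lift.
Variables (k : numClosedFieldType) (n : nat) (K : fieldType) (emb : {rmorphism k -> K}).
Variables (w : 'I_n.+1 -> K) (C : set (proj k n)).
Hypotheses (gw : generic C emb w) (hC : curve C) (hsm : smooth C).
Local Notation evK := (mmap emb w).
Local Notation reg := (reg emb w).
Local Notation uniformizer := (uniformizer emb w).
Local Notation vl := (vl emb w).
Local Notation jet := (jet emb w).
Local Notation form := {mpoly k[n.+1]}.
Variables (h a b : form).
Hypotheses (hh : h \is 1.-homog) (ha : a \is 1.-homog) (hb : b \is 1.-homog).
Let g := evK a / evK b.
Let gv x := ev a (rep x) / ev b (rep x).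
Hypotheses (hb0 : forall x, C x -> ev h (rep x) = 0 -> ev b (rep x) != 0)
  (bn : evK b != 0) (hn : evK h != 0) (an : evK a != 0)
  (h_inj : forall x y, C x -> C y -> ev h (rep x) = 0 -> ev h (rep y) = 0 -> x <> y -> gv x != gv y)
  (h_unif : forall x, C x -> ev h (rep x) = 0 -> uniformizer x (g - emb (gv x)))
  (b_unif : forall x, C x -> ev b (rep x) = 0 -> uniformizer x (evK b / evK a)).
Variable D : K -> K.
Hypotheses (hD : derivation emb D) (Dg : D g = 1).
Variables (cs : seq k) (cs0 : (0 < size cs)%N) (csU : uniq cs).
Hypothesis csP : forall x, C x -> ev b (rep x) != 0 -> ~ uniformizer x (g - emb (gv x)) ->
  gv x \in cs.
Let aff x := [/\ C x, ev h (rep x) != 0 & ev b (rep x) != 0].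
Let U x := aff x /\ gv x \notin cs.
Let r := (size cs).+1.
Local Notation psi := (psi emb w h b r).
Variables (L0 L1 : form) (l1 l2 : k).
Hypotheses (hL0 : L0 \is 1.-homog) (hL1 : L1 \is 1.-homog) (l20 : l2 != 0).
Let q := (emb l1 + emb l2 * g) * psi L0 + psi L1.
Let iv x := ev L0 (rep x) / ev h (rep x) * (ev a (rep x) / ev h (rep x)) ^+ size cs.
Hypotheses (S1 : forall x, C x -> ev h (rep x) = 0 ->
        (l1 + l2 * gv x) * ev L0 (rep x) + ev L1 (rep x) != 0)
  (S2 : forall x y, C x -> C y -> ev b (rep x) = 0 -> ev b (rep y) = 0 -> x <> y -> iv x != iv y)
  (S3 : forall x y, aff x -> aff y -> gv x = gv y -> gv x \in cs -> x <> y -> vl x q <> vl y q)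
  (S4 : forall x, aff x -> ~ uniformizer x (g - emb (gv x)) -> uniformizer x (q - emb (vl x q)))
  (S5 : forall x y, U x -> U y -> gv x = gv y -> x <> y -> vl x q = vl y q -> vl x (D q) <> vl y (D q)).

Let M s := \prod_(c <- s) (g - emb c).
Let f := M cs * q.
Local Notation Phi := (contact_lift D g f).
Local Notation pval := (pval emb w Phi).
Local Notation immersed := (immersed emb w D g f).

Let rg x : C x -> ev b (rep x) != 0 -> reg x g (gv x).
Proof. exact: reg_pencil. Qed.

Let D0 : exists p, D p != 0. Proof. by exists g; rewrite Dg oner_neq0. Qed.

Let regM x s : C x -> ev b (rep x) != 0 -> reg x (M s) (\prod_(c <- s) (gv x - c)).
Proof.
move=> Cx bx; have gx := reg_graph gw Cx; rewrite /M; elim: s => [|c s IH].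
  by rewrite !big_nil; exact: (pg11 gx).
rewrite !big_cons; apply: (pgM gx) => //; apply: (pgB gx); [exact: rg|exact: (pgC gx)].
Qed.

Let dq x : aff x -> dom (reg x) q.
Proof.
move=> ax; have [Cx _ bx] := ax; have [d0 _] := psi_vl gw hh hb r ax hL0.
have [d1 _] := psi_vl gw hh hb r ax hL1.
apply: (domD gw) => //; apply: (domM gw) => //; apply: (domD gw) => //; first exact: (domC gw).
by apply: (domM gw) => //; [exact: (domC gw)|exists (gv x); exact: rg].
Qed.

Let U_dom x p : U x -> dom (reg x) p -> dom (reg x) (D p).
Proof.
move=> [[Cx hx bx] nc]; apply: (unram_dom gw hC hsm hD D0 Dg (c := gv x) Cx).
by apply: contrapT => nu; move/negP: nc; apply; exact: csP.
Qed.

Let derM_cons c s : D (M (c :: s)) = M s + (g - emb c) * D (M s).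
Proof. by rewrite /M big_cons (derM hD) (derB hD) (derC hD) Dg subr0 mul1r. Qed.

(** The derivative of a polynomial in g is again one, since D g = 1. On a fibre, f and f' can
    therefore differ only through q and D q. *)
Let M_der s x y : U x -> U y -> gv x = gv y -> vl x (D (M s)) = vl y (D (M s)).
Proof.
move=> Ux Uy e; elim: s => [|c s IH].
  have -> : D (M [::]) = emb 0 by rewrite /M big_nil (der1 hD) rmorph0.
  have [[Cx _ _] _] := Ux; have [[Cy _ _] _] := Uy.
  by rewrite (vlC gw Cx) (vlC gw Cy).
have E z : U z -> vl z (D (M (c :: s))) = \prod_(c <- s) (gv z - c) + (gv z - c) * vl z (D (M s)).
  move=> Uz; have [[Cz _ bz] _] := Uz; have gz := reg_graph gw Cz.
  have dM : dom (reg z) (M s) by eexists; exact: regM.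
  apply: (vlE gw Cz); rewrite derM_cons; apply: (pgD gz); first exact: regM.
  apply: (pgM gz); first by apply: (pgB gz); [exact: rg|exact: (pgC gz)].
  by apply: (vl_reg gw Cz); exact: U_dom.
by rewrite !E // IH e.
Qed.

Let unbranched x : U x -> [/\ dom (reg x) f, dom (reg x) (D f),
  vl x f = \prod_(c <- cs) (gv x - c) * vl x q,
  \prod_(c <- cs) (gv x - c) != 0 &
  vl x (D f) = vl x (D (M cs)) * vl x q + \prod_(c <- cs) (gv x - c) * vl x (D q)].
Proof.
move=> Ux; have [ax nc] := Ux; have [Cx hx bx] := ax; have gx := reg_graph gw Cx.
have rM := regM cs Cx bx; have rq := vl_reg gw Cx (dq ax).
have dM : dom (reg x) (M cs) by eexists; exact: rM.
have rf : reg x f (\prod_(c <- cs) (gv x - c) * vl x q) by exact: (pgM gx).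
have rDf : reg x (D f) (vl x (D (M cs)) * vl x q + \prod_(c <- cs) (gv x - c) * vl x (D q)).
  rewrite /f (derM hD); apply: (pgD gx); apply: (pgM gx) => //.
    by apply: (vl_reg gw Cx); exact: U_dom.
  by apply: (vl_reg gw Cx); apply: U_dom => //; exact: dq.
split; [by eexists; exact: rf|by eexists; exact: rDf|exact: (vlE gw Cx)| |exact: (vlE gw Cx)].
rewrite prodf_seq_neq0; apply/allP => c cc /=; rewrite subr_eq0.
by apply: contraNneq nc => ->.
Qed.

Let factor_cs c : c \in cs -> M cs = (g - emb c) * M (rem c cs).
Proof. by move=> cc; rewrite /M (perm_big _ (perm_to_rem cc)) big_cons. Qed.

Let rem_neq0 c : \prod_(d <- rem c cs) (c - d) != 0.
Proof.
rewrite prodf_seq_neq0; apply/allP => d; rewrite mem_rem_uniq // inE => /andP[dc _] /=.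
by rewrite subr_eq0 eq_sym.
Qed.

(** With c the value of g, f is (g - c) times a regular function p, so f' = p + (g - c) D p; the
    last term vanishes at x by [der_vanish], although D p may have a pole. *)
Let branched x : aff x -> gv x \in cs -> [/\ reg x f 0,
  reg x (D f) (\prod_(d <- rem (gv x) cs) (gv x - d) * vl x q) &
  ~ uniformizer x (g - emb (gv x)) ->
  uniformizer x (D f - emb (\prod_(d <- rem (gv x) cs) (gv x - d) * vl x q))].
Proof.
move=> ax cx; have [Cx hx bx] := ax; have gx := reg_graph gw Cx.
pose N := M (rem (gv x) cs); have rN := regM (rem (gv x) cs) Cx bx; rewrite -/N in rN.
have dN : dom (reg x) N by eexists; exact: rN.
have rq := vl_reg gw Cx (dq ax); have rw := pgM gx rN rq; have g0 := rg Cx bx.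
set e := \prod_(d <- _) _ * _ in rw *.
have fE : f = (g - emb (gv x)) * (N * q) by rewrite /f (factor_cs cx) mulrA.
have t0 : reg x (g - emb (gv x)) 0.
  by rewrite -[X in reg _ _ X](subrr (gv x)); apply: (pgB gx) => //; exact: (pgC gx).
have dw : dom (reg x) (N * q) by eexists; exact: rw.
have DfE : D f = N * q + (g - emb (gv x)) * D (N * q).
  by rewrite fE (derM hD) (derB hD) (derC hD) Dg subr0 mul1r.
have rDf : reg x (D f) e.
  rewrite DfE -[e]addr0; apply: (pgD gx) => //; exact: (der_vanish gw hC hsm hD Dg Cx).
split=> //.
  by rewrite fE mulrC; apply: (regM0 gw Cx).
move=> nu; have uq := S4 ax nu.
have jg : jet x (q - emb (vl x q)) g = 0.
  apply: contrapT => /eqP jg; apply: nu; rewrite -(vlE gw Cx g0).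
  by apply/(jet_unif gw Cx uq) => //; exists (gv x).
(* At a ramification point g has zero jet, hence so has every polynomial in g; the product with q
   then inherits the nonzero jet of q. *)
have jN s : jet x (q - emb (vl x q)) (M s) = 0.
  elim: s => [|c s IH]; first by rewrite /M big_nil -(rmorph1 emb) (jetC gw Cx).
  have dM : dom (reg x) (M s) by eexists; exact: regM.
  have dg : dom (reg x) g by exists (gv x).
  have dc : dom (reg x) (emb (- c)) by exact: (domC gw).
  have -> : M (c :: s) = (g + emb (- c)) * M s by rewrite /M big_cons rmorphN.
  rewrite (jetM gw Cx uq (domD gw Cx dg dc) dM) IH mulr0 addr0.
  by rewrite (jetD gw Cx uq dg dc) jg (jetC gw Cx) addr0 mul0r.
have jq : jet x (q - emb (vl x q)) q != 0 by apply/(jet_unif gw Cx uq (dq ax)).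
have ut : uniformizer x (N * q - emb e).
  rewrite -(vlE gw Cx rw); apply/(jet_unif gw Cx uq dw).
  rewrite (jetM gw Cx uq dN (dq ax)) jN mul0r add0r mulf_neq0 // (vlE gw Cx rN).
  exact: rem_neq0.
set t := N * q - emb e in ut.
have Dt : D (N * q) = D t by rewrite /t (derB hD) (derC hD) subr0.
have [|[|m] [u [d [d0 ud gE]]]] := unif_order gw Cx ut _ (g_nonconst hD Dg (gv x)); first by exists 0.
  rewrite expr0 mul1r in gE; rewrite gE in t0.
  by move: d0; rewrite (pg_fun gx ud t0) eqxx.
have u0 := pg_neq0 gx ud d0; have tn := unif_neq0 ut.
have m0 := natK_neq0 emb m.
(* With ramification index m + 1, differentiating g - c = t^(m+1) u shows that (g - c) D t is
   t/(m+1) up to a factor of value 1. So f' minus its value is t times a unit of value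
   (m+2)/(m+1). *)
have id1 : 1 = m.+1%:R * t ^+ m * D t * u + t ^+ m.+1 * D u.
  have : D (g - emb (gv x)) = 1 by rewrite (derB hD) (derC hD) Dg subr0.
  by rewrite gE (derM hD) (derX hD) /= => e1; rewrite -[LHS]e1 -mulr_natl mulrA.
have -> : D f - emb e = t * (1 + m.+1%:R^-1 * (1 - u^-1 * ((g - emb (gv x)) * D u))).
  rewrite DfE Dt.
  have -> : (g - emb (gv x)) * D t = t * (m.+1%:R^-1 * (m.+1%:R * t ^+ m * D t * u)).
    by rewrite gE exprS; move: (m.+1%:R : K) m0 => mm m0; field.
  have -> : u^-1 * ((g - emb (gv x)) * D u) = t ^+ m.+1 * D u by rewrite gE; field.
  have -> : m.+1%:R * t ^+ m * D t * u = 1 - t ^+ m.+1 * D u by rewrite [X in X - _]id1 addrK.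
  by rewrite /t; ring.
apply: (unif_mul gw Cx ut (c := 1 + m.+1%:R^-1 * (1 - d^-1 * 0))).
  apply: (pgD gx); first exact: (pg11 gx).
  apply: (pgM gx); first by rewrite -(rmorph_nat emb) -fmorphV; exact: (pgC gx).
  apply: (pgB gx); first exact: (pg11 gx).
  apply: (pgM gx); first exact: reg_local.
  by apply: (der_vanish gw hC hsm hD Dg Cx) => //; exists d.
have n0 : m.+1%:R != 0 :> k by rewrite pnatr_eq0.
rewrite mulr0 subr0 mulr1.
have -> : 1 + m.+1%:R^-1 = m.+2%:R / m.+1%:R :> k by rewrite [in RHS]mulrS mulrDl divff // mul1r addrC.
by rewrite mulf_neq0 ?invr_eq0 // pnatr_eq0.
Qed.

Let finite_case x : aff x -> exists e p, [/\ reg x f e, reg x (D f) p &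
  uniformizer x (g - emb (gv x)) \/ uniformizer x (D f - emb p)].
Proof.
move=> ax; have [cx|cx] := boolP (gv x \in cs).
  have [rf rD uD] := branched ax cx; do 2!eexists; split; [exact: rf|exact: rD|].
  by have [u|/uD u] := pselect (uniformizer x (g - emb (gv x))); [left|right].
have [df dD _ _ _] := unbranched (conj ax cx); have [Cx _ bx] := ax.
do 2!eexists; split; [exact: (vl_reg gw Cx df)|exact: (vl_reg gw Cx dD)|left].
by apply: contrapT => nu; move/negP: cx; apply; exact: csP.
Qed.

Let finite_inj x y e p : aff x -> aff y -> gv x = gv y -> reg x f e -> reg y f e ->
  reg x (D f) p -> reg y (D f) p -> x = y.
Proof.
move=> ax ay gg rx ry dx dy; apply: contrapT => xy.
have [Cx _ bx] := ax; have [Cy _ yb] := ay.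
have gx := reg_graph gw Cx; have gy := reg_graph gw Cy.
have [cx|cx] := boolP (gv x \in cs).
  have cy : gv y \in cs by rewrite -gg.
  have [_ rDx _] := branched ax cx; have [_ rDy _] := branched ay cy.
  apply: (S3 ax ay gg cx xy); apply: (mulfI (rem_neq0 (gv x))).
  by rewrite -(pg_fun gx dx rDx) (pg_fun gy dy rDy) gg.
have cy : gv y \notin cs by rewrite -gg.
have [_ _ fx n0 Dx] := unbranched (conj ax cx); have [_ _ fy _ Dy] := unbranched (conj ay cy).
have eq : vl x q = vl y q.
  apply: (mulfI n0); rewrite -fx gg -fy.
  by rewrite (vlE gw Cx rx) (vlE gw Cy ry).
apply: (S5 (conj ax cx) (conj ay cy) gg xy eq).
have : vl x (D f) = vl y (D f) by rewrite (vlE gw Cx dx) (vlE gw Cy dy).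
rewrite Dx Dy (M_der _ (conj ax cx) (conj ay cy) gg) eq -gg => /addrI.
exact: mulfI.
Qed.

Let h_neq0 x : C x -> ev b (rep x) = 0 -> ev h (rep x) != 0.
Proof. by move=> Cx bx; apply/eqP => hx; have := hb0 Cx hx; rewrite bx eqxx. Qed.

Let infinite_case x : C x -> ev b (rep x) = 0 ->
  pval x (vec4 [:: 0; 2%:R^-1 * (l2 * iv x); 1; 0]) /\
  immersed x (vec4 [:: 0; 2%:R^-1 * (l2 * iv x); 1; 0]).
Proof.
move=> Cx bx; have gx := reg_graph gw Cx; have hx := h_neq0 Cx bx.
have gi : g^-1 = evK b / evK a by rewrite /g invf_div.
have ui : uniformizer x g^-1 by rewrite gi; exact: b_unif.
have g0 : g != 0 by rewrite /g mulf_neq0 ?invr_eq0.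
pose P := \prod_(c <- cs) (1 - emb c * g^-1).
(* This is f/g rewritten in terms of 1/g; [P] is the branch polynomial divided by its leading power
   of g, with value 1 here. *)
pose om := P * ((emb l1 * g^-1 + emb l2) * (evK L0 / evK h) + g^-1 * (evK L1 / evK h)) *
  (evK a / evK h) ^+ size cs.
apply: (infinite_point gw hC hsm hD Dg Cx (om := om)) => //; first exact: unif0.
- rewrite /f /q /psi /r /om.
  have -> : M cs = g ^+ size cs * P.
    rewrite /M /P; elim: (cs) => [|c s IH]; first by rewrite !big_nil mulr1.
    by rewrite !big_cons IH /= exprS; field.
  have -> : evK a / evK h = g * (evK b / evK h) by rewrite mulrA divfK.
  rewrite (exprMn _ g) exprS; move: (g ^+ size cs) ((evK b / evK h) ^+ size cs) (P) => G B P1.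
  by field; rewrite bn hn g0.
- have hc c : reg x (emb c) c by exact: (pgC gx).
  have r0 := unif0 ui.
  have rP : reg x P 1.
    rewrite /P; elim: (cs) => [|c s IH]; first by rewrite big_nil; exact: (pg11 gx).
    rewrite big_cons -[X in reg _ _ X]mulr1; apply: (pgM gx) => //.
    rewrite -[X in reg _ _ X](subr0 1) -(mulr0 c); apply: (pgB gx); first exact: (pg11 gx).
    exact: (pgM gx).
  have -> : l2 * iv x = 1 * ((l1 * 0 + l2) * (ev L0 (rep x) / ev h (rep x)) +
      0 * (ev L1 (rep x) / ev h (rep x))) * (ev a (rep x) / ev h (rep x)) ^+ size cs.
    by rewrite /iv; ring.
  have rr u : u \is 1.-homog -> reg x (evK u / evK h) (ev u (rep x) / ev h (rep x)).
    by move=> hu; exact: (reg_frac emb w hu hh hx).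
  apply: (pgM gx); last by apply: (pgX _ gx); exact: rr.
  apply: (pgM gx) => //; apply: (pgD gx); apply: (pgM gx) => //; try exact: rr.
  by apply: (pgD gx) => //; exact: (pgM gx).
Qed.

(** The poles come from the powers of b/h alone; the linear part [Y] is a unit by the choice of l1,
    and the branch polynomial has at most a simple zero here, since its roots are distinct and g is
    unramified. *)
Lemma lift_pole x : C x -> ev h (rep x) = 0 -> exists N u d,
  [/\ f * (g - emb (gv x)) ^+ N.+1 = u, reg x u d & d != 0].
Proof.
move=> Cx hx; have gx := reg_graph gw Cx; have bx := hb0 Cx hx; have ut := h_unif Cx hx.
set t := g - emb (gv x) in ut *; have tn := unif_neq0 ut.
pose m := (gv x \in cs) : nat; pose s := rem (gv x) cs.
have ME : M cs = t ^+ m * M s.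
  rewrite /m /s; have [cx|cx] := boolP (gv x \in cs); first by rewrite expr1 (factor_cs cx).
  by rewrite expr0 mul1r rem_id.
have s0 : \prod_(d <- s) (gv x - d) != 0 by exact: rem_neq0.
pose Y := (emb l1 + emb l2 * g) * (evK L0 / evK b) + evK L1 / evK b.
have rL u : u \is 1.-homog -> reg x (evK u / evK b) (ev u (rep x) / ev b (rep x)).
  by move=> hu; exact: (reg_frac emb w hu hb bx).
have rY : reg x Y (((l1 + l2 * gv x) * ev L0 (rep x) + ev L1 (rep x)) / ev b (rep x)).
  rewrite mulrDl -mulrA; apply: (pgD gx); last exact: rL.
  apply: (pgM gx); last exact: rL.
  apply: (pgD gx); first exact: (pgC gx).
  by apply: (pgM gx); [exact: (pgC gx)|exact: rg].
have Y0 : ((l1 + l2 * gv x) * ev L0 (rep x) + ev L1 (rep x)) / ev b (rep x) != 0.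
  by rewrite mulf_neq0 ?invr_eq0 // S1.
have reta : reg x (evK h / evK b) 0 by have := rL h hh; rewrite hx mul0r.
have eta0 : evK h / evK b != 0 by rewrite mulf_neq0 ?invr_eq0.
have [|[|e] [u0 [d0 [d00 ud0 etaE]]]] := unif_order gw Cx ut _ eta0; first by exists 0.
  rewrite expr0 mul1r in etaE; rewrite etaE in reta.
  by move: d00; rewrite (pg_fun gx ud0 reta) eqxx.
have un := pg_neq0 gx ud0 d00.
(* A possible simple zero of the branch polynomial cannot cancel the pole, because [r] is at least 2
   when [cs] is nonempty. *)
have mr : (m < e.+1 * r)%N.
  by apply: (@leq_trans r); [rewrite /m /r; case: (_ \in _)|rewrite leq_pmull].
have [N NE] : exists N, (e.+1 * r = N.+1 + m)%N.
  by exists (e.+1 * r - m).-1; rewrite prednK ?subn_gt0 // subnK // ltnW.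
exists N; do 2!eexists; split; [by []| |]; last first.
  exact: (mulf_neq0 (mulf_neq0 s0 Y0) (expf_neq0 r (invr_neq0 d00))).
have -> : f * t ^+ N.+1 = M s * Y * u0^-1 ^+ r.
  have -> : f = t ^+ m * M s * Y * (evK h / evK b)^-1 ^+ r.
    rewrite /f /q /psi ME invf_div; move: (_ ^+ r) (t ^+ m) (M s) => B T S.
    by rewrite /Y; ring.
  have XE (y z : K) j : (y * z)^-1 ^+ j = (y ^+ j)^-1 * z^-1 ^+ j by rewrite invfM exprMn !exprVn.
  rewrite etaE XE -exprM NE exprD.
  have := expf_neq0 m tn; have := expf_neq0 N.+1 tn.
  move: (t ^+ N.+1) (t ^+ m) (_ ^+ r) (M s) => T1 T2 B S T10 T20; field; by rewrite T10 T20.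
apply: (pgM gx); last by apply: (pgX _ gx); exact: reg_local.
by apply: (pgM gx) => //; exact: regM.
Qed.

Let kind x v := [\/ aff x /\ exists e p, [/\ reg x f e, reg x (D f) p &
      v = vec4 [:: 1; e - 2%:R^-1 * gv x * p; gv x; 2%:R^-1 * p]],
    ev b (rep x) = 0 /\ v = vec4 [:: 0; 2%:R^-1 * (l2 * iv x); 1; 0] |
    ev h (rep x) = 0 /\ v = vec4 [:: 0; - gv x; 0; 1]].

Let two0 : 2%:R^-1 != 0 :> k. Proof. by rewrite invr_eq0 pnatr_eq0. Qed.

Let kinds x : C x -> exists v, [/\ v != 0, pval x v, immersed x v & kind x v].
Proof.
move=> Cx; have [bx|bx] := eqVneq (ev b (rep x)) 0.
  have [pv iv'] := infinite_case Cx bx; eexists; split; [|exact: pv|exact: iv'|by apply: Or32].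
  by apply/eqP => /rowP/(_ 2%:R); rewrite !mxE /= => /eqP; rewrite oner_eq0.
have [hx|hx] := eqVneq (ev h (rep x)) 0.
  have [N [u [d [fE ud d0]]]] := lift_pole Cx hx.
  have [pv iv'] := pole_point gw hC hsm hD Dg Cx (h_unif Cx hx) fE ud d0.
  eexists; split; [|exact: pv|exact: iv'|by apply: Or33].
  by apply/eqP => /rowP/(_ 3%:R); rewrite !mxE /= => /eqP; rewrite oner_eq0.
have ax : aff x by [].
have [e [p [re rp u]]] := finite_case ax.
exists (vec4 [:: 1; e - 2%:R^-1 * gv x * p; gv x; 2%:R^-1 * p]); split.
- by apply/eqP => /rowP/(_ 0); rewrite !mxE /= => /eqP; rewrite oner_eq0.
- exact: (pval_finite gw Cx (rg Cx bx)).
- by apply: immersed_finite => //; exact: rg.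
- by apply: Or31; split=> //; exists e, p.
Qed.

(** The zero coordinates tell the three kinds apart. Within a kind a coordinate equal to 1 forces s
    = 1, and the separation hypothesis for that kind concludes. *)
Let kind_inj x y v s : C x -> C y -> s != 0 -> kind x v -> kind y (s *: v) -> x = y.
Proof.
move=> Cx Cy s0; case=> [[ax [e [p [re rp ->]]]]|[bx ->]|[hx ->]];
  case=> [[ay [e' [p' [re' rp' /rowP E]]]]|[yb /rowP E]|[hy /rowP E]];
  have := E 0; have := E 1; have := E 2%:R; have := E 3%:R; rewrite !mxE /= ?mulr0 ?mulr1 => E3 E2 E1 E0.
- rewrite E0 !mul1r in E3 E2 E1.
  have {}E3 := mulfI two0 E3; rewrite E3 E2 in E1; move/addIr: E1 => E1.
  by apply: (finite_inj ax ay E2 re _ rp); rewrite ?E1 ?E3.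
- by move: s0; rewrite E0 eqxx.
- by move: s0; rewrite E0 eqxx.
- by move/eqP: E0; rewrite eq_sym oner_eq0.
- apply: contrapT => xy; move: E1; rewrite E2 mul1r => /(mulfI two0)/(mulfI l20) e.
  by move/eqP: (S2 Cx Cy bx yb xy).
- by move: s0; rewrite E2 eqxx.
- by move/eqP: E0; rewrite eq_sym oner_eq0.
- by move: s0; rewrite E3 eqxx.
- apply: contrapT => xy; move: E1; rewrite E3 mul1r => /oppr_inj e.
  by move/eqP: (h_inj Cx Cy hx hy xy).
Qed.

Lemma lift_inj x y v : C x -> C y -> v != 0 -> pval x v -> pval y v -> x = y.
Proof.
move=> Cx Cy v0 pv pv'.
have [vx [x0 px _ kx]] := kinds Cx; have [vy [y0 py _ ky]] := kinds Cy.
have [s s0 sE] := pval_uniq gw Cx x0 v0 px pv; have [s' s'0 s'E] := pval_uniq gw Cy v0 y0 pv' py.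
apply: (kind_inj Cx Cy (s := s' * s) _ kx); first by rewrite mulf_neq0.
by rewrite -scalerA -sE -s'E.
Qed.

Lemma lift_imm x : C x -> exists v A B,
  [/\ v != 0, pval x v, A \is 1.-homog, B \is 1.-homog &
  [/\ ev A v = 0, ev B v != 0 & uniformizer x (mmap emb Phi A / mmap emb Phi B)]].
Proof. by move=> Cx; have [v [v0 pv [A [B [hA hB A0 B0 u]]] _]] := kinds Cx; exists v, A, B. Qed.

End Lift.

(** What later arguments require of f and g. The last field, a pole of f at an unramified point of
    g, is kept for the nonvanishing of the third derivative. *)
Record legendrian_lift (k : numClosedFieldType) n (K : fieldType) (emb : {rmorphism k -> K})
    (w : 'I_n.+1 -> K) (C : set (proj k n)) (D : K -> K) (g f : K) : Prop := LegendrianLift {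
  lift_der : derivation emb D;
  lift_g : D g = 1;
  lift_injective : forall x y v, C x -> C y -> v != 0 ->
    pval emb w (contact_lift D g f) x v -> pval emb w (contact_lift D g f) y v -> x = y;
  lift_immersive : forall x, C x -> exists v A B,
    [/\ v != 0, pval emb w (contact_lift D g f) x v, A \is 1.-homog, B \is 1.-homog &
    [/\ ev A v = 0, ev B v != 0 & uniformizer emb w x
      (mmap emb (contact_lift D g f) A / mmap emb (contact_lift D g f) B)]];
  lift_polar : exists x c N u d, [/\ C x, uniformizer emb w x (g - emb c),
    f * (g - emb c) ^+ N.+1 = u, reg emb w x u d & d != 0] }.

Lemma exists_lift (k : numClosedFieldType) n (K : fieldType) (emb : {rmorphism k -> K})
    (w : 'I_n.+1 -> K) (C : set (proj k n)) :
  generic C emb w -> curve C -> smooth C -> exists D g f, legendrian_lift emb w C D g f.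
Proof.
move=> gw hC hsm.
have [h [a [b [[hh ha hb] [[p Cp hp] hfin hb0 [h_inj h_unif ab0 b_unif]]]]]] := exists_pencil gw hC hsm.
have bp := hb0 p Cp hp.
have bn : mmap emb w b != 0 by apply: (gen_neq0 gw _ Cp bp); exists 1%N.
have gc := unif_nonconstant gw Cp (h_unif p Cp hp).
have an : mmap emb w a != 0.
  by apply: contraNneq (gc 0) => ->; rewrite mul0r rmorph0.
have hn : mmap emb w h != 0.
  apply/eqP => h0; apply: (curve_infinite hC); apply: sub_finite_set hfin => x Cx; split=> //.
  by apply: (gen_vanish gw _ h0 Cx); exists 1%N.
have [D [hD Dg]] := der_normalize gw hC hsm gc.
set g := mmap emb w a / mmap emb w b in h_unif gc Dg.
pose gv x := ev a (rep x) / ev b (rep x).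
have fR := finite_image gv (unram_finite gw hC hsm hD Dg).
have [s0 sE] := (finite_seqP _).1 fR.
(* The value 0 is added to ensure a nonempty list, hence an exponent of at least 2; duplicates are
   removed so that the branch polynomial has simple roots. *)
pose cs := undup (0 :: s0).
have csU : uniq cs by exact: undup_uniq.
have cs0 : (0 < size cs)%N.
  by rewrite lt0n size_eq0; apply/eqP => e; have : 0 \in cs; [rewrite mem_undup mem_head|rewrite e].
have csP x : C x -> ev b (rep x) != 0 -> ~ uniformizer emb w x (g - emb (gv x)) -> gv x \in cs.
  move=> Cx bx nu; rewrite mem_undup inE; apply/orP; right.
  have : [set` s0] (gv x); last by [].
  rewrite -sE; exists x => //; split=> // - [c uc]; apply: nu.
  have -> : gv x = c; last by [].
  have gx := reg_graph gw Cx; apply: (pg_fun gx (reg_pencil emb w ha hb Cx bx)).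
  by have := pgD gx (unif0 uc) (pgC gx c); rewrite subrK add0r.
have [L0 [L1 [l1 [l2 [[hL0 hL1 l20] [S1 S2 [S3 S4 S5]]]]]]] :=
  exists_projection gw hC hsm hh ha hb hfin hb0 ab0 bn hD Dg (size cs).+1 csP (size cs).
exists D, g, ((\prod_(c <- cs) (g - emb c)) * ((emb l1 + emb l2 * g) * psi emb w h b (size cs).+1 L0 +
  psi emb w h b (size cs).+1 L1)); split=> //.
- exact: (lift_inj gw hC hsm hh ha hb hb0 bn hn an h_inj h_unif b_unif hD Dg cs0 csU csP hL0 hL1 l20 S1 S2 S3 S4 S5).
- exact: (lift_imm gw hC hsm hh ha hb hb0 bn hn an h_unif b_unif hD Dg cs0 csU csP hL0 hL1 S1 S4).
- have [N [u [d [fE ud d0]]]] := lift_pole gw hh ha hb hb0 bn hn h_unif cs0 csU hL0 hL1 S1 Cp hp.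
  by exists p, (gv p), N, u, d; split=> //; exact: h_unif.
Qed.

(** * Legendrian curves *)

Lemma sum_ord4 (V : nmodType) (F : 'I_4 -> V) : \sum_i F i = F 0 + F 1 + F 2%:R + F 3%:R.
Proof.
rewrite !big_ord_recl big_ord0 addr0 !addrA.
by congr (_ + F _ + F _ + F _); exact: val_inj.
Qed.

Section StandardForm.
Variable k : fieldType.

Definition symplectic : 'M[k]_4 := \matrix_(i, j)
  (if (i == 0) && (j == 1) || (i == 2%:R) && (j == 3%:R) then 1
   else if (i == 1) && (j == 0) || (i == 3%:R) && (j == 2%:R) then -1 else 0).

Lemma mul_symplectic (v : 'rV[k]_4) :
  v *m symplectic = vec4 [:: - v 0 1; v 0 0; - v 0 3%:R; v 0 2%:R].
Proof.
apply/rowP; apply: forall_ord4; rewrite !mxE sum_ord4 !mxE /=; by ring.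
Qed.

Lemma bform_symplectic (v u : 'rV[k]_4) : bform symplectic v u =
  v 0 0 * u 0 1 - v 0 1 * u 0 0 + v 0 2%:R * u 0 3%:R - v 0 3%:R * u 0 2%:R.
Proof.
by rewrite /bform mul_symplectic !mxE sum_ord4 !mxE /=; ring.
Qed.

Lemma symplectic_contact : contact_form symplectic.
Proof.
split=> [v u|v v0]; first by rewrite !bform_symplectic; ring.
apply/rowP; apply: forall_ord4; rewrite mxE.
- have := v0 (delta_mx 0 1); rewrite bform_symplectic !mxE /= => /eqP.
  by rewrite !(mulr0, mulr1, subr0, sub0r, addr0, add0r, oppr0, oppr_eq0) => /eqP.
- have := v0 (delta_mx 0 0); rewrite bform_symplectic !mxE /= => /eqP.
  by rewrite !(mulr0, mulr1, subr0, sub0r, addr0, add0r, oppr0, oppr_eq0) => /eqP.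
- have := v0 (delta_mx 0 3%:R); rewrite bform_symplectic !mxE /= => /eqP.
  by rewrite !(mulr0, mulr1, subr0, sub0r, addr0, add0r, oppr0, oppr_eq0) => /eqP.
- have := v0 (delta_mx 0 2%:R); rewrite bform_symplectic !mxE /= => /eqP.
  by rewrite !(mulr0, mulr1, subr0, sub0r, addr0, add0r, oppr0, oppr_eq0) => /eqP.
Qed.

Lemma symplectic_sqr : symplectic *m symplectic = - 1%:M.
Proof.
apply/row_matrixP => i; rewrite row_mul mul_symplectic.
move: i; apply: forall_ord4; apply/rowP; apply: forall_ord4; rewrite !mxE /=; by rewrite ?oppr0 ?opprK.
Qed.

Lemma symplectic_unit : symplectic \in unitmx.
Proof.
have /mulmx1_unit[] // : symplectic *m (- symplectic) = 1%:M.
by rewrite mulmxN symplectic_sqr opprK.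
Qed.

End StandardForm.

Section ContactHyperplane.
Variables (k : numClosedFieldType) (B : 'M[k]_4).

(** The line through y in the direction u lies in the hyperplane. A form vanishing on the hyperplane
    restricts to the zero polynomial on the line, and the derivative of the restriction at s = 0
    pairs the gradient with u. *)
Lemma contact_hyperplane_perp (y : proj k 3) (u : 'rV[k]_4) : bform B (rep y) (rep y) = 0 ->
  bform B (rep y) u = 0 -> contact_hyperplane B y u.
Proof.
move=> yy yu F hF F0.
have bl s : bform B (rep y) (rep y + s *: u) = 0.
  have -> : bform B (rep y) (rep y + s *: u) = bform B (rep y) (rep y) + s * bform B (rep y) u.
    by rewrite /bform linearD linearZ /= mulmxDr -scalemxAr !mxE.
  by rewrite yy yu mulr0 addr0.
pose l i := (rep y 0 i)%:P + (u 0 i)%:P * 'X : {poly k}.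
have lE s G : (mmap polyC l G).[s] = ev G (rep y + s *: u).
  elim/mpoly_ring_ind: G => [c|i|G H HG HH|G H HG HH].
  - by rewrite mmapC hornerC /ev mevalC.
  - by rewrite mmapX mmap1U evXU !mxE !hornerE mulrC.
  - by rewrite mmapD hornerD HG HH evD.
  - by rewrite rmorphM hornerM HG HH evM.
have p0 : mmap polyC l F = 0.
  apply: contrapT => /eqP pn; apply: (@infinite_numClosed k).
  (* For at most one s does the vector fail to span a point, and there the vanishing of F says
     nothing. *)
  have fS : finite_set [set s | rep y + s *: u = 0].
    have [u0|/rV0Pn[j uj]] := eqVneq u 0.
      apply: (@sub_finite_set _ _ set0) => // s /=; rewrite u0 scaler0 addr0 => /eqP.
      by rewrite (negPf (rep_neq0 y)).
    apply: (sub_finite_set _ (finite_set1 (- rep y 0 j / u 0 j))) => s /= /rowP/(_ j).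
    by rewrite !mxE => /eqP; rewrite addrC addr_eq0 => /eqP <-; rewrite mulfK.
  have fin := conj (finite_roots pn) fS; rewrite -finite_setU in fin.
  apply: sub_finite_set fin => s _.
  have [e|/exists_point[x xE]] := eqVneq (rep y + s *: u) 0; [by right|left].
  rewrite /= lE; have [d hd] := hF; have [t t0 xt] := rep_val xE.
  have : ev F (rep x) = 0.
    by apply: F0; rewrite /perp /= xt /bform linearZ /= -scalemxAr mxE -/(bform _ _ _) bl mulr0.
  rewrite xt (ev_scale _ _ hd) => /eqP; rewrite mulf_eq0 (negPf (expf_neq0 _ t0)) /= => /eqP //.
have := congr1 (fun p : {poly k} => p^`().[0]) p0.
rewrite /= deriv0 horner0 (@leibniz_mmap _ _ _ (@deriv k) _ _ _ (@derivD _) (@derivM _) (@derivC _)).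
rewrite horner_sum => e; rewrite -[RHS]e; apply: eq_bigr => i _.
rewrite hornerM lE scale0r addr0 derivD derivM !derivC derivX.
by rewrite mul0r !add0r mulr1 hornerC.
Qed.

End ContactHyperplane.

Section Legendrian.
Variables (k : numClosedFieldType) (n : nat) (K : fieldType) (emb : {rmorphism k -> K}).
Variables (w : 'I_n.+1 -> K) (C : set (proj k n)) (D : K -> K) (g f : K).
Hypotheses (gw : generic C emb w) (hC : curve C) (hsm : smooth C).
Hypothesis lift : legendrian_lift emb w C D g f.
Local Notation Phi := (contact_lift D g f).
Local Notation reg := (reg emb w).
Local Notation uniformizer := (uniformizer emb w).
Local Notation E := (image_curve emb w C Phi).
Local Notation B := (symplectic k).
Let hD := lift_der lift.
Let Dg := lift_g lift.

Lemma lift_neq0 : exists j, Phi j != 0.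
Proof. by exists 0; rewrite oner_neq0. Qed.

Let imE := lift_injective lift.
Let iE := lift_immersive lift.
Let nE := lift_neq0.

Lemma lift_curve : curve E.
Proof. exact: (image_curve_curve gw hC hsm nE imE). Qed.

Lemma lift_isomorphic : isomorphic C E.
Proof. exact: (image_isomorphic gw hC hsm nE imE iE). Qed.

Lemma lift_generic : generic E emb Phi.
Proof. exact: (image_generic gw hC hsm nE imE iE). Qed.

(** The plane of tangent vectors is spanned by [rep y] and by [v1], the value of the scaled
    derivative of the coordinates. The two are independent because a quotient of linear forms is a
    local parameter, so its scaled derivative does not vanish at x. *)
Lemma lift_legendrian : legendrian B E.
Proof.
move=> y Ey [d [V [dim VE Vd]]] u /VE uV.
have {}Vd : \dim V = 2 by have [_ _ d1] := lift_curve; rewrite Vd (dimension_uniq dim d1).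
have [x Cx [s s0 sy]] := image_rep gw Ey; have gx := reg_graph gw Cx.
have D0 : exists p, D p != 0 by exists g; rewrite Dg oner_neq0.
have [t [r [ut r0 rD rt]]] := der_local gw hC hsm hD D0 Cx.
pose xi i := s * Phi i; pose v1 := \row_i vl emb w x (r * D (xi i)).
have rv1 i : reg x (r * D (xi i)) (v1 0 i).
  by rewrite mxE; apply: (vl_reg gw Cx); apply: rD; exists (rep y 0 i); exact: sy.
have rF F : reg x (r * D (mmap emb xi F)) (\sum_i ev (mderiv i F) (rep y) * v1 0 i).
  rewrite (der_mmap hD) mulr_sumr.
  apply: (@pg_sum _ _ _ (reg x) _ _ xpredT _ (fun i => ev (mderiv i F) (rep y) * v1 0 i) gx) => i _.
  by rewrite mulrCA; apply: (pgM gx) => //; exact: (pg_mmap _ gx).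
have tv1 : tangent E y v1.
  move=> F hF F0; have [j hj] := hF.
  have : mmap emb xi F = 0.
    rewrite (mmap_scale emb Phi s hj).
    by have -> := (image_eq0 gw hC hsm nE hF).2 F0; rewrite mulr0.
  by move=> e; have := rF F; rewrite e (der0 hD) mulr0 => /(pg0 gx).
have ty : tangent E y (rep y).
  move=> F [j hj] F0; have := congr1 (fun G => ev G (rep y)) (euler_homog hj).
  rewrite /= ev_sum => e.
  transitivity (\sum_i ev (mderiv i F * 'X_i) (rep y)).
    by apply: eq_bigr => i _; rewrite evM evXU.
  by rewrite e -mulr_natl evM F0 ?mulr0.
have nl c : v1 <> c *: rep y.
  move=> vc; have [v [A [H [v0 pv hA hH [A0 H0 uA]]]]] := iE Cx.
  have pr : pval emb w Phi x (rep y) by exists s.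
  have [c' c'0 yv] := pval_uniq gw Cx v0 (rep_neq0 y) pv pr.
  have Ay : ev A (rep y) = 0 by rewrite yv (ev_scale _ _ hA) A0 mulr0.
  have Hy : ev H (rep y) != 0 by rewrite yv (ev_scale _ _ hH) mulf_neq0 ?expf_neq0.
  have [e e0 re] := der_unif gw hD Cx ut rD rt uA.
  have : reg x (r * D (mmap emb xi A)) (e * ev H (rep y) + 0).
    have -> : mmap emb xi A = mmap emb Phi A / mmap emb Phi H * mmap emb xi H.
      have Hn : mmap emb Phi H != 0.
        have : mmap emb xi H != 0 by apply: (pg_neq0 gx _ Hy); exact: (pg_mmap _ gx).
        by rewrite (mmap_scale emb Phi s hH) mulf_eq0 negb_or => /andP[].
      by rewrite !(mmap_scale emb Phi s (d := 1)) //; field.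
    rewrite (derM hD) mulrDr mulrA mulrCA; apply: (pgD gx).
      by apply: (pgM gx) => //; exact: (pg_mmap _ gx).
    rewrite mulrC; apply: (regM0 gw Cx); last exact: (unif0 uA).
    by exists (\sum_i ev (mderiv i H) (rep y) * v1 0 i); exact: rF.
  move=> /(pg_fun gx (rF A)); rewrite addr0 => e1.
  have /eqP : e * ev H (rep y) = 0; last by rewrite (negPf (mulf_neq0 e0 Hy)).
  rewrite -e1 vc; transitivity (c * \sum_i ev (mderiv i A * 'X_i) (rep y)).
    by rewrite mulr_sumr; apply: eq_bigr => i _; rewrite evM evXU mxE; ring.
  by rewrite -ev_sum (euler_homog hA) Ay mulr0.
have fr : free [:: rep y; v1].
  rewrite free_cons seq1_free span_seq1; apply/andP; split.
    apply/vlineP => -[c e]; have c0 : c != 0.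
      by apply/eqP => c0; move/eqP: e; rewrite c0 scale0r (negPf (rep_neq0 y)).
    by apply: (nl c^-1); rewrite e scalerA mulVf ?scale1r.
  by apply/eqP => v0; apply: (nl 0); rewrite v0 scale0r.
have VS : V = <<[:: rep y; v1]>>%VS.
  apply/eqP; rewrite eq_sym eqEdim; apply/andP; split.
    by rewrite span_cons span_seq1 subv_add -!memvE; apply/andP; split; apply/VE.
  by rewrite Vd; move: fr; rewrite /free => /eqP ->.
have [a [b ->]] : exists a b, u = a *: rep y + b *: v1.
  move: uV; rewrite VS span_cons span_seq1 => /memv_addP[_ /vlineP[a ->] [_ /vlineP[b ->] ->]].
  by exists a, b.
have yy : bform B (rep y) (rep y) = 0 by rewrite bform_symplectic; ring.
apply: contact_hyperplane_perp => //.
have yv1 : bform B (rep y) v1 = 0.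
  rewrite bform_symplectic.
  have : reg x 0 (rep y 0 0 * v1 0 1 - rep y 0 1 * v1 0 0 + rep y 0 2%:R * v1 0 3%:R -
      rep y 0 3%:R * v1 0 2%:R); last exact: (pg0 gx).
  (* The terms with D s cancel by antisymmetry; what is left is r s^2 times the contact identity of
     [Phi]. *)
  have -> : 0 = xi 0 * (r * D (xi 1)) - xi 1 * (r * D (xi 0)) + xi 2%:R * (r * D (xi 3%:R)) -
      xi 3%:R * (r * D (xi 2%:R)).
    rewrite /xi !(derM hD) /contact_lift /= (derB hD) !(derM hD) (der1 hD) Dg.
    have -> : D 2%:R^-1 = 0 by rewrite -(rmorph_nat emb) -fmorphV (derC hD).
    have two : 2%:R != 0 :> K by exact: (natK_neq0 emb 1).
    by field.
  have t2 i j : reg x (xi i * (r * D (xi j))) (rep y 0 i * v1 0 j) := pgM gx (sy i) (rv1 j).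
  by apply: (pgB gx) => //; apply: (pgD gx) => //; exact: (pgB gx).
have -> : bform B (rep y) (a *: rep y + b *: v1) = a * bform B (rep y) (rep y) + b * bform B (rep y) v1.
  by rewrite !bform_symplectic !mxE; ring.
by rewrite yy yv1 !mulr0 addr0.
Qed.

End Legendrian.

(** * Osculating planes *)

Section LinearForms.
Variables (k : fieldType) (n : nat).

Definition linear_form (u : 'rV[k]_n.+1) : {mpoly k[n.+1]} := \sum_i u 0 i *: 'X_i.

Lemma linear_form_homog u : linear_form u \is 1.-homog.
Proof. by apply: rpred_sum => i _; apply: rpredZ; exact: hom_coord. Qed.

Lemma ev_linear_form u v : ev (linear_form u) v = pairing u v.
Proof. by rewrite ev_sum; apply: eq_bigr => i _; rewrite /ev mevalZ mevalXU. Qed.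

Lemma mmap_linear_form (K : fieldType) (emb : {rmorphism k -> K}) (z : 'I_n.+1 -> K) u :
  mmap emb z (linear_form u) = \sum_i emb (u 0 i) * z i.
Proof. by rewrite rmorph_sum; apply: eq_bigr => i _; rewrite /= mmapZ mmapX mmap1U. Qed.

Definition subst_linear (M : 'M[k]_n.+1) (F : {mpoly k[n.+1]}) : {mpoly k[n.+1]} :=
  mmap (@mpolyC n.+1 k) (fun j => linear_form (col j M)^T) F.

Lemma ev_subst_linear M F (v : 'rV[k]_n.+1) : ev (subst_linear M F) v = ev F (v *m M).
Proof.
rewrite /subst_linear; elim/mpoly_ring_ind: F => [c|i|F G HF HG|F G HF HG].
- by rewrite mmapC /ev !mevalC.
- rewrite mmapX mmap1U ev_linear_form evXU mxE; apply: eq_bigr => j _.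
  by rewrite !mxE mulrC.
- by rewrite mmapD !evD HF HG.
- by rewrite rmorphM !evM HF HG.
Qed.

Lemma subst_linear_hom M F : hom F -> hom (subst_linear M F).
Proof.
move=> [d hF]; exists d; rewrite /subst_linear /mmap.
rewrite big_seq; apply: rpred_sum => m mF.
have <- : mdeg m = d by have /dhomogP := hF; apply.
rewrite mul_mpolyC; apply: rpredZ.
rewrite /mmap1 mdegE; apply: (big_rec2 (fun (e : nat) (H : {mpoly k[n.+1]}) => H \is e.-homog)).
  exact: dhomog1.
move=> i e H _ hH; apply: dhomogM => //.
elim: (m i) => [|j IH]; first by rewrite expr0 dhomog1.
by rewrite exprS -[j.+1]add1n; apply: dhomogM => //; exact: linear_form_homog.
Qed.

Lemma linear_image_closed M (X : set (proj k n)) : M \in unitmx -> zclosed X ->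
  zclosed (linear_image M X).
Proof.
move=> uM cX; apply: zclosed_intro => a na.
have [|z zE] := @exists_point k n (rep a *m invmx M).
  apply/eqP => e; have := rep_neq0 a.
  by rewrite -[rep a](mulmxKV uM) e mul0mx eqxx.
have [t t0 zt] := rep_val zE.
have nz : ~ X z.
  move=> Xz; apply: na; exists z => //.
  by rewrite zt -scalemxAl mulmxKV // vlineZ // -val_rep.
have [F [hF FX Fz]] := zclosed_sep cX nz.
exists (subst_linear (invmx M) F); split; first exact: subst_linear_hom.
  move=> y [x Xx yx]; have [s s0 ys] := rep_val yx; have [d hd] := hF.
  by rewrite ev_subst_linear ys -scalemxAl mulmxK // (ev_scale _ _ hd) FX // mulr0.
rewrite ev_subst_linear; move: Fz; have [d hd] := hF.
by rewrite zt (ev_scale _ _ hd) mulf_eq0 negb_or => /andP[].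
Qed.

End LinearForms.

Section Osculation.
Variables (k : numClosedFieldType) (n : nat) (K : fieldType) (emb : {rmorphism k -> K}).
Variables (w : 'I_n.+1 -> K) (C : set (proj k n)) (D : K -> K) (g f : K).
Hypotheses (gw : generic C emb w) (hC : curve C) (hsm : smooth C).
Hypothesis lift : legendrian_lift emb w C D g f.
Local Notation Phi := (contact_lift D g f).
Local Notation regE := (reg emb Phi).
Local Notation reg := (reg emb w).
Local Notation uniformizer := (uniformizer emb w).
Local Notation vl := (vl emb w).
Local Notation E := (image_curve emb w C Phi).
Local Notation B := (symplectic k).
Let hD := lift_der lift.
Let Dg := lift_g lift.
Let imE := lift_injective lift.
Let iE := lift_immersive lift.
Let nE : exists j, Phi j != 0 := lift_neq0 D g f.
Let cE : curve E := lift_curve gw hC hsm lift.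
Let gE : generic E emb Phi := lift_generic gw hC hsm lift.

Let D0 : exists p, D p != 0. Proof. by exists g; rewrite Dg oner_neq0. Qed.

Lemma third_neq0 : D (D (D f)) != 0.
Proof.
have [x [c [N [u [d [Cx uc fE ud d0]]]]]] := lift_polar lift.
have gx := reg_graph gw Cx.
have [u1 f1 r1] := der_pole gw hC hsm hD Dg Cx uc fE ud.
have [u2 f2 r2] := der_pole gw hC hsm hD Dg Cx uc f1 r1.
have [u3 f3 r3] := der_pole gw hC hsm hD Dg Cx uc f2 r2.
apply/eqP => e; move: f3; rewrite e mul0r => e3.
have : u3 != 0; last by rewrite -e3 eqxx.
by apply: (pg_neq0 gx r3); rewrite !mulf_neq0 // oppr_eq0 pnatr_eq0.
Qed.

(** Two differentiations of a linear relation between the coordinates leave (r3 - r1 g) f'''/2 = 0.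
    As g is not constant, r1 and r3 vanish, and then so do r2 and r0. *)
Lemma lift_nonplanar : ~ exists a : dual_proj k 3, E `<=` hyperplane a.
Proof.
move=> [a Ea]; have hl := linear_form_homog (rep a).
have /(image_eq0 gw hC hsm nE (ex_intro _ 1%N hl)).2 : forall y, E y -> ev (linear_form (rep a)) (rep y) = 0.
  by move=> y /Ea; rewrite ev_linear_form.
rewrite mmap_linear_form sum_ord4 /contact_lift /= mulr1; set r := rep a => e.
have h0 : D 2%:R^-1 = 0 by rewrite -(rmorph_nat emb) -fmorphV (derC hD).
have two : 2%:R != 0 :> K by exact: (natK_neq0 emb 1).
have e1 := congr1 D e; have e2 := congr1 D e1.
have g0 c : g - emb c != 0 := g_nonconst hD Dg c.
have e3 : 2%:R^-1 * D (D (D f)) * (emb (r 0 3%:R) - g * emb (r 0 1)) = 0.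
  rewrite -[RHS](der0 hD) -[X in _ = D X](der0 hD) -e2.
  rewrite !((derD hD), (derB hD), (derCM hD), (derC hD), (derM hD), Dg, h0, der1 hD, der0 hD, derN hD).
  by field.
have e4 : emb (r 0 3%:R) - g * emb (r 0 1) = 0.
  apply/eqP; move/eqP: e3; rewrite !mulf_eq0 invr_eq0 (negPf two) (negPf third_neq0) //.
have r1 : r 0 1 = 0.
  apply: contrapT => /eqP r1; have := g0 (r 0 3%:R / r 0 1); rewrite fmorph_div => /eqP; apply.
  have r1' : emb (r 0 1) != 0 by rewrite fmorph_eq0.
  by apply: (mulIf r1'); rewrite mul0r mulrBl divfK // -[LHS]opprK opprB e4 oppr0.
have r3 : r 0 3%:R = 0.
  by apply/eqP; rewrite -(fmorph_eq0 emb) -e4 r1 rmorph0 mulr0 subr0 eqxx.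
move: e; rewrite r1 r3 rmorph0 !mul0r !addr0 => e.
have r2 : r 0 2%:R = 0.
  have := congr1 D e; rewrite (derD hD) (derC hD) (derCM hD) Dg (der0 hD) add0r mulr1 => /eqP.
  by rewrite fmorph_eq0 => /eqP.
move: e; rewrite r2 rmorph0 mul0r addr0 => /eqP; rewrite fmorph_eq0 => /eqP r0.
have /eqP := rep_neq0 a; apply; apply/rowP; apply: forall_ord4; rewrite mxE; assumption.
Qed.

(** Germs in the definition of osculation are functions of points with arbitrary values away from y;
    agreement with an element of K off a finite set makes the identity principle applicable. *)
Lemma germ_fraction y s : E y -> regular_at E y s -> exists q,
  regE y q (s y) /\ finite_set [set z | E z /\ ~ regE z q (s z)].
Proof.
move=> Ey [U [oU Uy [d [F [G [hF hG FG]]]]]]; exists (mmap emb Phi F / mmap emb Phi G).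
have rz z : E z -> U z -> regE z (mmap emb Phi F / mmap emb Phi G) (s z).
  by move=> Ez Uz; have [Gz ->] := FG z Ez Uz; exact: (reg_frac emb Phi hF hG Gz).
split; first exact: rz.
have [cEz _ _] := cE.
have fin : finite_set (~` U `&` E).
  apply: (curve_proper_finite cE); first exact: zclosedI.
    by move=> z [].
  by move=> H; have [] := H y Ey.
by apply: sub_finite_set fin => z [Ez nz]; split=> // Uz; exact/nz/rz.
Qed.

Lemma lift_point x y y' : C x -> pval emb w Phi x (rep y) -> pval emb w Phi x (rep y') -> y = y'.
Proof.
move=> Cx p p'; have [a _ e] := pval_uniq gw Cx (rep_neq0 y') (rep_neq0 y) p' p; exact: proj_eq e.
Qed.

Definition ordinary x := [/\ exists c, uniformizer x (g - emb c), dom (reg x) f &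
  exists2 d, d != 0 & reg x (D (D (D f))) d].

Lemma ordinary_cofinite : finite_set [set x | C x /\ ~ ordinary x].
Proof.
have f1 := unram_finite gw hC hsm hD Dg.
have f2 := reg_finite gw hC f; have f3 := reg_nz_finite gw hC third_neq0.
have fin := conj f1 (conj f2 f3); rewrite -!finite_setU in fin.
apply: sub_finite_set fin => x [Cx no]; apply: contrapT => /not_orP[n1 /not_orP[n2 n3]].
apply: no; split; apply: contrapT => H; [exact: n1|exact: n2|exact: n3].
Qed.

Section AtOrdinary.
Variables (x : proj k n) (y : proj k 3) (c : k).
Hypotheses (Cx : C x) (pxy : pval emb w Phi x (rep y)) (ug : uniformizer x (g - emb c)).
Hypotheses (df : dom (reg x) f) (dl : exists2 d, d != 0 & reg x (D (D (D f))) d).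
Let gx := reg_graph gw Cx.
Let t := g - emb c.

Let dD p : dom (reg x) p -> dom (reg x) (D p).
Proof. exact: (unram_dom gw hC hsm hD D0 Dg Cx ug). Qed.

Let gc : reg x g c.
Proof. by have := pgD gx (unif0 ug) (pgC gx c); rewrite subrK add0r. Qed.

Let dt : dom (reg x) t. Proof. by exists 0; exact: unif0. Qed.

Let Dt : D t = 1. Proof. by rewrite /t (derB hD) (derC hD) Dg subr0. Qed.

(** As D t = 1 and D preserves the local ring, the three values are the first Taylor coefficients in
    [t] up to factorials. Division by [t] is performed one step at a time, dividing by 2 at the
    second. *)
Lemma order_three q : dom (reg x) q ->
  ((exists2 u, dom (reg x) u & q = t ^+ 3 * u) <->
   [/\ reg x q 0, reg x (D q) 0 & reg x (D (D q)) 0]).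
Proof.
move=> dq; have tn : t != 0 := unif_neq0 ug.
have v0 u : dom (reg x) u -> reg x (t * u) 0.
  by move=> du; rewrite mulrC; apply: (regM0 gw Cx) => //; exact: unif0.
have dn m : dom (reg x) m%:R by rewrite -(rmorph_nat emb); exact: (domC gw).
split=> [[u du ->]|[q0 q1 q2]].
  have du1 := dD du; have du2 := dD du1.
  split; first by rewrite exprS -mulrA; apply: v0; apply: (domM gw) => //; exact: (domX gw).
    have -> : D (t ^+ 3 * u) = t * (t * (3%:R * u + t * D u)).
      by rewrite (derM hD) (derX hD) Dt /= -mulr_natl; ring.
    by apply: v0; apply: (domM gw) => //; apply: (domD gw) => //; apply: (domM gw).
  have -> : D (D (t ^+ 3 * u)) = t * (6%:R * u + 6%:R * t * D u + t ^+ 2 * D (D u)).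
    rewrite !exprS expr0 mulr1 !((derM hD), (derD hD), Dt, der1 hD, der0 hD, mulr1, mul1r).
    by ring.
  apply: v0; do ?[apply: (domD gw) => //|apply: (domM gw) => //|exact: (domX gw)].
have [w1 r1] := unif_div ug q0; have qE : q = t * (q / t) by rewrite mulrC divfK.
set u1 := q / t in r1 qE; have d1 : dom (reg x) u1 by exists w1.
have {}r1 : reg x u1 0.
  have -> : u1 = D q - t * D u1 by rewrite qE (derM hD) Dt; ring.
  by rewrite -[X in reg _ _ X](subrr 0); apply: (pgB gx) => //; apply: v0; exact: dD.
have [w2 r2] := unif_div ug r1; have u1E : u1 = t * (u1 / t) by rewrite mulrC divfK.
set u2 := u1 / t in r2 u1E; have d2 : dom (reg x) u2 by exists w2.
have two : 2%:R != 0 :> K by exact: (natK_neq0 emb 1).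
have {}r2 : reg x u2 0.
  have -> : u2 = emb 2%:R^-1 * (D (D q) - t * (4%:R * D u2 + t * D (D u2))).
    rewrite qE u1E fmorphV rmorph_nat.
    rewrite !((derM hD), (derD hD), Dt, der1 hD).
    by field; rewrite tn two.
  rewrite -[X in reg _ _ X](mulr0 2%:R^-1); apply: (pgM gx); first exact: (pgC gx).
  rewrite -[X in reg _ _ X](subrr 0); apply: (pgB gx) => //; apply: v0.
  have du := dD d2; have ddu := dD du.
  by apply: (domD gw) => //; apply: (domM gw).
have [w3 r3] := unif_div ug r2; exists (u2 / t); first by exists w3.
by rewrite qE u1E; field.
Qed.

Let vdata : exists p q m l, [/\ reg x f p, reg x (D f) q, reg x (D (D f)) m,
  reg x (D (D (D f))) l & l != 0].
Proof.
have [p fp] := df; have [q fq] := dD df; have [m fm] := dD (dD df); have [l l0 fl] := dl.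
by exists p, q, m, l.
Qed.

(** The vanishing of the form and of its first two derivatives is a triangular linear system for
    [r]: since f''' does not vanish at x, the second derivative gives r3, the first r2 and the form
    itself r0 in terms of r1. The solution line is spanned by the skew-orthogonal plane of y. *)
Lemma osculating_form (r : 'rV[k]_4) : dom (reg x) (mmap emb Phi (linear_form r)) /\
  ((exists2 u, dom (reg x) u & mmap emb Phi (linear_form r) = t ^+ 3 * u) <->
   exists s, r = s *: (rep y *m B)).
Proof.
have [p [q [m [l [fp fq fm fl l0]]]]] := vdata.
have pv := pval_finite gw Cx gc fp fq.
set v := vec4 _ in pv.
have vn : v != 0.
  by apply/eqP => /rowP/(_ 0); rewrite !mxE /= => /eqP; rewrite oner_eq0.
have [a a0 yE] := pval_uniq gw Cx vn (rep_neq0 y) pv pxy.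
pose hk : k := 2%:R^-1; pose hf := emb hk.
have hfE : 2%:R^-1 = hf by rewrite /hf /hk fmorphV rmorph_nat.
pose T := emb (r 0 0) + emb (r 0 1) * (f - hf * g * D f) + emb (r 0 2%:R) * g + emb (r 0 3%:R) * (hf * D f).
have TE : mmap emb Phi (linear_form r) = T.
  by rewrite mmap_linear_form sum_ord4 /contact_lift /= mulr1 hfE.
have h2 : 1 - hf = hf.
  have two : 2%:R != 0 :> K by exact: (natK_neq0 emb 1).
  by rewrite -hfE; field.
have D1 : D T = emb (r 0 1) * (hf * D f - hf * g * D (D f)) + emb (r 0 2%:R) + emb (r 0 3%:R) * (hf * D (D f)).
  rewrite /T !((derD hD), (derN hD), (derCM hD), (derC hD), (derM hD), Dg).
  transitivity (emb (r 0 1) * ((1 - hf) * D f - hf * g * D (D f)) + emb (r 0 2%:R) +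
    emb (r 0 3%:R) * (hf * D (D f))); last by rewrite h2.
  by ring.
have D2 : D (D T) = emb (r 0 1) * (- (hf * g * D (D (D f)))) + emb (r 0 3%:R) * (hf * D (D (D f))).
  rewrite D1 !((derD hD), (derN hD), (derCM hD), (derC hD), (derM hD), Dg); ring.
have C' d := pgC gx d.
have T0 : reg x T (r 0 0 + r 0 1 * (p - hk * c * q) + r 0 2%:R * c + r 0 3%:R * (hk * q)).
  by do ?[exact: C'|apply: (pgB gx) => //|apply: (pgD gx) => //|apply: (pgM gx) => //].
have T1 : reg x (D T) (r 0 1 * (hk * q - hk * c * m) + r 0 2%:R + r 0 3%:R * (hk * m)).
  by rewrite D1; do ?[exact: C'|apply: (pgB gx) => //|apply: (pgD gx) => //|apply: (pgM gx) => //].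
have T2 : reg x (D (D T)) (r 0 1 * (- (hk * c * l)) + r 0 3%:R * (hk * l)).
  by rewrite D2; do ?[exact: C'|apply: (pgB gx) => //|apply: (pgD gx) => //|apply: (pgM gx) => //|apply: (pgN gx) => //].
have dT : dom (reg x) T by eexists; exact: T0.
have hk0 : hk != 0 by rewrite invr_eq0 pnatr_eq0.
rewrite TE; split=> //; rewrite order_three //.
have -> : (exists s, r = s *: (rep y *m B)) <-> exists s, r = s *: (v *m B).
  rewrite yE -scalemxAl; split=> [[s ->]|[s ->]]; first by exists (s * a); rewrite scalerA.
  by exists (s / a); rewrite scalerA divfK.
rewrite mul_symplectic; split=> [[q0 q1 q2]|[s rE]].
  have e2 := pg_fun gx T2 q2; have e1 := pg_fun gx T1 q1; have e0 := pg_fun gx T0 q0.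
  have r3 : r 0 3%:R = c * r 0 1.
    apply/eqP; rewrite -subr_eq0; apply/eqP; apply: (mulfI (mulf_neq0 hk0 l0)).
    by rewrite mulr0 -[RHS]e2; ring.
  rewrite r3 in e1 e0.
  have r2 : r 0 2%:R = - (hk * q) * r 0 1.
    by apply/eqP; rewrite -subr_eq0; apply/eqP; rewrite -[RHS]e1; ring.
  rewrite r2 in e0.
  have r0 : r 0 0 = - (p - hk * c * q) * r 0 1.
    by apply/eqP; rewrite -subr_eq0; apply/eqP; rewrite -[RHS]e0; ring.
  exists (r 0 1); apply/rowP; apply: forall_ord4; rewrite !mxE /=.
  - by rewrite r0 mulrC.
  - by rewrite mulr1.
  - by rewrite r2 mulrC.
  - by rewrite r3 mulrC.
have s0 i : r 0 i = s * (vec4 [:: - v 0 1; v 0 0; - v 0 3%:R; v 0 2%:R]) 0 i by rewrite rE mxE.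
have r0 := s0 0; have r1 := s0 1; have r2 := s0 2%:R; have r3 := s0 3%:R.
rewrite !mxE /= -/hk in r0 r1 r2 r3.
split.
- have <- : r 0 0 + r 0 1 * (p - hk * c * q) + r 0 2%:R * c + r 0 3%:R * (hk * q) = 0 by rewrite r0 r1 r2 r3; ring.
  exact: T0.
- have <- : r 0 1 * (hk * q - hk * c * m) + r 0 2%:R + r 0 3%:R * (hk * m) = 0 by rewrite r1 r2 r3; ring.
  exact: T1.
- have <- : r 0 1 * (- (hk * c * l)) + r 0 3%:R * (hk * l) = 0 by rewrite r1 r3; ring.
  exact: T2.
Qed.

(** Both directions transport the condition between germs on the image and divisibility by t^3 in
    the local ring at x, which is the local ring at y. *)
Lemma osculates_lift (a : dual_proj k 3) : E y ->
  (osculates E 2 y a <-> exists s, rep a = s *: (rep y *m B)).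
Proof.
move=> Ey; have gy := reg_graph gE Ey.
have [dL LE] := osculating_form (rep a); set L := mmap emb Phi _ in dL LE.
have hL := linear_form_homog (rep a).
rewrite -LE; split.
  move=> [_ [b by0 [N [cf [tf [hc ht [U [oU Uy sE]]]]]]]].
  have hb := linear_form_homog b.
  have bz z : (ev (linear_form b) (rep z) != 0) = (pairing b (rep z) != 0) by rewrite ev_linear_form.
  have [qc qcE] := choice (fun i => germ_fraction Ey (hc i)).
  have exq (ij : 'I_N * 'I_3) : exists q, regE y q (tf ij.1 ij.2 y) /\
      finite_set [set z | E z /\ ~ regE z q (tf ij.1 ij.2 z)].
    by case: (ht ij.1 ij.2) => rt _; exact: germ_fraction.
  have [qt qtE] := choice exq.
  pose bad := (\bigcup_(i in [set: 'I_N]) [set z | E z /\ ~ regE z (qc i) (cf i z)]) `|`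
    ((\bigcup_(ij in [set: 'I_N * 'I_3]) [set z | E z /\ ~ regE z (qt ij) (tf ij.1 ij.2 z)]) `|`
    ((~` U `&` E) `|` [set z | E z /\ ev (linear_form b) (rep z) = 0])).
  have fbad : finite_set bad.
    rewrite !finite_setU; split; [|split; [|split]].
    - by apply: bigcup_finite => [|i _]; [exact: finite_finset|have [] := qcE i].
    - by apply: bigcup_finite => [|i _]; [exact: finite_finset|have [] := qtE i].
    - have [cEz _ _] := cE; apply: (curve_proper_finite cE); first exact: zclosedI.
        by move=> z [].
      by move=> H; have [] := H y Ey.
    - by apply: (curve_zeros_finite cE); [exists 1%N|exists y => //; rewrite bz].
  pose Q := \sum_i qc i * \prod_j qt (i, j).
  (* The germ identity holds at all points outside [bad], so it is an identity in K. *)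
  have LQ : L / mmap emb Phi (linear_form b) = Q.
    apply/eqP; rewrite -subr_eq0; apply/eqP; apply: (reg_all0 gE cE) => fin.
    have fin2 := conj fin fbad; rewrite -finite_setU in fin2.
    apply: (curve_infinite cE); apply: sub_finite_set fin2 => z Ez.
    have [bz'|nb] := pselect (bad z); [by right|left; split=> //].
    have gz := reg_graph gE Ez; move: nb => /not_orP[n1 /not_orP[n2 /not_orP[n3 n4]]].
    have Uz : U z by apply: contrapT => nU; apply: n3.
    have bzn : ev (linear_form b) (rep z) != 0 by apply/eqP => e; apply: n4.
    rewrite -[X in regE _ _ X](subrr (pairing (rep a) (rep z) / pairing b (rep z))); apply: (pgB gz).
      by rewrite -!ev_linear_form; exact: (reg_frac emb Phi hL hb bzn).
    rewrite (sE z Ez Uz).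
    apply: (@pg_sum _ _ _ (regE z) _ _ xpredT _ (fun i => cf i z * \prod_j tf i j z) gz) => i _.
    apply: (pgM gz); first by apply: contrapT => nr; apply: n1; exists i.
    apply: (@pg_prod _ _ _ (regE z) _ _ xpredT (fun j => qt (i, j)) (fun j => tf i j z) gz) => j _.
    by apply: contrapT => nr; apply: n2; exists (i, j).
  have rx q e : regE y q e -> reg x q e by exact: (regD_reg gw Cx pxy).
  have [s s0 sy] := pxy.
  have bK : mmap emb Phi (linear_form b) != 0.
    by apply: (gen_neq0 gE _ Ey); [exists 1%N|rewrite bz].
  have db : dom (reg x) (mmap emb Phi (linear_form b)) by have [] := osculating_form b.
  exists ((\sum_i qc i * \prod_j (qt (i, j) / t)) * mmap emb Phi (linear_form b)).
    apply: (domM gw) => //; apply: (dom_sum gw) => // i; apply: (domM gw) => //.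
      by have [r _] := qcE i; exists (cf i y); exact: rx.
    apply: (big_ind (fun q => dom (reg x) q)) => [|p q|j _]; [exact: (dom1 gw)|exact: (domM gw)|].
    apply: (unif_div ug); have [r _] := qtE (i, j); have [_ e] := ht i j.
    by rewrite -e; exact: rx.
  rewrite -[L](divfK bK) LQ mulrA; congr (_ * _); rewrite /Q mulr_sumr; apply: eq_bigr => i _.
  rewrite prodf_div prodr_const card_ord; have tn := expf_neq0 3 (unif_neq0 ug : t != 0).
  by rewrite mulrCA; congr (_ * _); rewrite mulrC divfK.
move=> [u [cu ru] Lu]; have tn : t != 0 := unif_neq0 ug.
have ry q e : reg x q e -> regE y q e by exact: (reg_regD gw hC hsm imE iE Cx pxy).
have [d [F [G [hF hG Gy uE cuE]]]] := ry _ _ ru.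
have [d' [F' [G' [hF' hG' Gy' tE tE0]]]] := ry _ _ (unif0 ug : reg x t 0).
(* The first coordinate of [Phi] is 1, so X_0 is a denominator for the local equation that leaves L
   = t^3 u unchanged in K. *)
have y0 : rep y 0 0 != 0.
  have [p fp] := df; have [q fq] := dD df; have pv := pval_finite gw Cx gc fp fq.
  set v := vec4 _ in pv.
  have v1 : v 0 0 != 0 by rewrite mxE oner_neq0.
  have vn : v != 0 by apply/eqP => /rowP/(_ 0) e; move: v1; rewrite e mxE eqxx.
  have [e e0 ->] := pval_uniq gw Cx vn (rep_neq0 y) pv pxy.
  by rewrite mxE mulf_neq0.
have pX (z : proj k 3) : pairing (delta_mx 0 0) (rep z) = rep z 0 0.
  by rewrite /pairing sum_ord4 !mxE /= !mul0r !addr0 mul1r.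
pose U := [set z : proj k 3 | ev (G * G' * 'X_0) (rep z) != 0].
have hU : hom (G * G' * 'X_0).
  by do ?[apply: homM]; [exists d|exists d'|exists 1%N; exact: hom_coord].
have UE z : U z -> [/\ ev G (rep z) != 0, ev G' (rep z) != 0 & rep z 0 0 != 0].
  by rewrite /U /= !evM evXU !mulf_eq0 !negb_or => /andP[/andP[]].
have Uy : U y by rewrite /U /= !evM evXU !mulf_neq0.
have oU : zopen U by exact: zopen_form.
have rz z : E z -> U z -> pairing (rep a) (rep z) / pairing (delta_mx 0 0) (rep z) =
    ev F (rep z) / ev G (rep z) * (ev F' (rep z) / ev G' (rep z)) ^+ 3.
  move=> Ez /UE[Gz Gz' z0]; have gz := reg_graph gE Ez.
  have r1 : regE z (u * t ^+ 3) (ev F (rep z) / ev G (rep z) * (ev F' (rep z) / ev G' (rep z)) ^+ 3).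
    rewrite uE tE; apply: (pgM gz); first exact: (reg_frac emb Phi hF hG Gz).
    by apply: (pgX _ gz); exact: (reg_frac emb Phi hF' hG' Gz').
  have hX := @hom_coord k 3 0; have Xz : ev 'X_0 (rep z) != 0 by rewrite evXU.
  have := reg_frac emb Phi hL hX Xz; rewrite -/L mmapX mmap1U divr1 Lu mulrC ev_linear_form evXU -pX => r2.
  exact: (pg_fun gz r2 r1).
split.
  have : reg x L 0.
    rewrite Lu exprS -mulrA mulrC; apply: (regM0 gw Cx); last exact: unif0.
    by apply: (domM gw) => //; [exact: (domX gw)|exists cu].
  have [s s0 sy] := pxy => L0; rewrite /hyperplane /= -ev_linear_form.
  have := pg_mmap (linear_form (rep a)) gx sy; rewrite (mmap_scale emb Phi s hL) -/L expr1 => r1.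
  have r0 : reg x (s * L) 0; last exact: (pg_fun gx r1 r0).
  have Phi0 : Phi 0 = 1 by [].
  have ds : dom (reg x) s by exists (rep y 0 0); have := sy 0; rewrite Phi0 mulr1.
  exact: (regM0 gw Cx).
exists (delta_mx 0 0); first by rewrite pX.
exists 1%N, (fun _ z => ev F (rep z) / ev G (rep z)), (fun _ _ z => ev F' (rep z) / ev G' (rep z)); split.
- move=> _; exists U; split=> //; exists d, F, G; split=> // z _ /UE[Gz _ _]; by [].
- move=> _ _; split; last by rewrite -tE0.
  exists U; split=> //; exists d', F', G'; split=> // z _ /UE[_ Gz _]; by [].
- exists U; split=> // z Ez Uz; rewrite rz // big_ord1 prodr_const card_ord; by [].
Qed.

End AtOrdinary.

(** The open set omits the images of the finitely many points that are not ordinary. A form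
    vanishing on the remaining osculating planes pulls back under B to a form with infinitely many
    zeros on the curve, hence vanishes on the whole linear image, which is itself closed. *)
Lemma lift_osculating_self_dual : osculating_self_dual E.
Proof.
split; [exact: cE|exact: lift_nonplanar|].
exists (linear_image B E), B; split=> //; last exact: symplectic_unit.
pose bad := [set x | C x /\ ~ ordinary x].
pose Y := [set y | exists2 x, bad x & pval emb w Phi x (rep y)].
have [y0 Ey0] := infinite_setN0 (curve_infinite cE).
have exy x : exists y, C x -> pval emb w Phi x (rep y).
  have [Cx|nC] := pselect (C x); last by exists y0.
  have [v v0 pv] := pval_exists gw hC hsm nE Cx.
  have [y Ey yv] := image_intro Cx v0 pv; exists y => _.
  by have [e e0 ->] := rep_val yv; exact: (pvalZ gw).
have [phi phiE] := choice exy.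
have fY : finite_set Y.
  apply: sub_finite_set (finite_image phi ordinary_cofinite) => y [x [Cx nx] py].
  by exists x; [|apply: (lift_point Cx _ py); exact: phiE].
have good y : E y -> ~ Y y -> forall a, osculates E 2 y a <-> exists s, rep a = s *: (rep y *m B).
  move=> Ey nY a; have [x Cx py] := image_rep gw Ey.
  have [[c uc] df dl] : ordinary x by apply: contrapT => no; apply: nY; exists x.
  exact: (osculates_lift Cx py uc df dl).
have yB (y : proj k 3) : rep y *m B != 0.
  apply/eqP => e; have := rep_neq0 y.
  by rewrite -[rep y](mulmxK (symplectic_unit k)) e mul0mx eqxx.
have spans (y : proj k 3) (a : dual_proj k 3) :
    (exists s, rep a = s *: (rep y *m B)) <-> val a = <[rep y *m B]>%VS.
  split=> [[s e]|/rep_val[s _ e]]; last by exists s.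
  have s0 : s != 0 by apply/eqP => s0; have := rep_neq0 a; rewrite e s0 scale0r eqxx.
  by rewrite val_rep e vlineZ.
exists (~` Y); split.
- exact: zopen_finite.
- have [y Ey nY] := infinite_avoid cE fY; by exists y.
- move=> y Ey nY; have [a aE] := exists_point (yB y).
  exists a; split; first by apply/good => //; apply/spans.
  move=> a' /good H; have /spans e := H Ey nY.
  by apply: val_inj; rewrite aE e.
move=> U oU UY [y1 [Ey1 Uy1]].
have fU : finite_set (~` U `&` E).
  have [cEz _ _] := cE; apply: (curve_proper_finite cE); first exact: zclosedI.
    by move=> z [].
  by move=> H; have [] := H y1 Ey1.
apply/seteqP; split=> a.
  move=> [y Ey ay] Z cZ SZ; apply: contrapT => nZ.
  have [F [hF FZ Fa]] := zclosed_sep cZ nZ.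
  have hG := subst_linear_hom B hF.
  have fin : finite_set [set z | E z /\ ev (subst_linear B F) (rep z) = 0].
    apply: (curve_zeros_finite cE) => //; exists y => //.
    rewrite ev_subst_linear; have [s s0 e] := rep_val ay; have [d hd] := hF.
    by move: Fa; rewrite e (ev_scale _ _ hd) mulf_eq0 negb_or => /andP[].
  have fin2 := conj fin fU; rewrite -finite_setU in fin2.
  apply: (curve_infinite cE); apply: sub_finite_set fin2 => z Ez.
  have [Uz|nU] := pselect (U z); [left; split=> //|by right].
  have [b bE] := exists_point (yB z).
  have Zb : Z b by apply: SZ; exists z => //; apply/good => //; [exact: UY|apply/spans].
  rewrite ev_subst_linear; apply/eqP; rewrite -(ev_val_eq0 hF bE); apply/eqP; exact: FZ.
move=> H; apply: (H (linear_image B E)).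
  by apply: linear_image_closed; [exact: symplectic_unit|have [] := cE].
move=> b [y [Ey Uy] /good Hb]; exists y => //; apply/spans; apply: Hb => //; exact: UY.
Qed.

End Osculation.

Theorem proposition4p6 (R : realType) (n : nat) (C : set (proj R[i] n))
    (hC : curve C) (hsm : smooth C) :
  (exists B : 'M[R[i]]_4, contact_form B /\
     exists D : set (proj R[i] 3),
       curve D /\ isomorphic C D /\ legendrian B D) /\
  (exists D : set (proj R[i] 3),
     curve D /\ isomorphic C D /\ osculating_self_dual D).
Proof.
have [_ irrC _] := hC.
have [K [emb [w gw]]] := exists_generic irrC.
have [D [g [f lift]]] := @exists_lift R[i] n K emb w C gw hC hsm.
have cE := lift_curve gw hC hsm lift; have iE := lift_isomorphic gw hC hsm lift.
split.
  exists (symplectic R[i]); split; first exact: symplectic_contact.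
  by exists (image_curve emb w C (contact_lift D g f)); split=> //; split=> //; exact: (lift_legendrian gw hC hsm lift).
by exists (image_curve emb w C (contact_lift D g f)); split=> //; split=> //; exact: (lift_osculating_self_dual gw hC hsm lift).
Qed.
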